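(* Let $T>0$, let $\phi_0,\psi_0$ be real-valued initial data and let $z$ be the solution of the periodic ''good'' Boussinesq equation $$z_{tt}+z_{xxxx}-z_{xx}-(z^2)_{xx}=0,\quad x\in\mathbb{T},\ t>0,\qquad z(0,x)=\phi_0(x),\quad z_t(0,x)=\psi_0(x).$$ Let $r\ge 1$ and suppose $z\in C(0,T;H^{r+p(r)})$ and $z_t\in C(0,T;H^{r+p(r)-2})$. Let $z^n,z^n_t$ be the numerical approximations produced by the scheme described in the context with step size $\tau$ and $t_n=n\tau$. Then there exists $\tau_0>0$ such that for all $0<\tau\le\tau_0$ and all $n$ with $t_n\le T$, $$\|z(t_n)-z^n\|_r+\|z_t(t_n)-z^n_t\|_{r-2}\le C\tau,$$ where $C>0$ depends on $T$, $\|z\|_{L^\infty(0,T;H^{r+p(r)})}$ and $\|z_t\|_{L^\infty(0,T;H^{r+p(r)-2})}$.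
   Context: $\mathbb{T}=[-\pi,\pi]$ with periodic boundary conditions. For $f\in L^2(\mathbb{T})$, $\widehat f_k=\frac{1}{2\pi}\int_{\mathbb T}f(x)e^{-ikx}dx$, so $f=\sum_{k\in\mathbb Z}\widehat f_ke^{ikx}$. For $s\in\mathbb R$, $H^s$ is the space with norm $\|f\|_s^2=\sum_k(1+k^2)^s|\widehat f_k|^2$, and $\|f\|=\|f\|_0$. $\bar f$ denotes complex conjugation. Fourier multipliers: $\partial_x^{-m}$ ($m\ge1$) has symbol $(ik)^{-m}$ for $k\ne0$ and $0$ for $k=0$; $\partial_x^m$ has symbol $(ik)^m$; $e^{it\partial_x^2}$ has symbol $e^{-itk^2}$; $\langle\partial_x^2\rangle$ has symbol $\sqrt{k^2+k^4}$; $\langle\partial_x^2\rangle^{-1}$ has symbol $(k^2+k^4)^{-1/2}$ for $k\neq0$ and $0$ for $k=0$; $e^{i\tau\langle\partial_x^2\rangle}$ has symbol $e^{i\tau\sqrt{k^2+k^4}}$. Let $B=\langle\partial_x^2\rangle^{-1}\partial_x^2$ and $B^\tau f=Be^{i\tau\langle\partial_x^2\rangle}f$. Let $\psi_1(y)=\int_0^1e^{ys}ds$ and $\psi_1(2i\tau\partial_x^2)$ the multiplier with symbol $\psi_1(-2i\tau k^2)$. Define, for a function $f$: $L_1^\tau(f)=-\frac i2\partial_x^{-2}[(e^{2i\tau\partial_x^2}\partial_x^{-2}\bar f)(\partial_x^2\bar f)]+\frac i2\partial_x^{-2}[(\partial_x^2\bar f)(\partial_x^{-2}\bar f)]$; $L_2^\tau(f)=-\frac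 i2e^{i\tau\partial_x^2}\partial_x^{-3}[(e^{i\tau\partial_x^2}\partial_x\bar f)(e^{-i\tau\partial_x^2}\bar f)]+\frac i2\partial_x^{-3}[(\partial_x\bar f)\bar f]-\tau\partial_x^{-2}[(\partial_x^2\bar f)\bar f]$; $L_3^\tau(f)=-i\partial_x^{-4}(e^{2i\tau\partial_x^2}-1)(\partial_x\bar f)^2$; $L_4^\tau(f)=i\partial_x^{-2}e^{-i\tau\partial_x^2}(e^{i\tau\partial_x^2}\bar f)^2-i\partial_x^{-2}(\bar f)^2-2\tau\partial_x^{-2}(\partial_x\bar f)^2$; $I_1^\tau(f)=\frac i2[(\partial_x^{-1}f)^2-e^{i\tau\partial_x^2}(e^{-i\tau\partial_x^2}\partial_x^{-1}f)^2]$; $I_2^\tau(f)=-\frac i2e^{i\tau\partial_x^2}\partial_x^{-1}[(e^{-i\tau\partial_x^2}f)(e^{i\tau\partial_x^2}\partial_x^{-1}\bar f)]+\frac i2\partial_x^{-1}[f\,\partial_x^{-1}\bar f]+\tau\|f\|^2$. Let $a=\frac1{2\pi}\int_{\mathbb T}\psi_0dx$, $b=\frac1{2\pi}\int_{\mathbb T}\phi_0dx$, and for $t_n=n\tau$ $$\Psi_1^\tau(f)=e^{i\tau\langle\partial_x^2\rangle}f-\frac i4B^\tau\big[2L_1^\tau(f)+2L_2^\tau(f)+L_3^\tau(f)+L_4^\tau(f)+I_1^\tau(f)+2I_2^\tau(f)\big]-i\tau(at_n+b)B^\tau\big(f+\psi_1(2i\tau\partial_x^2)\bar f\big).$$ The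 scheme: $u^0=\phi_0-b-i\langle\partial_x^2\rangle^{-1}(\psi_0-a)$, $u^{n+1}=\Psi_1^\tau(u^n)$ (with $t_n$ in $\Psi_1^\tau$), and $z^n=\frac12(u^n+\overline{u^n})+at_n+b$, $z^n_t=\frac i2\langle\partial_x^2\rangle(u^n-\overline{u^n})+a$. The function $p$ on $[1,\infty)$: $p(1)=1$; $p(r)=(3-2r)+$ for $1<r\le7/6$; $p(r)=2/3$ for $7/6<r\le17/12$; $p(r)=(7/2-2r)+$ for $17/12<r\le3/2$; $p(r)=5/4-r/2$ for $3/2<r<5/2$; $p(5/2)=0+$; $p(r)=0$ for $r>5/2$. Here $c+$ means: the statement holds with $c+\varepsilon$ in place of $p(r)$ for every sufficiently small $\varepsilon>0$ (constants may then depend on $\varepsilon$). *)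

(* Defs.v *)
From Stdlib Require Import Reals ZArith.
From Coquelicot Require Import Coquelicot.
Open Scope R_scope.

(* A (periodic) function on T = [-pi,pi] is represented by its Fourier
   coefficient sequence  k |-> \hat f_k,  f = sum_k \hat f_k e^{ikx}. *)
Definition Fc := Z -> C.

Definition sumZ_term (a : Z -> R) (n : nat) : R :=
  match n with O => a 0%Z | S _ => a (Z.of_nat n) + a (- Z.of_nat n)%Z end.
Definition ex_sumZ (a : Z -> R) : Prop := ex_series (sumZ_term a).
Definition sumZ (a : Z -> R) : R := Series (sumZ_term a).
Definition CsumZ (a : Z -> C) : C :=
  (sumZ (fun k => Re (a k)), sumZ (fun k => Im (a k))).

Definition Hs_w (s : R) (f : Fc) (k : Z) : R :=
  Rpower (1 + IZR k ^ 2) s * (Cmod (f k)) ^ 2.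
Definition in_Hs (s : R) (f : Fc) : Prop := ex_sumZ (Hs_w s f).
Definition Hs_norm (s : R) (f : Fc) : R := sqrt (sumZ (Hs_w s f)).
Definition L2_norm (f : Fc) : R := Hs_norm 0 f.

Definition fadd (f g : Fc) : Fc := fun k => Cplus (f k) (g k).
Definition fsub (f g : Fc) : Fc := fun k => Cminus (f k) (g k).
Definition fscal (c : C) (f : Fc) : Fc := fun k => Cmult c (f k).
Definition fconst (c : C) : Fc := fun k => if Z.eq_dec k 0 then c else RtoC 0.
(* complex conjugation of the function: \hat{\bar f}_k = conj (\hat f_{-k}) *)
Definition fconj (f : Fc) : Fc := fun k => Cconj (f (- k)%Z).
(* product of functions: \hat{(fg)}_k = sum_m \hat f_m \hat g_{k-m} *)
Definition fmul (f g : Fc) : Fc := fun k => CsumZ (fun m => Cmult (f m) (g (k - m)%Z)).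
Definition fsq (f : Fc) : Fc := fmul f f.

Definition mult (sym : Z -> C) (f : Fc) : Fc := fun k => Cmult (sym k) (f k).
Definition cexpi (th : R) : C := (cos th, sin th).
Definition cexp (y : C) : C := (exp (Re y) * cos (Im y), exp (Re y) * sin (Im y)).
Definition dx (m : nat) : Fc -> Fc := mult (fun k => Cpow (Cmult Ci (RtoC (IZR k))) m).
Definition dxinv (m : nat) : Fc -> Fc :=
  mult (fun k => if Z.eq_dec k 0 then RtoC 0 else Cinv (Cpow (Cmult Ci (RtoC (IZR k))) m)).
(* e^{i t d^2} : symbol e^{-i t k^2} *)
Definition Sgrp (t : R) : Fc -> Fc := mult (fun k => cexpi (- t * IZR k ^ 2)).
Definition bsym (k : Z) : R := sqrt (IZR k ^ 2 + IZR k ^ 4).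
Definition bracket : Fc -> Fc := mult (fun k => RtoC (bsym k)).
Definition bracket_inv : Fc -> Fc :=
  mult (fun k => if Z.eq_dec k 0 then RtoC 0 else RtoC (/ bsym k)).
Definition Egrp (tau : R) : Fc -> Fc := mult (fun k => cexpi (tau * bsym k)).
Definition Bop (f : Fc) : Fc := bracket_inv (dx 2 f).
Definition Btau (tau : R) (f : Fc) : Fc := Bop (Egrp tau f).
Definition psi1 (y : C) : C :=
  (RInt (fun s => Re (cexp (Cmult y (RtoC s)))) 0 1,
   RInt (fun s => Im (cexp (Cmult y (RtoC s)))) 0 1).
(* psi_1(2 i tau d^2) : symbol psi_1(-2 i tau k^2) *)
Definition psi1op (tau : R) : Fc -> Fc :=
  mult (fun k => psi1 (Cmult (RtoC (- 2 * tau * IZR k ^ 2)) Ci)).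

Definition ci (x : R) : C := Cmult (RtoC x) Ci.

Definition L1 (tau : R) (f : Fc) : Fc :=
  let fb := fconj f in
  fadd (fscal (ci (- / 2)) (dxinv 2 (fmul (Sgrp (2 * tau) (dxinv 2 fb)) (dx 2 fb))))
       (fscal (ci (/ 2)) (dxinv 2 (fmul (dx 2 fb) (dxinv 2 fb)))).

Definition L2 (tau : R) (f : Fc) : Fc :=
  let fb := fconj f in
  fsub (fadd (fscal (ci (- / 2)) (Sgrp tau (dxinv 3 (fmul (Sgrp tau (dx 1 fb)) (Sgrp (- tau) fb)))))
             (fscal (ci (/ 2)) (dxinv 3 (fmul (dx 1 fb) fb))))
       (fscal (RtoC tau) (dxinv 2 (fmul (dx 2 fb) fb))).

Definition L3 (tau : R) (f : Fc) : Fc :=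
  let g := fsq (dx 1 (fconj f)) in
  fscal (ci (- 1)) (dxinv 4 (fsub (Sgrp (2 * tau) g) g)).

Definition L4 (tau : R) (f : Fc) : Fc :=
  let fb := fconj f in
  fsub (fsub (fscal (ci 1) (dxinv 2 (Sgrp (- tau) (fsq (Sgrp tau fb)))))
             (fscal (ci 1) (dxinv 2 (fsq fb))))
       (fscal (RtoC (2 * tau)) (dxinv 2 (fsq (dx 1 fb)))).

Definition I1 (tau : R) (f : Fc) : Fc :=
  fscal (ci (/ 2)) (fsub (fsq (dxinv 1 f)) (Sgrp tau (fsq (Sgrp (- tau) (dxinv 1 f))))).

Definition I2 (tau : R) (f : Fc) : Fc :=
  let fb := fconj f in
  fadd (fadd (fscal (ci (- / 2)) (Sgrp tau (dxinv 1 (fmul (Sgrp (- tau) f) (Sgrp tau (dxinv 1 fb))))))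
             (fscal (ci (/ 2)) (dxinv 1 (fmul f (dxinv 1 fb)))))
       (fconst (RtoC (tau * L2_norm f ^ 2))).

Definition Psi1 (tau tn a b : R) (f : Fc) : Fc :=
  let brk := fadd (fadd (fadd (fadd (fadd (fscal (RtoC 2) (L1 tau f)) (fscal (RtoC 2) (L2 tau f)))
                                    (L3 tau f)) (L4 tau f)) (I1 tau f)) (fscal (RtoC 2) (I2 tau f)) in
  fsub (fsub (Egrp tau f) (fscal (ci (/ 4)) (Btau tau brk)))
       (fscal (ci (tau * (a * tn + b))) (Btau tau (fadd f (psi1op tau (fconj f))))).

(* a = mean of psi0 = \hat psi0_0, b = mean of phi0 = \hat phi0_0 (both real for real data) *)
Definition mean_a (psi0 : Fc) : R := Re (psi0 0%Z).
Definition mean_b (phi0 : Fc) : R := Re (phi0 0%Z).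

Definition u0 (phi0 psi0 : Fc) : Fc :=
  fsub (fsub phi0 (fconst (RtoC (mean_b phi0))))
       (fscal Ci (bracket_inv (fsub psi0 (fconst (RtoC (mean_a psi0)))))).

Fixpoint u_n (tau : R) (phi0 psi0 : Fc) (n : nat) : Fc :=
  match n with
  | O => u0 phi0 psi0
  | S m => Psi1 tau (INR m * tau) (mean_a psi0) (mean_b phi0) (u_n tau phi0 psi0 m)
  end.

Definition z_n (tau : R) (phi0 psi0 : Fc) (n : nat) : Fc :=
  let u := u_n tau phi0 psi0 n in
  fadd (fscal (RtoC (/ 2)) (fadd u (fconj u)))
       (fconst (RtoC (mean_a psi0 * (INR n * tau) + mean_b phi0))).

Definition zt_n (tau : R) (phi0 psi0 : Fc) (n : nat) : Fc :=
  let u := u_n tau phi0 psi0 n in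
  fadd (fscal (ci (/ 2)) (bracket (fsub u (fconj u)))) (fconst (RtoC (mean_a psi0))).

Definition real_valued (f : Fc) : Prop := forall k, f (- k)%Z = Cconj (f k).

Definition cont_Hs (s T : R) (z : R -> Fc) : Prop :=
  (forall t, 0 <= t <= T -> in_Hs s (z t)) /\
  (forall t, 0 <= t <= T -> forall eps, 0 < eps -> exists delta, 0 < delta /\
     forall t', 0 <= t' <= T -> Rabs (t' - t) < delta -> Hs_norm s (fsub (z t') (z t)) < eps).

(* (z, z_t) solves z_tt + z_xxxx - z_xx - (z^2)_xx = 0 on (0,T), z(0)=phi0, z_t(0)=psi0,
   written Fourier-mode-wise:  d/dt \hat z_k = \hat{z_t}_k,
   d/dt \hat{z_t}_k = -(k^4+k^2) \hat z_k - k^2 \hat{(z^2)}_k. *)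
Definition boussinesq_sol (T : R) (phi0 psi0 : Fc) (z zt : R -> Fc) : Prop :=
  z 0 = phi0 /\ zt 0 = psi0 /\
  forall k, forall t, 0 < t < T ->
    is_derive (fun s => Re (z s k)) t (Re (zt t k)) /\
    is_derive (fun s => Im (z s k)) t (Im (zt t k)) /\
    let rhs := Cminus (Cmult (RtoC (- (IZR k ^ 4 + IZR k ^ 2))) (z t k))
                      (Cmult (RtoC (IZR k ^ 2)) (fsq (z t) k)) in
    is_derive (fun s => Re (zt s k)) t (Re rhs) /\
    is_derive (fun s => Im (zt s k)) t (Im rhs).

(* p(r), with the "c+" cases replaced by c + eps *)
Definition p_eps (r eps : R) : R :=
  if Rle_dec r 1 then 1
  else if Rle_dec r (7/6) then 3 - 2 * r + eps
  else if Rle_dec r (17/12) then 2/3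
  else if Rle_dec r (3/2) then 7/2 - 2 * r + eps
  else if Rlt_dec r (5/2) then 5/4 - r / 2
  else if Rle_dec r (5/2) then eps
  else 0.

(* Main.v *)
Require Import Defs.
From Stdlib Require Import Reals ZArith List FinFun Lra Lia Psatz Bool.
From Coquelicot Require Import Coquelicot.
Import Defs ListNotations.
Open Scope R_scope.

(** With [u = z - (a t + b) - i <d^2>^{-1} (z_t - a)] the equation becomes [u_t = i <d^2> u - i B z^2].
    Replacing [<d^2>] by [-d^2] in the twisted variable costs [O(tau)] under the integral, since
    [k^2 <= sqrt (k^2 + k^4) <= k^2 + 1], and the scheme then integrates the [u^2] and [u ubar]
    interactions of frequencies [j + l = k] exactly.  For the [ubar^2] interaction it replaces each
    of three factorizations [a b] of the phase by [a + b - 1]; the defect [(a - 1) (b - 1)] is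
    [O(tau)] times [|l|^3 / |k|] if [|k|] is the smallest of [|j|, |l|, |k|], and times
    [min (j^2, l^2)] otherwise.  By Schur-type estimates this symbol maps [H^s x H^s] to [H^r] as soon
    as [s = r/2 + 5/4 < 5/2] or [s >= r] and [s > 5/2], which [r + p(r)] always dominates.  The symbols
    of the scheme are bounded by [tau (j^2 + l^2) / k^2], hence stability in [H^r] for [r >= 1], and
    the discrete Gronwall argument concludes.  That the solution stays real-valued, which the
    reconstruction of [z] from [u] needs, follows from uniqueness. *)

(** Two obstacles shape the proof. The solution is differentiable in time only mode by mode, so no
    integral of an [H^r]-valued function is formed: the mean value inequality [mvt_nb] replaces
    Duhamel's formula and is applied to the exact twisted variable compared with the increment of
    the scheme, both as functions of the step length. This needs time derivatives of bilinear sums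
    with growing symbols. The value at the start of a step is therefore cut to finitely many modes,
    where termwise differentiation is free, and stability leads back to the full value at the cost
    of [tau^2]. Norms are handled through [nb], a bound on all finite partial sums, so every
    estimate lives on finite lists. The exponent [r/2 + 5/4] balances two counts at once: the number
    of outputs [|k| <= |l|] when the output is the smallest frequency, and the sum of [|j|^(4 - 2s)]
    over [|j| <= |k|] otherwise. The latter is logarithmic at [s = 5/2], whence the [0+] at
    [r = 5/2]. Stability holds with constants that depend on a ball; [tau * growth <= 1] keeps the
    numerical solution within distance 1 of the exact one. *)

(** * Finite sums over lists of integers *)

Definition lsum (a : Z -> R) (L : list Z) : R := fold_right (fun k s => a k + s) 0 L.

Lemma lsum_cons a x L : lsum a (x :: L) = a x + lsum a L.
Proof. reflexivity. Qed.

Lemma lsum_ext a b L : (forall k, In k L -> a k = b k) -> lsum a L = lsum b L.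
Proof.
  induction L as [|x L IH]; simpl; intros H; [reflexivity|].
  rewrite (H x) by now left. rewrite IH; [reflexivity|]. intros; apply H; now right.
Qed.

Lemma lsum_le a b L : (forall k, In k L -> a k <= b k) -> lsum a L <= lsum b L.
Proof.
  induction L as [|x L IH]; simpl; intros H; [lra|].
  assert (a x <= b x) by (apply H; now left).
  assert (lsum a L <= lsum b L) by (apply IH; intros; apply H; now right). lra.
Qed.

Lemma lsum_zero L : lsum (fun _ => 0) L = 0.
Proof. induction L; simpl; lra. Qed.

Lemma lsum_nonneg a L : (forall k, 0 <= a k) -> 0 <= lsum a L.
Proof. intros H. rewrite <- (lsum_zero L). apply lsum_le; auto. Qed.

Lemma lsum_plus a b L : lsum (fun k => a k + b k) L = lsum a L + lsum b L.
Proof. induction L; simpl; lra. Qed.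

Lemma lsum_scal c a L : lsum (fun k => c * a k) L = c * lsum a L.
Proof. induction L as [|x L IH]; simpl; [lra|]. rewrite IH; lra. Qed.

Lemma lsum_app a L L' : lsum a (L ++ L') = lsum a L + lsum a L'.
Proof. induction L; simpl; lra. Qed.

Lemma lsum_map a h L : lsum a (map h L) = lsum (fun k => a (h k)) L.
Proof. induction L; simpl; lra. Qed.

Lemma lsum_swap (a : Z -> Z -> R) L L' :
  lsum (fun k => lsum (fun j => a k j) L') L = lsum (fun j => lsum (fun k => a k j) L) L'.
Proof.
  induction L as [|x L IH]; simpl.
  - symmetry; apply lsum_zero.
  - rewrite IH, <- lsum_plus. reflexivity.
Qed.

(** Removal of one occurrence of [x], described through membership so that [L] may contain
    repetitions. *)
Lemma lsum_split a x L : In x L -> exists L', lsum a L = a x + lsum a L' /\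
  (forall y, In y L <-> y = x \/ In y L') .
Proof.
  intros H. apply in_split in H. destruct H as [l1 [l2 ->]].
  exists (l1 ++ l2). rewrite !lsum_app. simpl. split; [lra|].
  intros y. rewrite !in_app_iff. simpl. intuition.
Qed.

Lemma lsum_incl a L L' :
  (forall k, 0 <= a k) -> NoDup L -> incl L L' -> lsum a L <= lsum a L'.
Proof.
  intros Ha HL; revert L'. induction HL as [|x L Hx HL IH]; intros L' Hi; simpl.
  - now apply lsum_nonneg.
  - destruct (lsum_split a x L') as [L2 [E HI]]. { apply Hi; now left. }
    rewrite E. apply Rplus_le_compat_l. apply IH. intros y Hy.
    assert (In y L') by (apply Hi; now right). apply HI in H.
    destruct H; [subst; contradiction|assumption].
Qed.

Lemma lsum_support a L L' :
  NoDup L -> NoDup L' -> (forall k, a k <> 0 -> In k L) -> (forall k, a k <> 0 -> In k L') ->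
  lsum a L = lsum a L'.
Proof.
  (* The induction drops [x] from both lists, which then no longer contain the whole support; [G]
     therefore only asks each list to contain the support points of the other. *)
  intros HL; revert L'. assert (G : forall L', NoDup L' -> (forall k, In k L' -> a k <> 0 -> In k L) ->
    (forall k, In k L -> a k <> 0 -> In k L') -> lsum a L = lsum a L').
  2:{ intros; apply G; auto. }
  induction HL as [|x L Hx HL IH]; intros L' HL' H1 H2; simpl.
  - rewrite <- (lsum_zero L'). apply lsum_ext. intros k Hk.
    destruct (Req_dec (a k) 0) as [E|E]; [now rewrite E|]. destruct (H1 k Hk E).
  - destruct (Req_dec (a x) 0) as [E|E].
    + rewrite E, Rplus_0_l. apply IH; auto.
      * intros k Hk Ha. destruct (H1 k Hk Ha); [subst; contradiction|assumption].
      * intros k Hk Ha. apply H2; auto. now right.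
    + assert (Hin : In x L') by (apply H2; auto; now left).
      apply in_split in Hin. destruct Hin as [l1 [l2 ->]].
      rewrite lsum_app. simpl. rewrite (IH (l1 ++ l2)); [rewrite lsum_app; lra| | |].
      * now apply NoDup_remove_1 in HL'.
      * intros k Hk Ha. apply NoDup_remove_2 in HL'.
        destruct (H1 k) as [->|]; auto; [|contradiction].
        rewrite in_app_iff in *. simpl. tauto.
      * intros k Hk Ha. assert (In k (l1 ++ x :: l2)) as Hi by (apply H2; auto; now right).
        rewrite in_app_iff in *. simpl in Hi. destruct Hi as [|[->|]]; auto. contradiction.
Qed.

Lemma lsum_CS a b L : (lsum (fun k => a k * b k) L) ^ 2
  <= lsum (fun k => a k ^ 2) L * lsum (fun k => b k ^ 2) L.
Proof.
  induction L as [|x L IH]; [simpl; lra|]. rewrite !lsum_cons.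
  set (P := lsum (fun k => a k * b k) L) in *.
  set (U := lsum (fun k => a k ^ 2) L) in *. set (V := lsum (fun k => b k ^ 2) L) in *.
  assert (HU : 0 <= U) by (apply lsum_nonneg; intros; apply pow2_ge_0).
  assert (HV : 0 <= V) by (apply lsum_nonneg; intros; apply pow2_ge_0).
  enough (2 * (a x * b x) * P <= a x ^ 2 * V + b x ^ 2 * U).
  { replace ((a x * b x + P) ^ 2) with (a x ^ 2 * b x ^ 2 + 2 * (a x * b x) * P + P ^ 2) by ring.
    replace ((a x ^ 2 + U) * (b x ^ 2 + V))
      with (a x ^ 2 * b x ^ 2 + (a x ^ 2 * V + b x ^ 2 * U) + U * V) by ring. lra. }
  set (p := a x) in *. set (q := b x) in *.
  assert (Hp := pow2_ge_0 p). assert (Hq := pow2_ge_0 q).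
  assert (Ht1 := Rmult_le_pos _ _ Hp HV). assert (Ht2 := Rmult_le_pos _ _ Hq HU).
  (* Compared through squares: [4 p^2 q^2 P^2 <= 4 p^2 q^2 U V <= (p^2 V + q^2 U)^2], the first step
     by induction, the second because [(p^2 V - q^2 U)^2 >= 0]. *)
  apply Rsqr_incr_0_var; [|lra]. rewrite !Rsqr_pow2.
  replace ((2 * (p * q) * P) ^ 2) with (4 * (p * q) ^ 2 * P ^ 2) by ring.
  apply Rle_trans with (4 * (p * q) ^ 2 * (U * V)).
  - apply Rmult_le_compat_l; [|assumption]. assert (0 <= (p * q) ^ 2) by apply pow2_ge_0. lra.
  - assert (0 <= (p ^ 2 * V - q ^ 2 * U) ^ 2) by apply pow2_ge_0. nra.
Qed.

(** An injective change of index keeps lists free of duplicates, so a bound on all partial sums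
    survives it. It serves for [k -> -k], [j -> k - j] and translations. *)
Lemma lsum_double_le (g : Z -> R) (h : Z -> Z) A L :
  (forall L, NoDup L -> lsum g L <= A) ->
  (forall x y, h x = h y -> x = y) -> NoDup L -> lsum (fun k => g (h k)) L <= A.
Proof.
  intros Hg Hh HL. rewrite <- lsum_map. apply Hg.
  apply Injective_map_NoDup; auto.
Qed.

(** * Sums over the integers *)

(** The frequency window [|k| <= n], enlarged by a pair of opposite frequencies exactly as the
    partial sums of [sumZ_term] are. *)
Fixpoint zl (n : nat) : list Z :=
  match n with
  | O => [0%Z]
  | S m => Z.of_nat (S m) :: (- Z.of_nat (S m))%Z :: zl m
  end.

Lemma in_zl n k : In k (zl n) <-> (Z.abs k <= Z.of_nat n)%Z.
Proof.
  induction n as [|n IH].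
  - simpl. lia.
  - cbn [zl In]. rewrite IH. lia.
Qed.

Lemma NoDup_zl n : NoDup (zl n).
Proof.
  induction n as [|n IH]; cbn [zl].
  - constructor; [intros []|constructor].
  - constructor; [|constructor; [|assumption]].
    + cbn [In]. rewrite in_zl. lia.
    + rewrite in_zl. lia.
Qed.

Lemma incl_zl L : exists n, incl L (zl n).
Proof.
  induction L as [|x L [n IH]].
  - exists O. intros ? [].
  - exists (n + Z.abs_nat x)%nat. intros y [<-|Hy]; apply in_zl; [lia|].
    apply IH, in_zl in Hy. lia.
Qed.

Lemma sum_n_zl a n : sum_n (sumZ_term a) n = lsum a (zl n).
Proof.
  induction n as [|n IH].
  - rewrite sum_O. simpl. lra.
  - rewrite sum_Sn, IH. cbn [zl lsum fold_right sumZ_term]. unfold plus; simpl.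
    fold (lsum a (zl n)). lra.
Qed.

(** For nonnegative [a] this expresses convergence with sum at most [A], without a limit and without
    an order of summation. *)
Definition sumb (a : Z -> R) (A : R) : Prop := forall L, NoDup L -> lsum a L <= A.

Lemma sumb_ex a A : (forall k, 0 <= a k) -> sumb a A -> ex_sumZ a.
Proof.
  intros Ha HA. unfold ex_sumZ, ex_series.
  destruct (ex_finite_lim_seq_incr (sum_n (sumZ_term a)) A) as [l Hl].
  - intros n. rewrite !sum_n_zl. simpl.
    assert (H1 := Ha (Z.pos (Pos.of_succ_nat n))). assert (H2 := Ha (Z.neg (Pos.of_succ_nat n))).
    fold (lsum a (zl n)). lra.
  - intros n. rewrite sum_n_zl. apply HA, NoDup_zl.
  - exists l. exact Hl.
Qed.

Lemma is_lim_sumZ a : ex_sumZ a -> is_lim_seq (fun n => lsum a (zl n)) (sumZ a).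
Proof.
  intros H. apply Series_correct in H.
  apply is_lim_seq_ext with (sum_n (sumZ_term a)); [intros; apply sum_n_zl|exact H].
Qed.

Lemma sumZ_le_sumb a A : ex_sumZ a -> sumb a A -> sumZ a <= A.
Proof.
  intros He HA. apply (is_lim_seq_le (fun n => lsum a (zl n)) (fun _ => A) (sumZ a) A).
  - intros n. apply HA, NoDup_zl.
  - now apply is_lim_sumZ.
  - apply is_lim_seq_const.
Qed.

Lemma sumb_sumZ a : (forall k, 0 <= a k) -> ex_sumZ a -> sumb a (sumZ a).
Proof.
  intros Ha He L HL. destruct (incl_zl L) as [n Hn].
  apply Rle_trans with (lsum a (zl n)); [now apply lsum_incl|].
  apply (is_lim_seq_incr_compare (fun n => lsum a (zl n))); [now apply is_lim_sumZ|].
  intros m. cbn [zl lsum fold_right]. fold (lsum a (zl m)).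
  assert (H1 := Ha (Z.of_nat (S m))). assert (H2 := Ha (- Z.of_nat (S m))%Z). lra.
Qed.

Lemma is_sumZ_unique a (l : R) : is_lim_seq (fun n => lsum a (zl n)) l -> ex_sumZ a /\ sumZ a = l.
Proof.
  intros H.
  assert (is_series (sumZ_term a) l).
  { change (is_lim_seq (sum_n (sumZ_term a)) l).
    apply is_lim_seq_ext with (u := fun n => lsum a (zl n)); [|exact H].
    intros; symmetry; apply sum_n_zl. }
  split; [now exists l|]. now apply is_series_unique.
Qed.

Lemma sumZ_plus a b : ex_sumZ a -> ex_sumZ b ->
  ex_sumZ (fun k => a k + b k) /\ sumZ (fun k => a k + b k) = sumZ a + sumZ b.
Proof.
  intros Ha Hb. apply is_sumZ_unique.
  apply is_lim_seq_ext with (fun n => lsum a (zl n) + lsum b (zl n)).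
  - intros; symmetry; apply lsum_plus.
  - apply is_lim_seq_plus' ; now apply is_lim_sumZ.
Qed.

Lemma sumZ_scal c a : ex_sumZ a ->
  ex_sumZ (fun k => c * a k) /\ sumZ (fun k => c * a k) = c * sumZ a.
Proof.
  intros Ha. apply is_sumZ_unique.
  apply is_lim_seq_ext with (fun n => c * lsum a (zl n)).
  - intros; symmetry; apply lsum_scal.
  - apply (is_lim_seq_scal_l _ c (sumZ a)). now apply is_lim_sumZ.
Qed.

Lemma sumZ_ext a b : (forall k, a k = b k) -> sumZ a = sumZ b.
Proof.
  intros H. apply Series_ext. intros [|n]; simpl; now rewrite ?H.
Qed.

Lemma ex_sumZ_ext a b : (forall k, a k = b k) -> ex_sumZ a -> ex_sumZ b.
Proof.
  intros H. apply ex_series_ext. intros [|n]; simpl; now rewrite ?H.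
Qed.

Lemma sumb_abs_ex a A : sumb (fun k => Rabs (a k)) A -> ex_sumZ a.
Proof.
  intros H.
  assert (H1 : ex_sumZ (fun k => Rabs (a k))) by (eapply sumb_ex; eauto; intros; apply Rabs_pos).
  assert (H2 : ex_sumZ (fun k => Rabs (a k) + a k)).
  { apply sumb_ex with (2 * A).
    - intros k. assert (H2 := Rle_abs (- a k)). rewrite Rabs_Ropp in H2. lra.
    - intros L HL. apply Rle_trans with (lsum (fun k => 2 * Rabs (a k)) L).
      + apply lsum_le. intros k _. assert (H2 := Rle_abs (a k)). lra.
      + rewrite lsum_scal. specialize (H L HL). lra. }
  destruct (sumZ_scal (-1) _ H1) as [H3 _].
  destruct (sumZ_plus _ _ H2 H3) as [H4 _].
  revert H4. apply ex_sumZ_ext. intros; lra.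
Qed.

Lemma sumZ_invol_nonneg a A (h : Z -> Z) : (forall k, h (h k) = k) ->
  (forall k, 0 <= a k) -> sumb a A -> sumZ (fun k => a (h k)) = sumZ a.
Proof.
  intros Hh Ha HA.
  assert (inj : forall x y, h x = h y -> x = y) by (intros x y E; rewrite <- (Hh x), E; auto).
  assert (He : ex_sumZ a) by (eapply sumb_ex; eauto).
  assert (HA' : sumb (fun k => a (h k)) (sumZ a)).
  { intros L HL. apply lsum_double_le; auto. now apply sumb_sumZ. }
  assert (He' : ex_sumZ (fun k => a (h k))) by (eapply sumb_ex; eauto).
  apply Rle_antisym.
  - apply sumZ_le_sumb; auto.
  - apply sumZ_le_sumb; auto. intros L HL.
    apply Rle_trans with (lsum (fun k => a (h (h k))) L).
    + apply Req_le, lsum_ext. intros; now rewrite Hh.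
    + apply (lsum_double_le (fun k => a (h k)) h); auto. apply sumb_sumZ; auto.
Qed.

(** [sumZ] sums symmetrically about zero, so a reindexing such as [j -> k - j] rests on absolute
    convergence. The decomposition [a = (|a| + a) - |a|] reduces it to nonnegative terms. *)
Lemma sumZ_invol a A (h : Z -> Z) : (forall k, h (h k) = k) ->
  sumb (fun k => Rabs (a k)) A -> sumZ (fun k => a (h k)) = sumZ a.
Proof.
  intros Hh HA.
  assert (H1 : sumZ (fun k => Rabs (a (h k))) = sumZ (fun k => Rabs (a k))).
  { apply (sumZ_invol_nonneg (fun k => Rabs (a k)) A); auto. intros; apply Rabs_pos. }
  assert (P0 : forall k, 0 <= Rabs (a k) + a k).
  { intros k. assert (H2 := Rle_abs (- a k)). rewrite Rabs_Ropp in H2. lra. }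
  assert (P1 : sumb (fun k => Rabs (a k) + a k) (2 * A)).
  { intros L HL. apply Rle_trans with (lsum (fun k => 2 * Rabs (a k)) L).
      + apply lsum_le. intros k _. assert (H2 := Rle_abs (a k)). lra.
      + rewrite lsum_scal. specialize (HA L HL). lra. }
  assert (H2 : sumZ (fun k => Rabs (a (h k)) + a (h k)) = sumZ (fun k => Rabs (a k) + a k)).
  { apply (sumZ_invol_nonneg (fun k => Rabs (a k) + a k) (2 * A)); auto. }
  assert (HA' : sumb (fun k => Rabs (a (h k))) A).
  { intros L HL. apply (lsum_double_le (fun k => Rabs (a k)) h); auto.
    intros x y E; rewrite <- (Hh x), E; auto. }
  destruct (sumZ_plus (fun k => Rabs (a k)) a) as [_ E1].
  { eapply sumb_ex; eauto; intros; apply Rabs_pos. } { eapply sumb_abs_ex; eauto. }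
  destruct (sumZ_plus (fun k => Rabs (a (h k))) (fun k => a (h k))) as [_ E2].
  { eapply sumb_ex; eauto; intros; apply Rabs_pos. } { eapply sumb_abs_ex; eauto. }
  lra.
Qed.

Lemma sumZ_finite a L : NoDup L -> (forall k, a k <> 0 -> In k L) -> sumZ a = lsum a L.
Proof.
  intros HL H. apply is_sumZ_unique.
  destruct (incl_zl L) as [n0 Hn0].
  apply is_lim_seq_ext_loc with (fun _ => lsum a L); [|apply is_lim_seq_const].
  exists n0. intros n Hn. apply lsum_support; auto using NoDup_zl.
  intros k Hk. apply in_zl. apply H, Hn0, in_zl in Hk. lia.
Qed.

(** * Absolutely convergent complex sums *)

Definition absc (a : Z -> C) : Prop := exists A, sumb (fun k => Cmod (a k)) A.

Definition clsum (a : Z -> C) (L : list Z) : C :=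
  (lsum (fun k => Re (a k)) L, lsum (fun k => Im (a k)) L).

Lemma Rabs_Re_le c : Rabs (Re c) <= Cmod c.
Proof.
  unfold Cmod, Re. rewrite <- sqrt_Rsqr_abs. apply sqrt_le_1_alt. unfold Rsqr.
  assert (H := pow2_ge_0 (snd c)). lra.
Qed.

Lemma Rabs_Im_le c : Rabs (Im c) <= Cmod c.
Proof.
  unfold Cmod, Im. rewrite <- sqrt_Rsqr_abs. apply sqrt_le_1_alt. unfold Rsqr.
  assert (H := pow2_ge_0 (fst c)). lra.
Qed.

Lemma absc_Re a : absc a -> exists A, sumb (fun k => Rabs (Re (a k))) A.
Proof.
  intros [A H]. exists A. intros L HL. eapply Rle_trans; [|now apply (H L)].
  apply lsum_le. intros; apply Rabs_Re_le.
Qed.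

Lemma absc_Im a : absc a -> exists A, sumb (fun k => Rabs (Im (a k))) A.
Proof.
  intros [A H]. exists A. intros L HL. eapply Rle_trans; [|now apply (H L)].
  apply lsum_le. intros; apply Rabs_Im_le.
Qed.

Lemma absc_ex a : absc a -> ex_sumZ (fun k => Re (a k)) /\ ex_sumZ (fun k => Im (a k)).
Proof.
  intros H. destruct (absc_Re _ H) as [A HA]. destruct (absc_Im _ H) as [B HB].
  split; eapply sumb_abs_ex; eauto.
Qed.

Lemma absc_le a b c : (forall k, Cmod (a k) <= c * Cmod (b k)) -> 0 <= c -> absc b -> absc a.
Proof.
  intros Hab Hc [B HB]. exists (c * B). intros L HL.
  apply Rle_trans with (lsum (fun k => c * Cmod (b k)) L); [apply lsum_le; auto|].
  rewrite lsum_scal. apply Rmult_le_compat_l; auto.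
Qed.

Lemma absc_plus a b : absc a -> absc b -> absc (fun k => Cplus (a k) (b k)).
Proof.
  intros [A HA] [B HB]. exists (A + B). intros L HL.
  apply Rle_trans with (lsum (fun k => Cmod (a k) + Cmod (b k)) L).
  - apply lsum_le. intros; apply Cmod_triangle.
  - rewrite lsum_plus. specialize (HA L HL). specialize (HB L HL). simpl in *. lra.
Qed.

Lemma absc_scal c a : absc a -> absc (fun k => Cmult c (a k)).
Proof.
  intros H. apply absc_le with a (Cmod c); auto using Cmod_ge_0.
  intros k. rewrite Cmod_mult. lra.
Qed.

Lemma CsumZ_ext a b : (forall k, a k = b k) -> CsumZ a = CsumZ b.
Proof.
  intros H. unfold CsumZ. f_equal; apply sumZ_ext; intros; now rewrite H.
Qed.

Lemma CsumZ_plus a b : absc a -> absc b ->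
  CsumZ (fun k => Cplus (a k) (b k)) = Cplus (CsumZ a) (CsumZ b).
Proof.
  intros Ha Hb. destruct (absc_ex _ Ha), (absc_ex _ Hb). unfold CsumZ, Cplus. simpl.
  f_equal; now apply sumZ_plus.
Qed.

Lemma CsumZ_scal c a : absc a -> CsumZ (fun k => Cmult c (a k)) = Cmult c (CsumZ a).
Proof.
  intros Ha. destruct (absc_ex _ Ha) as [H1 H2]. unfold CsumZ.
  destruct c as [x y]. unfold Cmult; simpl. f_equal.
  - destruct (sumZ_scal x _ H1) as [P1 E1]. destruct (sumZ_scal (- y) _ H2) as [P2 E2].
    destruct (sumZ_plus _ _ P1 P2) as [_ E].
    transitivity (sumZ (fun k => x * Re (a k) + - y * Im (a k))).
    + apply sumZ_ext. intros; unfold Re, Im; simpl; ring.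
    + rewrite E, E1, E2. ring.
  - destruct (sumZ_scal x _ H2) as [P1 E1]. destruct (sumZ_scal y _ H1) as [P2 E2].
    destruct (sumZ_plus _ _ P1 P2) as [_ E].
    transitivity (sumZ (fun k => x * Im (a k) + y * Re (a k))).
    + apply sumZ_ext. intros; unfold Re, Im; simpl; ring.
    + rewrite E, E1, E2. ring.
Qed.

Lemma CsumZ_minus a b : absc a -> absc b ->
  CsumZ (fun k => Cminus (a k) (b k)) = Cminus (CsumZ a) (CsumZ b).
Proof.
  intros Ha Hb. transitivity (Cplus (CsumZ a) (Cmult (Copp (RtoC 1)) (CsumZ b))); [|ring].
  rewrite <- CsumZ_scal, <- CsumZ_plus by auto using absc_scal.
  apply CsumZ_ext. intros; ring.
Qed.

Lemma CsumZ_invol a (h : Z -> Z) : (forall k, h (h k) = k) -> absc a ->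
  CsumZ (fun k => a (h k)) = CsumZ a.
Proof.
  intros Hh Ha. destruct (absc_Re _ Ha) as [A HA]. destruct (absc_Im _ Ha) as [B HB].
  unfold CsumZ. f_equal.
  - apply (sumZ_invol (fun k => Re (a k)) A); auto.
  - apply (sumZ_invol (fun k => Im (a k)) B); auto.
Qed.

Lemma CsumZ_finite a L : NoDup L -> (forall k, a k <> RtoC 0 -> In k L) -> CsumZ a = clsum a L.
Proof.
  intros HL H. unfold CsumZ, clsum. f_equal; apply sumZ_finite; auto;
    intros k Hk; apply H; intros E; apply Hk; rewrite E; reflexivity.
Qed.

Lemma Cmod_clsum a L : Cmod (clsum a L) <= lsum (fun k => Cmod (a k)) L.
Proof.
  induction L as [|x L IH].
  - unfold clsum; simpl. change (0, 0) with (RtoC 0). rewrite Cmod_0. lra.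
  - replace (clsum a (x :: L)) with (Cplus (a x) (clsum a L)) by reflexivity.
    simpl. eapply Rle_trans; [apply Cmod_triangle|]. lra.
Qed.

Lemma is_lim_CsumZ a : absc a ->
  is_lim_seq (fun n => Re (clsum a (zl n))) (Re (CsumZ a)) /\
  is_lim_seq (fun n => Im (clsum a (zl n))) (Im (CsumZ a)).
Proof.
  intros Ha. destruct (absc_ex _ Ha). split; simpl.
  - now apply (is_lim_sumZ (fun k => Re (a k))).
  - now apply (is_lim_sumZ (fun k => Im (a k))).
Qed.

(** * Sobolev bounds *)

Definition jj (k : Z) : R := 1 + IZR k ^ 2.
Definition wt (s : R) (k : Z) : R := Rpower (jj k) (s / 2).

Lemma jj_ge1 k : 1 <= jj k.
Proof. unfold jj. assert (H := pow2_ge_0 (IZR k)). lra. Qed.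

Lemma jj_opp k : jj (- k) = jj k.
Proof. unfold jj. rewrite opp_IZR. ring. Qed.

Lemma wt_pos s k : 0 < wt s k.
Proof. apply exp_pos. Qed.

Lemma wt_sqr s k : wt s k ^ 2 = Rpower (jj k) s.
Proof. unfold wt. simpl. rewrite Rmult_1_r, <- Rpower_plus. f_equal. lra. Qed.

Lemma Hs_w_wt s f k : Hs_w s f k = (wt s k * Cmod (f k)) ^ 2.
Proof. unfold Hs_w. fold (jj k). rewrite Rpow_mult_distr, wt_sqr. reflexivity. Qed.

Lemma wt_0 s : wt s 0 = 1.
Proof.
  unfold wt, jj, Rpower. replace (1 + IZR 0 ^ 2) with 1 by (simpl; ring).
  rewrite ln_1, Rmult_0_r. apply exp_0.
Qed.

Lemma wt_opp s k : wt s (- k) = wt s k.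
Proof. unfold wt. now rewrite jj_opp. Qed.

Lemma wt_le r s k : r <= s -> wt r k <= wt s k.
Proof. intros H. apply Rle_Rpower; [apply jj_ge1|lra]. Qed.

Lemma wt_shift s k : wt (s - 2) k * jj k = wt s k.
Proof.
  unfold wt. rewrite <- (Rpower_1 (jj k)) at 2 by (assert (H := jj_ge1 k); lra).
  rewrite <- Rpower_plus. f_equal. lra.
Qed.

(** Membership in [H^s] and the norm bound in one statement: an inequality on [Hs_norm] alone would
    say nothing about a divergent series, to which [Series] still assigns a value. *)
Definition nb (s : R) (f : Fc) (A : R) : Prop :=
  0 <= A /\ sumb (fun k => (wt s k * Cmod (f k)) ^ 2) (A ^ 2).

Lemma nb_of_Hs s f A : in_Hs s f -> Hs_norm s f <= A -> nb s f A.
Proof.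
  intros H HA. assert (P : forall k, 0 <= Hs_w s f k).
  { intros k. rewrite Hs_w_wt. apply pow2_ge_0. }
  assert (HS := sumb_sumZ _ P H).
  assert (S0 : 0 <= sumZ (Hs_w s f)) by (apply (HS nil); constructor).
  assert (N0 := sqrt_pos (sumZ (Hs_w s f))). unfold Hs_norm in HA.
  split; [lra|]. intros L HL.
  apply Rle_trans with (sumZ (Hs_w s f)).
  - rewrite (lsum_ext _ (Hs_w s f)); [now apply HS|]. intros; now rewrite Hs_w_wt.
  - rewrite <- (pow2_sqrt _ S0). now apply pow_incr.
Qed.

Lemma Hs_of_nb s f A : nb s f A -> in_Hs s f /\ Hs_norm s f <= A.
Proof.
  intros [A0 H]. assert (P : forall k, 0 <= Hs_w s f k).
  { intros k. rewrite Hs_w_wt. apply pow2_ge_0. }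
  assert (H' : sumb (Hs_w s f) (A ^ 2)).
  { intros L HL. rewrite (lsum_ext _ (fun k => (wt s k * Cmod (f k)) ^ 2)); [now apply H|].
    intros; apply Hs_w_wt. }
  assert (E : in_Hs s f) by (eapply sumb_ex; eauto).
  split; [assumption|]. unfold Hs_norm. rewrite <- (sqrt_pow2 A A0).
  apply sqrt_le_1_alt. now apply sumZ_le_sumb.
Qed.

Lemma nb_pos s f A : nb s f A -> 0 <= A.
Proof. now intros [H _]. Qed.

Lemma nb_mono s f A B : A <= B -> nb s f A -> nb s f B.
Proof.
  intros H [HA HL]. split; [lra|]. intros L N. apply Rle_trans with (A ^ 2); [now apply HL|].
  apply pow_incr; lra.
Qed.

Lemma nb_dom r s f g c A : 0 <= c ->
  (forall k, wt r k * Cmod (f k) <= c * (wt s k * Cmod (g k))) -> nb s g A -> nb r f (c * A).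
Proof.
  intros Hc H [HA HL]. split; [now apply Rmult_le_pos|]. intros L N.
  apply Rle_trans with (lsum (fun k => c ^ 2 * (wt s k * Cmod (g k)) ^ 2) L).
  - apply lsum_le. intros k _. rewrite <- Rpow_mult_distr. apply pow_incr. split; [|apply H].
    apply Rmult_le_pos; [apply Rlt_le, wt_pos|apply Cmod_ge_0].
  - rewrite lsum_scal, Rpow_mult_distr. apply Rmult_le_compat_l; [apply pow2_ge_0|now apply HL].
Qed.

Lemma nb_le s f g A : (forall k, Cmod (f k) <= Cmod (g k)) -> nb s g A -> nb s f A.
Proof.
  intros H Hg. replace A with (1 * A) by ring. apply nb_dom with s g; auto; [lra|].
  intros k. rewrite Rmult_1_l. apply Rmult_le_compat_l; [apply Rlt_le, wt_pos|auto].
Qed.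

Lemma nb_ext s f g A : (forall k, f k = g k) -> nb s g A -> nb s f A.
Proof. intros H. apply nb_le. intros k. rewrite H. lra. Qed.

Lemma nb_index r s f A : r <= s -> nb s f A -> nb r f A.
Proof.
  intros H Hg. replace A with (1 * A) by ring. apply nb_dom with s f; auto; [lra|].
  intros k. rewrite Rmult_1_l. apply Rmult_le_compat_r; [apply Cmod_ge_0|now apply wt_le].
Qed.

Lemma nb_mult r s f sym c A : 0 <= c ->
  (forall k, wt r k * Cmod (sym k) <= c * wt s k) -> nb s f A -> nb r (mult sym f) (c * A).
Proof.
  intros Hc H. apply nb_dom; auto. intros k. unfold mult. rewrite Cmod_mult.
  rewrite <- !Rmult_assoc. apply Rmult_le_compat_r; [apply Cmod_ge_0|apply H].
Qed.

Lemma nb_mult_le s f sym c A : 0 <= c ->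
  (forall k, Cmod (sym k) <= c) -> nb s f A -> nb s (mult sym f) (c * A).
Proof.
  intros Hc H. apply nb_mult; auto. intros k. rewrite Rmult_comm.
  apply Rmult_le_compat_r; [apply Rlt_le, wt_pos|apply H].
Qed.

Lemma nb_scal s f c A : nb s f A -> nb s (fscal c f) (Cmod c * A).
Proof. apply (nb_mult_le s f (fun _ => c)); [apply Cmod_ge_0|intros; lra]. Qed.

Lemma nb_plus s f g A B : nb s f A -> nb s g B -> nb s (fadd f g) (A + B).
Proof.
  intros [HA HL] [HB HM]. split; [lra|]. intros L N.
  set (x := fun k => wt s k * Cmod (f k)). set (y := fun k => wt s k * Cmod (g k)).
  apply Rle_trans with (lsum (fun k => x k ^ 2 + (2 * (x k * y k) + y k ^ 2)) L).
  - apply lsum_le. intros k _. replace (x k ^ 2 + (2 * (x k * y k) + y k ^ 2))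
      with ((x k + y k) ^ 2) by ring.
    apply pow_incr. split.
    + apply Rmult_le_pos; [apply Rlt_le, wt_pos|apply Cmod_ge_0].
    + unfold x, y. rewrite <- Rmult_plus_distr_l.
      apply Rmult_le_compat_l; [apply Rlt_le, wt_pos|]. apply Cmod_triangle.
  - rewrite !lsum_plus, lsum_scal.
    assert (H1 : lsum (fun k => x k ^ 2) L <= A ^ 2) by now apply HL.
    assert (H2 : lsum (fun k => y k ^ 2) L <= B ^ 2) by now apply HM.
    assert (H3 : lsum (fun k => x k * y k) L <= A * B).
    { apply Rsqr_incr_0_var; [|now apply Rmult_le_pos]. rewrite !Rsqr_pow2.
      eapply Rle_trans; [apply lsum_CS|]. rewrite Rpow_mult_distr.
      apply Rmult_le_compat; auto; apply lsum_nonneg; intros; apply pow2_ge_0. }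
    nra.
Qed.

Lemma nb_opp s f A : nb s f A -> nb s (fun k => Copp (f k)) A.
Proof. apply nb_le. intros k. rewrite Cmod_opp. lra. Qed.

Lemma nb_minus s f g A B : nb s f A -> nb s g B -> nb s (fsub f g) (A + B).
Proof.
  intros Hf Hg. apply nb_ext with (fadd f (fun k => Copp (g k))).
  - intros; reflexivity.
  - apply nb_plus; auto. now apply nb_opp.
Qed.

Lemma Cmod_conj c : Cmod (Cconj c) = Cmod c.
Proof. unfold Cmod, Cconj. simpl. f_equal. ring. Qed.

Lemma nb_conj s f A : nb s f A -> nb s (fconj f) A.
Proof.
  intros [HA H]. split; [assumption|]. intros L HL.
  rewrite (lsum_ext _ (fun k => (wt s (- k) * Cmod (f (- k)%Z)) ^ 2)).
  - apply (lsum_double_le (fun k => (wt s k * Cmod (f k)) ^ 2) Z.opp); auto.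
    intros; lia.
  - intros k _. unfold fconj. now rewrite Cmod_conj, wt_opp.
Qed.

Lemma nb_mode s f A k : nb s f A -> wt s k * Cmod (f k) <= A.
Proof.
  intros [HA H]. apply Rsqr_incr_0_var; [|assumption]. rewrite !Rsqr_pow2.
  specialize (H [k]). simpl lsum in H. rewrite Rplus_0_r in H. apply H.
  constructor; [intros []|constructor].
Qed.

Lemma nb_mode0 s f A : nb s f A -> Cmod (f 0%Z) <= A.
Proof. intros H. apply (nb_mode _ _ _ 0) in H. rewrite wt_0 in H. lra. Qed.

Lemma nb_const s c : nb s (fconst c) (Cmod c).
Proof.
  split; [apply Cmod_ge_0|]. intros L HL.
  set (a := fun k => (wt s k * Cmod (fconst c k)) ^ 2).
  assert (Ha : forall k, a k <> 0 -> k = 0%Z).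
  { intros k Hk. destruct (Z.eq_dec k 0) as [E|E]; [exact E|]. destruct Hk. unfold a, fconst.
    destruct (Z.eq_dec k 0); [contradiction|]. rewrite Cmod_0. ring. }
  apply Rle_trans with (lsum a (0%Z :: filter (fun k => negb (Z.eqb k 0)) L)).
  - apply lsum_incl; auto. { intros; apply pow2_ge_0. }
    intros k Hk. destruct (Z.eq_dec k 0) as [->|E]; [now left|right].
    apply filter_In. split; auto. apply Z.eqb_neq in E. now rewrite E.
  - rewrite lsum_cons. rewrite (lsum_ext _ (fun _ => 0)).
    + rewrite lsum_zero. unfold a, fconst. simpl. rewrite wt_0. lra.
    + intros k Hk. apply filter_In in Hk. destruct Hk as [_ Hk].
      destruct (Req_dec (a k) 0) as [E|E]; [exact E|]. apply Ha in E. subst. discriminate.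
Qed.

Lemma is_lim_seq_lsum (a : nat -> Z -> R) (b : Z -> R) L :
  (forall k, In k L -> is_lim_seq (fun n => a n k) (b k)) ->
  is_lim_seq (fun n => lsum (a n) L) (lsum b L).
Proof.
  induction L as [|x L IH]; intros H.
  - apply is_lim_seq_const.
  - simpl. apply is_lim_seq_plus'; [apply H; now left|]. apply IH. intros; apply H; now right.
Qed.

Lemma Cmod_sqr c : Cmod c ^ 2 = Re c ^ 2 + Im c ^ 2.
Proof.
  unfold Cmod, Re, Im. apply pow2_sqrt.
  assert (H1 := pow2_ge_0 (fst c)). assert (H2 := pow2_ge_0 (snd c)). lra.
Qed.

(** Fatou's lemma for mode-wise limits: [nb] only speaks of finite sums, and each of these passes to
    the limit. *)
Lemma nb_lim s (fn : nat -> Fc) f A : 0 <= A ->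
  (forall k, is_lim_seq (fun n => Re (fn n k)) (Re (f k))) ->
  (forall k, is_lim_seq (fun n => Im (fn n k)) (Im (f k))) ->
  (forall n, nb s (fn n) A) -> nb s f A.
Proof.
  intros HA HR HI Hn. split; [assumption|]. intros L HL.
  apply (is_lim_seq_le (fun n => lsum (fun k => (wt s k * Cmod (fn n k)) ^ 2) L) (fun _ => A ^ 2)
     (lsum (fun k => (wt s k * Cmod (f k)) ^ 2) L) (A ^ 2)).
  - intros n. now apply Hn.
  - apply (is_lim_seq_lsum (fun n k => (wt s k * Cmod (fn n k)) ^ 2)). intros k _.
    apply is_lim_seq_ext with (fun n => wt s k ^ 2 * (Re (fn n k) * Re (fn n k) + Im (fn n k) * Im (fn n k))).
    { intros n. rewrite Rpow_mult_distr, Cmod_sqr. ring. }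
    replace ((wt s k * Cmod (f k)) ^ 2) with (wt s k ^ 2 * (Re (f k) * Re (f k) + Im (f k) * Im (f k)))
      by (rewrite Rpow_mult_distr, Cmod_sqr; ring).
    apply (is_lim_seq_scal_l _ (wt s k ^ 2) (Re (f k) * Re (f k) + Im (f k) * Im (f k))).
    apply is_lim_seq_plus'; apply is_lim_seq_mult'; auto.
  - apply is_lim_seq_const.
Qed.

(** * Bilinear operators *)

Definition Bil (m : Z -> Z -> C) (f g : Fc) : Fc :=
  fun k => CsumZ (fun j => Cmult (m j (k - j)%Z) (Cmult (f j) (g (k - j)%Z))).

(* In both sums the frequencies are [j + l = k]: [K1] is tested at fixed [k], [K2] at fixed [l]. *)
Definition kernel (c : R) (K1 K2 : Z -> Z -> R) : Prop :=
  0 <= c /\ (forall k j, 0 <= K1 k j) /\ (forall k j, 0 <= K2 k j) /\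
  (forall k, sumb (fun j => K1 k j ^ 2) (c ^ 2)) /\
  (forall l, sumb (fun j => K2 (j + l)%Z j ^ 2) (c ^ 2)).

(** A Schur test by two groupings in the Cauchy-Schwarz inequality over [j]: [K1] against [F G],
    with [K1] square-summable at fixed output [k], and [F] against [K2 G], where the sum over [k]
    then tests [K2] at fixed [l]. *)
Lemma kernel_bound c K1 K2 F G A B L J : kernel c K1 K2 ->
  0 <= A -> 0 <= B ->
  sumb (fun k => F k ^ 2) (A ^ 2) -> sumb (fun k => G k ^ 2) (B ^ 2) ->
  NoDup L -> NoDup J ->
  lsum (fun k => (lsum (fun j => (K1 k j + K2 k j) * (F j * G (k - j)%Z)) J) ^ 2) L
  <= (2 * c * A * B) ^ 2.
Proof.
  intros (Hc & P1 & P2 & H1 & H2) HA HB HF HG NL NJ.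
  assert (E1 : lsum (fun k => (lsum (fun j => K1 k j * (F j * G (k - j)%Z)) J) ^ 2) L
               <= c ^ 2 * (A ^ 2 * B ^ 2)).
  { apply Rle_trans with (lsum (fun k => c ^ 2 * lsum (fun j => F j ^ 2 * G (k - j)%Z ^ 2) J) L).
    - apply lsum_le. intros k _. eapply Rle_trans; [apply lsum_CS|].
      apply Rmult_le_compat.
      + apply lsum_nonneg; intros; apply pow2_ge_0.
      + apply lsum_nonneg; intros; apply pow2_ge_0.
      + now apply H1.
      + apply Req_le, lsum_ext. intros; ring.
    - rewrite lsum_scal. apply Rmult_le_compat_l; [apply pow2_ge_0|].
      rewrite (lsum_swap (fun k j => F j ^ 2 * G (k - j)%Z ^ 2)).
      apply Rle_trans with (lsum (fun j => B ^ 2 * F j ^ 2) J).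
      + apply lsum_le. intros j _. rewrite lsum_scal, Rmult_comm.
        apply Rmult_le_compat_r; [apply pow2_ge_0|].
        apply (lsum_double_le (fun k => G k ^ 2) (fun k => (k - j)%Z)); auto. intros; lia.
      + rewrite lsum_scal, Rmult_comm. apply Rmult_le_compat_r; [apply pow2_ge_0|]. now apply HF. }
  assert (E2 : lsum (fun k => (lsum (fun j => K2 k j * (F j * G (k - j)%Z)) J) ^ 2) L
               <= c ^ 2 * (A ^ 2 * B ^ 2)).
  { apply Rle_trans with (lsum (fun k => A ^ 2 * lsum (fun j => K2 k j ^ 2 * G (k - j)%Z ^ 2) J) L).
    - apply lsum_le. intros k _.
      rewrite (lsum_ext _ (fun j => F j * (K2 k j * G (k - j)%Z))) by (intros; ring).
      eapply Rle_trans; [apply lsum_CS|].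
      apply Rmult_le_compat.
      + apply lsum_nonneg; intros; apply pow2_ge_0.
      + apply lsum_nonneg; intros; apply pow2_ge_0.
      + now apply HF.
      + apply Req_le, lsum_ext. intros; ring.
    - rewrite lsum_scal.
      replace (c ^ 2 * (A ^ 2 * B ^ 2)) with (A ^ 2 * (c ^ 2 * B ^ 2)) by ring.
      apply Rmult_le_compat_l; [apply pow2_ge_0|].
      rewrite (lsum_swap (fun k j => K2 k j ^ 2 * G (k - j)%Z ^ 2)).
      (* [D] collects all differences [k - j], so that for every [j] the sum over [k] becomes part
         of a sum over one common list of values [l]. *)
      set (D := nodup Z.eq_dec (flat_map (fun j => map (fun k => (k - j)%Z) L) J)).
      apply Rle_trans with (lsum (fun j => lsum (fun l => K2 (j + l)%Z j ^ 2 * G l ^ 2) D) J).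
      + apply lsum_le. intros j Hj.
        rewrite (lsum_ext _ (fun k => (fun l => K2 (j + l)%Z j ^ 2 * G l ^ 2) (k - j)%Z)).
        2:{ intros k _. simpl. replace (j + (k - j))%Z with k by lia. reflexivity. }
        rewrite <- (lsum_map (fun l => K2 (j + l)%Z j ^ 2 * G l ^ 2)).
        apply lsum_incl.
        * intros; apply Rmult_le_pos; apply pow2_ge_0.
        * apply Injective_map_NoDup; auto. intros x y; lia.
        * intros y Hy. apply nodup_In, in_flat_map. exists j; auto.
      + rewrite (lsum_swap (fun j l => K2 (j + l)%Z j ^ 2 * G l ^ 2)).
        apply Rle_trans with (lsum (fun l => c ^ 2 * G l ^ 2) D).
        * apply lsum_le. intros l _.
          rewrite (lsum_ext _ (fun j => G l ^ 2 * K2 (j + l)%Z j ^ 2)) by (intros; ring).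
          rewrite lsum_scal, Rmult_comm. apply Rmult_le_compat_r; [apply pow2_ge_0|]. now apply H2.
        * rewrite lsum_scal. apply Rmult_le_compat_l; [apply pow2_ge_0|]. apply HG. apply NoDup_nodup. }
  apply Rle_trans with (lsum (fun k => 2 * (lsum (fun j => K1 k j * (F j * G (k - j)%Z)) J) ^ 2
    + 2 * (lsum (fun j => K2 k j * (F j * G (k - j)%Z)) J) ^ 2) L).
  - apply lsum_le. intros k _.
    rewrite (lsum_ext _ (fun j => K1 k j * (F j * G (k - j)%Z) + K2 k j * (F j * G (k - j)%Z)))
      by (intros; ring).
    rewrite lsum_plus.
    set (x := lsum (fun j => K1 k j * (F j * G (k - j)%Z)) J).
    set (y := lsum (fun j => K2 k j * (F j * G (k - j)%Z)) J).
    assert (Hxy := pow2_ge_0 (x - y)). lra.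
  - rewrite lsum_plus, !lsum_scal.
    replace ((2 * c * A * B) ^ 2) with (4 * (c ^ 2 * (A ^ 2 * B ^ 2))) by ring. lra.
Qed.

(** Absolute convergence at one [k] is [kernel_bound] for the one-point list [[k]]. The norm bound
    is proved with [j] confined to a window [zl n] and then passed to the limit by [nb_lim]. *)
Lemma Bil_bound r s m c K1 K2 f g A B : kernel c K1 K2 ->
  (forall j l, wt r (j + l) * Cmod (m j l)
     <= (K1 (j + l)%Z j + K2 (j + l)%Z j) * (wt s j * wt s l)) ->
  nb s f A -> nb s g B ->
  nb r (Bil m f g) (2 * c * A * B) /\
  forall k, absc (fun j => Cmult (m j (k - j)%Z) (Cmult (f j) (g (k - j)%Z))).
Proof.
  intros HK Hm [HA HF] [HB HG].
  set (F := fun k => wt s k * Cmod (f k)) in *. set (G := fun k => wt s k * Cmod (g k)) in *.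
  assert (HX : forall k j, wt r k * Cmod (Cmult (m j (k - j)%Z) (Cmult (f j) (g (k - j)%Z)))
     <= (K1 k j + K2 k j) * (F j * G (k - j)%Z)).
  { intros k j. rewrite !Cmod_mult, <- Rmult_assoc.
    specialize (Hm j (k - j)%Z). replace (j + (k - j))%Z with k in Hm by lia.
    unfold F, G.
    replace ((K1 k j + K2 k j) * (wt s j * Cmod (f j) * (wt s (k - j) * Cmod (g (k - j)%Z))))
      with ((K1 k j + K2 k j) * (wt s j * wt s (k - j)) * (Cmod (f j) * Cmod (g (k - j)%Z))) by ring.
    apply Rmult_le_compat_r; [|exact Hm]. apply Rmult_le_pos; apply Cmod_ge_0. }
  assert (H2c : 0 <= 2 * c * A * B).
  { destruct HK as [Hc _]. assert (0 <= c * A) by now apply Rmult_le_pos.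
    assert (0 <= c * A * B) by now apply Rmult_le_pos. lra. }
  assert (HA' : forall k, absc (fun j => Cmult (m j (k - j)%Z) (Cmult (f j) (g (k - j)%Z)))).
  { intros k. exists ((2 * c * A * B) / wt r k). intros J NJ.
    apply Rmult_le_reg_l with (wt r k); [apply wt_pos|].
    replace (wt r k * (2 * c * A * B / wt r k)) with (2 * c * A * B)
      by (field; apply Rgt_not_eq, wt_pos).
    rewrite <- lsum_scal.
    apply Rle_trans with (lsum (fun j => (K1 k j + K2 k j) * (F j * G (k - j)%Z)) J).
    { apply lsum_le. intros; apply HX. }
    apply Rsqr_incr_0_var; auto. rewrite !Rsqr_pow2.
    assert (N1 : NoDup [k]) by (constructor; [intros []|constructor]).
    assert (E := kernel_bound c K1 K2 F G A B [k] J HK HA HB HF HG N1 NJ).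
    rewrite lsum_cons in E. simpl (lsum _ []) in E. lra. }
  split; [|exact HA'].
  apply nb_lim with (fun n k => clsum (fun j => Cmult (m j (k - j)%Z) (Cmult (f j) (g (k - j)%Z))) (zl n)); auto.
  - intros k. exact (proj1 (is_lim_CsumZ _ (HA' k))).
  - intros k. exact (proj2 (is_lim_CsumZ _ (HA' k))).
  - intros n. split; auto. intros L NL.
    eapply Rle_trans; [|apply (kernel_bound c K1 K2 F G A B L (zl n) HK HA HB HF HG NL (NoDup_zl n))].
    apply lsum_le. intros k _. apply pow_incr. split.
    { apply Rmult_le_pos; [apply Rlt_le, wt_pos|apply Cmod_ge_0]. }
    eapply Rle_trans; [apply Rmult_le_compat_l; [apply Rlt_le, wt_pos|apply Cmod_clsum]|].
    rewrite <- lsum_scal. apply lsum_le. intros; apply HX.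
Qed.

(** At a single output frequency no decay in [k] is asked for, so one derivative on each factor pays
    for a symbol of size [<j><k - j>]. *)
Lemma Bil_absc m f g A B k c : nb 1 f A -> nb 1 g B -> 0 <= c ->
  (forall j, Cmod (m j (k - j)%Z) <= c * (wt 1 j * wt 1 (k - j))) ->
  absc (fun j => Cmult (m j (k - j)%Z) (Cmult (f j) (g (k - j)%Z))).
Proof.
  intros [HA HF] [HB HG] Hc Hm. exists (c * (A * B)). intros J NJ.
  apply Rle_trans with (lsum (fun j => c * ((wt 1 j * Cmod (f j)) *
     (wt 1 (k - j) * Cmod (g (k - j)%Z)))) J).
  - apply lsum_le. intros j _. rewrite !Cmod_mult.
    replace (c * (wt 1 j * Cmod (f j) * (wt 1 (k - j) * Cmod (g (k - j)%Z)))) with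
      (c * (wt 1 j * wt 1 (k - j)) * (Cmod (f j) * Cmod (g (k - j)%Z))) by ring.
    apply Rmult_le_compat_r; [|apply Hm]. apply Rmult_le_pos; apply Cmod_ge_0.
  - rewrite lsum_scal. apply Rmult_le_compat_l; auto.
    apply Rsqr_incr_0_var; [|now apply Rmult_le_pos]. rewrite !Rsqr_pow2.
    eapply Rle_trans; [apply lsum_CS|]. rewrite Rpow_mult_distr. apply Rmult_le_compat.
    + apply lsum_nonneg; intros; apply pow2_ge_0.
    + apply lsum_nonneg; intros; apply pow2_ge_0.
    + now apply HF.
    + apply (lsum_double_le (fun l => (wt 1 l * Cmod (g l)) ^ 2) (fun j => (k - j)%Z)); auto.
      intros; lia.
Qed.

(** * The two kernels *)

Lemma Rpower_ge1 x a : 1 <= x -> 0 <= a -> 1 <= Rpower x a.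
Proof. intros Hx Ha. rewrite <- (Rpower_O x) by lra. now apply Rle_Rpower. Qed.

Lemma Rpower_le1 x a : 1 <= x -> a <= 0 -> Rpower x a <= 1.
Proof. intros Hx Ha. rewrite <- (Rpower_O x) by lra. now apply Rle_Rpower. Qed.

Lemma Rpower_pos x a : 0 < Rpower x a.
Proof. apply exp_pos. Qed.

Lemma Rpower_sqr x a : Rpower x a ^ 2 = Rpower x (2 * a).
Proof. simpl. rewrite Rmult_1_r, <- Rpower_plus. f_equal. lra. Qed.

Lemma jj_triang j l : jj (j + l) <= 2 * (jj j + jj l).
Proof.
  unfold jj. rewrite plus_IZR. assert (H := pow2_ge_0 (IZR j - IZR l)). lra.
Qed.

Lemma jj_triang_l j l : jj j <= 2 * (jj (j + l) + jj l).
Proof. assert (H := jj_triang (j + l) (- l)). rewrite jj_opp in H. now rewrite Z.add_opp_r, Z.add_simpl_r in H. Qed.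

Lemma jj_triang_r j l : jj l <= 2 * (jj (j + l) + jj j).
Proof. rewrite Z.add_comm. apply jj_triang_l. Qed.

Lemma jj_le_abs j k : jj j <= jj k <-> (Z.abs j <= Z.abs k)%Z.
Proof.
  unfold jj. split; intros H.
  - apply le_IZR. rewrite !abs_IZR. apply Rsqr_incr_0; try apply Rabs_pos.
    rewrite <- !Rsqr_abs. unfold Rsqr. lra.
  - apply IZR_le in H. rewrite !abs_IZR in H. apply Rsqr_incr_1 in H; try apply Rabs_pos.
    rewrite <- !Rsqr_abs in H. unfold Rsqr in H. lra.
Qed.

Lemma sumb_zl a A : (forall k, 0 <= a k) -> (forall n, lsum a (zl n) <= A) -> sumb a A.
Proof.
  intros Ha H L HL. destruct (incl_zl L) as [n Hn].
  eapply Rle_trans; [|apply (H n)]. now apply lsum_incl.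
Qed.

Lemma lsum_zl_S a n : lsum a (zl (S n)) = a (Z.of_nat (S n)) + a (- Z.of_nat (S n))%Z + lsum a (zl n).
Proof. cbn [zl]. rewrite !lsum_cons. ring. Qed.

(** Telescoping: [2 / (1 + m^2) <= 4 / m - 4 / (m + 1)], starting from [1 = 5 - 4] at frequency
    zero. *)
Lemma sumb_inv_jj : sumb (fun j => / jj j) 5.
Proof.
  apply sumb_zl.
  - intros k. apply Rlt_le, Rinv_0_lt_compat. assert (H := jj_ge1 k); lra.
  - assert (H : forall n, lsum (fun j => / jj j) (zl n) <= 5 - 4 / (INR n + 1)).
    { induction n as [|n IH].
      - unfold jj; simpl. lra.
      - rewrite lsum_zl_S, jj_opp. unfold jj at 1 2. rewrite <- INR_IZR_INZ, S_INR.
        set (m := INR n + 1) in *. assert (Hm : 1 <= m) by (unfold m; assert (H := pos_INR n); lra).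
        assert (E : / (1 + m ^ 2) + / (1 + m ^ 2) <= 4 / m - 4 / (m + 1)).
        { replace (4 / m - 4 / (m + 1)) with (4 / (m * (m + 1))) by (field; lra).
          replace (/ (1 + m ^ 2) + / (1 + m ^ 2)) with (4 / (2 * (1 + m ^ 2))) by (field; nra).
          apply Rmult_le_compat_l; [lra|]. apply Rinv_le_contravar; nra. }
        lra. }
    intros n. specialize (H n).
    assert (0 < 4 / (INR n + 1)); [|lra].
    apply Rdiv_lt_0_compat; [lra|]. assert (H1 := pos_INR n); lra.
Qed.

Lemma sumb_invol_shift a A k : sumb a A -> sumb (fun j => a (k - j)%Z) A.
Proof. intros H L HL. apply (lsum_double_le a (fun j => (k - j)%Z)); auto. intros; lia. Qed.

Lemma sumb_shift a A l : sumb a A -> sumb (fun j => a (j + l)%Z) A.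
Proof. intros H L HL. apply (lsum_double_le a (fun j => (j + l)%Z)); auto. intros; lia. Qed.

(** Here [X, Y, Z] are [jj k, jj j, jj l] and [h = r/2]. The two larger values are comparable up to
    the factor 4, and the smallest one supplies the power [-1/2], which is square-summable over
    frequencies. If [X] is the smallest, [Y + Z <= 4 sqrt (Y Z)] leaves powers [h - 1/2]; in all
    cases these must be nonnegative, and this is where [r >= 1] enters. *)
Lemma stab_triple h X Y Z : / 2 <= h -> 1 <= X -> 1 <= Y -> 1 <= Z ->
  X <= 2 * (Y + Z) -> Y <= 2 * (X + Z) -> Z <= 2 * (X + Y) ->
  Rpower X h * ((Y + Z) / X) <=
  5 * Rpower 4 h * (Rpower X (- / 2) + Rpower Y (- / 2) + Rpower Z (- / 2)) * (Rpower Y h * Rpower Z h).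
Proof.
  intros Hh HX HY HZ TX TY TZ.
  (* Case of a smallest input [a]: [b] is the other input and [c] the output. *)
  assert (D : forall a b c, 1 <= a -> 1 <= b -> 1 <= c -> a <= b -> a <= c ->
     c <= 2 * (a + b) -> b <= 2 * (c + a) ->
     Rpower c h * ((a + b) / c) <= 5 * Rpower 4 h * Rpower a (- / 2) * (Rpower a h * Rpower b h)).
  { intros a b c Ha Hb Hc H1 H2 H3 H4.
    assert (E1 : (a + b) / c <= 5) by (apply Rle_div_l; lra).
    assert (E2 : Rpower c h <= Rpower 4 h * Rpower b h).
    { rewrite Rpower_mult_distr by lra. apply Rle_Rpower_l; lra. }
    assert (E3 : 1 <= Rpower a (- / 2) * Rpower a h).
    { rewrite <- Rpower_plus. apply Rpower_ge1; lra. }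
    apply Rle_trans with (Rpower 4 h * Rpower b h * 5).
    - apply Rmult_le_compat; auto; [apply Rlt_le, Rpower_pos|].
      apply Rlt_le, Rdiv_lt_0_compat; lra.
    - assert (P := Rmult_lt_0_compat _ _ (Rpower_pos 4 h) (Rpower_pos b h)).
      replace (5 * Rpower 4 h * Rpower a (- / 2) * (Rpower a h * Rpower b h)) with
        (5 * (Rpower 4 h * Rpower b h) * (Rpower a (- / 2) * Rpower a h)) by ring.
      nra. }
  assert (PX := Rpower_pos X (- / 2)). assert (PY := Rpower_pos Y (- / 2)).
  assert (PZ := Rpower_pos Z (- / 2)).
  assert (P4 : 1 <= Rpower 4 h) by (apply Rpower_ge1; lra).
  assert (PYZ := Rmult_lt_0_compat _ _ (Rpower_pos Y h) (Rpower_pos Z h)).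
  assert (Hmono : forall t, t <= Rpower X (- / 2) + Rpower Y (- / 2) + Rpower Z (- / 2) ->
    5 * Rpower 4 h * t * (Rpower Y h * Rpower Z h) <=
    5 * Rpower 4 h * (Rpower X (- / 2) + Rpower Y (- / 2) + Rpower Z (- / 2)) * (Rpower Y h * Rpower Z h)).
  { intros t Ht. apply Rmult_le_compat_r; [lra|]. apply Rmult_le_compat_l; lra. }
  destruct (Rle_dec Y X) as [YX|YX]; [destruct (Rle_dec Y Z) as [YZ|YZ]|destruct (Rle_dec Z X) as [ZX|ZX]].
  - eapply Rle_trans; [|apply (Hmono (Rpower Y (- / 2))); lra]. apply D; auto; lra.
  - eapply Rle_trans; [|apply (Hmono (Rpower Z (- / 2))); lra].
    rewrite (Rplus_comm Y Z), (Rmult_comm (Rpower Y h)). apply D; auto; lra.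
  - eapply Rle_trans; [|apply (Hmono (Rpower Z (- / 2))); lra].
    rewrite (Rplus_comm Y Z), (Rmult_comm (Rpower Y h)). apply D; auto; lra.
  - eapply Rle_trans; [|apply (Hmono (Rpower X (- / 2))); lra].
    set (g := h - / 2).
    assert (EX : Rpower X h = X * Rpower X (- / 2) * Rpower X g).
    { rewrite <- (Rpower_1 X) at 2 by lra. rewrite <- !Rpower_plus. f_equal. unfold g; lra. }
    assert (F1 : Rpower X g <= Rpower Y g) by (apply Rle_Rpower_l; unfold g; lra).
    assert (F2 : 1 <= Rpower Z g) by (apply Rpower_ge1; unfold g; lra).
    assert (F3 : Rpower Y h = sqrt Y * Rpower Y g).
    { rewrite <- Rpower_sqrt, <- Rpower_plus by lra. f_equal. unfold g; lra. }
    assert (F4 : Rpower Z h = sqrt Z * Rpower Z g).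
    { rewrite <- Rpower_sqrt, <- Rpower_plus by lra. f_equal. unfold g; lra. }
    assert (F5 : Y + Z <= 4 * (sqrt Y * sqrt Z)).
    { assert (Sy := sqrt_lt_R0 Y). assert (Sz := sqrt_lt_R0 Z).
      assert (QY : sqrt Y * sqrt Y = Y) by (apply sqrt_sqrt; lra).
      assert (QZ : sqrt Z * sqrt Z = Z) by (apply sqrt_sqrt; lra).
      set (y := sqrt Y) in *. set (z := sqrt Z) in *.
      assert (y <= 2 * z) by (apply Rsqr_incr_0_var; unfold Rsqr; nra).
      assert (z <= 2 * y) by (apply Rsqr_incr_0_var; unfold Rsqr; nra). nra. }
    rewrite EX, F3, F4.
    set (x := Rpower X (- / 2)) in *. set (xg := Rpower X g) in *. set (yg := Rpower Y g) in *.
    set (zg := Rpower Z g) in *. set (p := sqrt Y * sqrt Z) in *.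
    assert (Pxg : 0 < xg) by apply Rpower_pos.
    replace (X * x * xg * ((Y + Z) / X)) with (x * (xg * (Y + Z))) by (field; lra).
    replace (5 * Rpower 4 h * x * (sqrt Y * yg * (sqrt Z * zg)))
      with (x * (5 * Rpower 4 h * (p * (yg * zg)))) by (unfold p; ring).
    apply Rmult_le_compat_l; [lra|].
    assert (Pp : 0 < p) by (apply Rmult_lt_0_compat; apply sqrt_lt_R0; lra).
    assert (G1 : xg <= yg * zg) by nra.
    assert (G2 : p * xg <= p * (yg * zg)) by (apply Rmult_le_compat_l; lra).
    assert (G3 : 0 < p * (yg * zg)) by nra.
    assert (G4 : xg * (Y + Z) <= 4 * (p * xg)) by nra.
    nra.
Qed.

Lemma stab_kernel r : 1 <= r -> exists c K1 K2, kernel c K1 K2 /\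
  forall j l, wt r (j + l) * ((jj j + jj l) / jj (j + l))
     <= (K1 (j + l)%Z j + K2 (j + l)%Z j) * (wt r j * wt r l).
Proof.
  intros Hr. set (C0 := 5 * Rpower 4 (r / 2)).
  assert (P0 : 0 < C0) by (unfold C0; assert (H := Rpower_pos 4 (r / 2)); lra).
  set (q := fun k => Rpower (jj k) (- / 2)).
  assert (Pq : forall k, 0 < q k) by (intros; apply Rpower_pos).
  assert (Eq : forall k, q k ^ 2 = / jj k).
  { intros k. unfold q. rewrite Rpower_sqr. replace (2 * - / 2) with (- (1)) by field.
    rewrite Rpower_Ropp, Rpower_1; auto. assert (H := jj_ge1 k); lra. }
  (* The squares sum to at most [2 C0^2 (5 + 5)] for the first kernel and [5 C0^2] for the second,
     with 5 from [sumb_inv_jj]; both stay below [(5 C0)^2]. *)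
  exists (5 * C0), (fun k j => C0 * (q j + q (k - j)%Z)), (fun k j => C0 * q k).
  assert (HS := sumb_inv_jj).
  split.
  - repeat split.
    + lra.
    + intros. assert (H1 := Pq j). assert (H2 := Pq (k - j)%Z). apply Rmult_le_pos; lra.
    + intros. assert (H1 := Pq k). apply Rmult_le_pos; lra.
    + intros k L HL.
      apply Rle_trans with (lsum (fun j => 2 * C0 ^ 2 * (/ jj j + / jj (k - j)%Z)) L).
      * apply lsum_le. intros j _. rewrite <- !Eq. assert (H := pow2_ge_0 (C0 * (q j - q (k - j)%Z))).
        nra.
      * rewrite lsum_scal, lsum_plus. assert (H1 := HS L HL).
        assert (H2 := sumb_invol_shift _ _ k HS L HL). cbv beta in *.
        assert (H3 := pow2_ge_0 C0). nra.
    + intros l L HL.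
      apply Rle_trans with (lsum (fun j => C0 ^ 2 * (/ jj (j + l))) L).
      * apply lsum_le. intros j _. rewrite <- Eq. apply Req_le. ring.
      * rewrite lsum_scal. assert (H2 := sumb_shift _ _ l HS L HL). cbv beta in *.
        assert (H3 := pow2_ge_0 C0). nra.
  - intros j l. replace (j + l - j)%Z with l by lia.
    replace (C0 * (q j + q l) + C0 * q (j + l)%Z) with (C0 * (q (j + l)%Z + q j + q l)) by ring.
    unfold wt, C0, q. apply stab_triple; try apply jj_ge1; [lra|apply jj_triang|apply jj_triang_l|apply jj_triang_r].
Qed.

Lemma sumb_cutoff (a : Z -> R) k : (forall j, 0 <= a j) ->
  sumb (fun j => if Rle_dec (jj j) (jj k) then a j else 0) (lsum a (zl (Z.abs_nat k))).
Proof.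
  intros Ha L HL. set (b := fun j => if Rle_dec (jj j) (jj k) then a j else 0).
  assert (Pb : forall j, 0 <= b j) by (intros j; unfold b; destruct (Rle_dec _ _); auto; lra).
  destruct (incl_zl L) as [n Hn].
  apply Rle_trans with (lsum b (zl (n + Z.abs_nat k))).
  { apply lsum_incl; auto. intros j Hj. apply Hn, in_zl in Hj. apply in_zl. lia. }
  apply Rle_trans with (lsum b (zl (Z.abs_nat k))).
  - apply Req_le, lsum_support; auto using NoDup_zl; intros j Hj; unfold b in Hj;
      (destruct (Rle_dec _ _) as [E|]; [|lra]); apply jj_le_abs in E; apply in_zl; lia.
  - apply lsum_le. intros j _. unfold b. destruct (Rle_dec _ _); auto; lra.
Qed.

Lemma lsum_one_zl n : lsum (fun _ => 1) (zl n) = 2 * INR n + 1.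
Proof. induction n as [|n IH]; [simpl; lra|]. rewrite lsum_zl_S, IH, S_INR. lra. Qed.

Lemma INR_abs_le_sqrt k : INR (Z.abs_nat k) <= Rpower (jj k) (/ 2).
Proof.
  assert (H := jj_ge1 k). rewrite Rpower_sqrt by lra.
  rewrite INR_IZR_INZ, Zabs2Nat.id_abs, abs_IZR, <- sqrt_Rsqr_abs.
  apply sqrt_le_1_alt. unfold jj, Rsqr. lra.
Qed.

(* Comparison with the integral of [x^(-p)]. *)
Lemma lsum_power p n : 0 < p -> p <> 1 ->
  lsum (fun j => Rpower (jj j) (- p / 2)) (zl (S n))
  <= 3 + 2 * ((Rpower (INR (S n)) (1 - p) - 1) / (1 - p)).
Proof.
  intros Hp Hp1. induction n as [|n IH].
  - rewrite lsum_zl_S, jj_opp. cbn [zl]. rewrite lsum_cons. simpl (lsum _ []).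
    replace (Rpower (INR 1) (1 - p)) with 1.
    + assert (E : forall k, Rpower (jj k) (- p / 2) <= 1) by (intros; apply Rpower_le1; [apply jj_ge1|lra]).
      assert (E1 := E (Z.of_nat 1)). assert (E2 := E 0%Z). unfold Rdiv at 3. lra.
    + simpl. unfold Rpower. now rewrite ln_1, Rmult_0_r, exp_0.
  - rewrite lsum_zl_S, jj_opp.
    set (m := INR (S (S n))). set (m0 := INR (S n)) in *.
    assert (Em : m = m0 + 1) by (unfold m, m0; rewrite (S_INR (S n)); reflexivity).
    assert (Pm0 : 1 <= m0) by (unfold m0; rewrite S_INR; assert (H := pos_INR n); lra).
    assert (E1 : Rpower (jj (Z.of_nat (S (S n)))) (- p / 2) <= Rpower m (- p)).
    { replace (Rpower m (- p)) with (Rpower (m ^ 2) (- p / 2)).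
      2:{ change 2%nat with (1 + 1)%nat. rewrite <- Rpower_pow by lra. rewrite Rpower_mult. f_equal.
          simpl. field. }
      replace (- p / 2) with (- (p / 2)) by field. rewrite !Rpower_Ropp.
      apply Rinv_le_contravar; [apply Rpower_pos|]. apply Rle_Rpower_l; [lra|].
      unfold jj. rewrite <- INR_IZR_INZ. fold m. assert (0 < m ^ 2) by (apply pow_lt; lra). lra. }
    assert (E2 : Rpower m (- p) <= (Rpower m (1 - p) - Rpower m0 (1 - p)) / (1 - p)).
    { destruct (MVT_cor2 (fun x => Rpower x (1 - p)) (fun x => (1 - p) * Rpower x (1 - p - 1)) m0 m)
        as [x [Hx1 Hx2]]; [lra| |].
      - intros c Hc. apply derivable_pt_lim_power. lra.
      - rewrite Hx1, Em. replace (m0 + 1 - m0) with 1 by ring.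
        replace ((1 - p) * Rpower x (1 - p - 1) * 1 / (1 - p)) with (Rpower x (1 - p - 1)) by (field; lra).
        replace (1 - p - 1) with (- p) by ring. rewrite !Rpower_Ropp.
        apply Rinv_le_contravar; [apply Rpower_pos|]. apply Rle_Rpower_l; lra. }
    replace ((Rpower m (1 - p) - 1) / (1 - p)) with
      ((Rpower m0 (1 - p) - 1) / (1 - p) + (Rpower m (1 - p) - Rpower m0 (1 - p)) / (1 - p)) by (field; lra).
    lra.
Qed.

(** The two regimes of [cutoff_power]: below [5/2] the exponent sits on the critical line, above
    [5/2] the frequency sum converges. The logarithmic case [s = 5/2] belongs to neither. *)
Definition err_exponents (r s : R) : Prop :=
  1 <= r /\ (s = r / 2 + 5 / 4 /\ s < 5 / 2 \/ 5 / 2 < s /\ r <= s).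

Definition cutsum (e : R) (k : Z) : R :=
  lsum (fun j => if Rle_dec (jj j) (jj k) then Rpower (jj j) e else 0) (zl (Z.abs_nat k)).

(** The summands behave like [|j|^(-p)] with [p = 2 (s - 2)]. For [p < 1] their sum over
    [|j| <= |k|] is of order [|k|^(1 - p)], and [2 (r - s) + 1 - p = 0] exactly when
    [s = r/2 + 5/4]. For [p > 1] the sum is bounded and [r <= s] suffices. *)
Lemma cutoff_power r s : err_exponents r s -> exists C0, 0 < C0 /\ forall k,
  Rpower (jj k) (r - s) * cutsum (2 - s) k <= C0.
Proof.
  intros [Hr H].
  assert (Hz : forall p, (0 < p -> p <> 1 -> forall k,
    cutsum (- p / 2) k <=
    3 + 2 * ((Rpower (INR (Z.abs_nat k)) (1 - p) - 1) / (1 - p)) \/ k = 0%Z /\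
    cutsum (- p / 2) k <= 1)).
  { intros p Hp Hp1 k. unfold cutsum. destruct (Z.abs_nat k) as [|n] eqn:E.
    - right. split; [lia|]. cbn [zl]. rewrite lsum_cons. simpl (lsum _ []).
      destruct (Rle_dec _ _); [|lra]. assert (Rpower (jj 0) (- p / 2) <= 1); [|lra].
      apply Rpower_le1; [apply jj_ge1|lra].
    - left. eapply Rle_trans; [|now apply lsum_power]. apply lsum_le. intros j _.
      destruct (Rle_dec _ _); [lra|apply Rlt_le, Rpower_pos]. }
  set (p := 2 * (s - 2)). replace (2 - s) with (- p / 2) by (unfold p; field).
  destruct H as [[Es H]|[H Hrs]].
  (* For [p <= 0] the terms do not decrease in [|j|]; the largest of them times their number
     replaces the comparison with an integral. *)
  - destruct (Rle_dec p 0) as [Hp|Hp].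
    + exists 3. split; [lra|]. intros k. assert (HX := jj_ge1 k).
      apply Rle_trans with (Rpower (jj k) (r - s) * (Rpower (jj k) (- p / 2) * (3 * Rpower (jj k) (/ 2)))).
      * apply Rmult_le_compat_l; [apply Rlt_le, Rpower_pos|].
        apply Rle_trans with (lsum (fun j => Rpower (jj k) (- p / 2) * 1) (zl (Z.abs_nat k))).
        { apply lsum_le. intros j _. destruct (Rle_dec _ _) as [Hj|Hj].
          - rewrite Rmult_1_r. apply Rle_Rpower_l; [lra|]. split; auto.
            assert (H1 := jj_ge1 j). lra.
          - rewrite Rmult_1_r. apply Rlt_le, Rpower_pos. }
        rewrite lsum_scal, lsum_one_zl. apply Rmult_le_compat_l; [apply Rlt_le, Rpower_pos|].
        assert (H1 := INR_abs_le_sqrt k). assert (1 <= Rpower (jj k) (/ 2)) by (apply Rpower_ge1; lra). lra.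
      * replace (Rpower (jj k) (r - s) * (Rpower (jj k) (- p / 2) * (3 * Rpower (jj k) (/ 2))))
          with (3 * (Rpower (jj k) (r - s) * Rpower (jj k) (- p / 2) * Rpower (jj k) (/ 2))) by ring.
        rewrite <- !Rpower_plus. replace (r - s + - p / 2 + / 2) with 0 by (unfold p; lra).
        rewrite Rpower_O by lra. lra.
    + assert (Hp1 : p < 1) by (unfold p; lra).
      assert (P1 : 0 < 2 / (1 - p)) by (apply Rdiv_lt_0_compat; lra).
      exists (3 + 2 / (1 - p)). split; [lra|].
      intros k. assert (HX := jj_ge1 k).
      apply Rle_trans with (Rpower (jj k) (r - s) * ((3 + 2 / (1 - p)) * Rpower (jj k) ((1 - p) / 2))).
      * apply Rmult_le_compat_l; [apply Rlt_le, Rpower_pos|].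
        assert (G : 1 <= Rpower (jj k) ((1 - p) / 2)) by (apply Rpower_ge1; lra).
        destruct (Hz p) with (k := k) as [E|[_ E]]; try lra.
        -- eapply Rle_trans; [apply E|].
           assert (E2 : Rpower (INR (Z.abs_nat k)) (1 - p) <= Rpower (jj k) ((1 - p) / 2)).
           { destruct (Z.eq_dec k 0) as [->|Hk].
             - replace (jj 0) with 1 by (unfold jj; simpl; ring). simpl.
               (* [ln 0] has the default value 0, so the left-hand side is 1 at [k = 0]. *)
               unfold Rpower at 1. unfold ln. destruct (Rlt_dec 0 0) as [Q|Q]; [destruct (Rlt_irrefl _ Q)|].
               rewrite Rmult_0_r, exp_0. apply Rpower_ge1; lra.
             - replace ((1 - p) / 2) with (/ 2 * (1 - p)) by field. rewrite <- Rpower_mult.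
               apply Rle_Rpower_l; [lra|]. split; [|apply INR_abs_le_sqrt].
               apply lt_0_INR. lia. }
           set (y := Rpower (jj k) ((1 - p) / 2)) in *.
           assert (E3 : (Rpower (INR (Z.abs_nat k)) (1 - p) - 1) / (1 - p) <= y / (1 - p)).
           { apply Rmult_le_compat_r; [apply Rlt_le, Rinv_0_lt_compat; lra|lra]. }
           replace ((3 + 2 / (1 - p)) * y) with (3 * y + 2 * (y / (1 - p))) by (field; lra). lra.
        -- eapply Rle_trans; [apply E|]. nra.
      * replace (Rpower (jj k) (r - s) * ((3 + 2 / (1 - p)) * Rpower (jj k) ((1 - p) / 2)))
          with ((3 + 2 / (1 - p)) * (Rpower (jj k) (r - s) * Rpower (jj k) ((1 - p) / 2))) by ring.
        rewrite <- Rpower_plus. replace (r - s + (1 - p) / 2) with 0 by (unfold p; lra).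
        rewrite Rpower_O by lra. lra.
  - assert (Hp1 : 1 < p) by (unfold p; lra).
    assert (P1 : 0 < 2 / (p - 1)) by (apply Rdiv_lt_0_compat; lra).
    exists (3 + 2 / (p - 1)). split; [lra|]. intros k. assert (HX := jj_ge1 k).
    assert (E1 : Rpower (jj k) (r - s) <= 1) by (apply Rpower_le1; lra).
    assert (E0 := Rpower_pos (jj k) (r - s)).
    assert (E2 : cutsum (- p / 2) k <= 3 + 2 / (p - 1)).
    { destruct (Hz p) with (k := k) as [E|[_ E]]; try lra. eapply Rle_trans; [apply E|].
      assert (E3 := Rpower_pos (INR (Z.abs_nat k)) (1 - p)).
      replace ((Rpower (INR (Z.abs_nat k)) (1 - p) - 1) / (1 - p))
        with (/ (p - 1) - Rpower (INR (Z.abs_nat k)) (1 - p) * / (p - 1)) by (field; lra).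
      assert (E4 : 0 < / (p - 1)) by (apply Rinv_0_lt_compat; lra).
      unfold Rdiv. nra. }
    assert (E3 : 0 <= cutsum (- p / 2) k).
    { apply lsum_nonneg. intros j. destruct (Rle_dec _ _); [apply Rlt_le, Rpower_pos|lra]. }
    nra.
Qed.

(** Only [l] appears in the first branch, yet the weight is symmetric up to constants there: when
    [jj (j + l)] is the smallest, [jj j] and [jj l] agree within the factor 4. *)
Definition errD (j l : Z) : R :=
  if Rle_dec (jj (j + l)) (Rmin (jj j) (jj l)) then Rpower (jj l) (3 / 2) * Rpower (jj (j + l)) (- / 2)
  else Rmin (jj j) (jj l).

(** If the output is smallest, [K2] is summed over the outputs [|k| <= |l|]; their number times the
    largest term is of order [jj l ^ (r + 5/2 - 2 s)], bounded because [s >= r/2 + 5/4]. Otherwise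
    the weight of the larger input absorbs part of the output weight and leaves [H] at the smaller
    input, which [cutoff_power] sums. *)
Lemma err_kernel r s : err_exponents r s -> exists c K1 K2, kernel c K1 K2 /\
  forall j l, wt r (j + l) * errD j l
     <= (K1 (j + l)%Z j + K2 (j + l)%Z j) * (wt s j * wt s l).
Proof.
  intros Hrs. destruct (cutoff_power r s Hrs) as [C0 [P0 HC0]]. destruct Hrs as [Hr Hrs].
  assert (Hs : r / 2 + 5 / 4 <= s) by lra.
  set (c := Rpower 4 (s / 2)). assert (Pc : 0 < c) by apply Rpower_pos.
  set (H := fun k j => if Rle_dec (jj j) (jj k) then
     c * (Rpower (jj j) (1 - s / 2) * Rpower (jj k) ((r - s) / 2)) else 0).
  assert (PH : forall k j, 0 <= H k j).
  { intros k j. unfold H. destruct (Rle_dec _ _); [|lra].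
    apply Rmult_le_pos; [lra|]. apply Rmult_le_pos; apply Rlt_le, Rpower_pos. }
  assert (SH : forall k, sumb (fun j => H k j ^ 2) (c ^ 2 * C0)).
  { intros k L HL.
    apply Rle_trans with (c ^ 2 * (Rpower (jj k) (r - s) *
      lsum (fun j => if Rle_dec (jj j) (jj k) then Rpower (jj j) (2 - s) else 0) L)).
    - rewrite <- !lsum_scal. apply lsum_le. intros j _. unfold H. destruct (Rle_dec _ _).
      + rewrite !Rpow_mult_distr, !Rpower_sqr.
        replace (2 * (1 - s / 2)) with (2 - s) by field. replace (2 * ((r - s) / 2)) with (r - s) by field.
        apply Req_le; ring.
      + apply Req_le; ring.
    - apply Rmult_le_compat_l; [apply pow2_ge_0|]. eapply Rle_trans; [|apply (HC0 k)].
      apply Rmult_le_compat_l; [apply Rlt_le, Rpower_pos|].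
      eapply Rle_trans; [|apply lsum_le; intros j _; apply Rle_refl].
      assert (S := sumb_cutoff (fun j => if Rle_dec (jj j) (jj k) then Rpower (jj j) (2 - s) else 0) k).
      eapply Rle_trans; [|apply S; [|exact HL]].
      + apply lsum_le. intros j _. destruct (Rle_dec _ _); lra.
      + intros j. destruct (Rle_dec _ _); [apply Rlt_le, Rpower_pos|lra]. }
  set (K2 := fun k j => if Rle_dec (jj k) (jj (k - j)) then
    c * (Rpower (jj k) ((r - 1) / 2) * Rpower (jj (k - j)) (3 / 2 - s)) else 0).
  assert (Pc2 := pow2_ge_0 c).
  assert (PK2 : forall k j, 0 <= K2 k j).
  { intros k j. unfold K2. destruct (Rle_dec _ _); [|lra].
    apply Rmult_le_pos; [lra|]. apply Rmult_le_pos; apply Rlt_le, Rpower_pos. }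
  (* [4 C0 c^2] comes from [(H + H')^2 <= 2 H^2 + 2 H'^2], and [3 c^2] from the count
     [2 |l| + 1 <= 3 jj l ^ (1/2)] for [K2]. *)
  set (C1 := 4 * C0 * c ^ 2 + 3 * c ^ 2).
  assert (P1 : 0 <= C1) by (unfold C1; nra).
  exists (sqrt C1), (fun k j => H k j + H k (k - j)%Z), K2. split.
  - unfold kernel. rewrite pow2_sqrt by assumption. repeat split.
    + apply sqrt_pos.
    + intros k j. assert (Q1 := PH k j). assert (Q2 := PH k (k - j)%Z). lra.
    + intros k j. apply PK2.
    + intros k L HL.
      apply Rle_trans with (lsum (fun j => 2 * (H k j ^ 2 + H k (k - j)%Z ^ 2)) L).
      * apply lsum_le. intros j _. assert (Q := pow2_ge_0 (H k j - H k (k - j)%Z)). nra.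
      * rewrite lsum_scal, lsum_plus. assert (Q1 := SH k L HL).
        assert (Q2 := sumb_invol_shift _ _ k (SH k) L HL). cbv beta in *. unfold C1. nra.
    + intros l L HL.
      set (a := fun k => if Rle_dec (jj k) (jj l) then c ^ 2 * Rpower (jj l) (r + 2 - 2 * s) else 0).
      apply Rle_trans with (lsum (fun j => a (j + l)%Z) L).
      * apply lsum_le. intros j _. unfold K2, a. replace (j + l - j)%Z with l by lia.
        destruct (Rle_dec _ _) as [E|E]; [|apply Req_le; ring].
        rewrite !Rpow_mult_distr, !Rpower_sqr. apply Rmult_le_compat_l; [assumption|].
        replace (2 * ((r - 1) / 2)) with (r - 1) by field.
        replace (r + 2 - 2 * s) with ((r - 1) + (2 * (3 / 2 - s))) by field.
        rewrite Rpower_plus. apply Rmult_le_compat_r; [apply Rlt_le, Rpower_pos|].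
        apply Rle_Rpower_l; [lra|]. assert (Q := jj_ge1 (j + l)). lra.
      * assert (Pa : 0 <= c ^ 2 * Rpower (jj l) (r + 2 - 2 * s)).
        { apply Rmult_le_pos; [assumption|apply Rlt_le, Rpower_pos]. }
        assert (S := sumb_cutoff (fun _ => c ^ 2 * Rpower (jj l) (r + 2 - 2 * s)) l (fun _ => Pa)).
        eapply Rle_trans; [apply (sumb_shift _ _ l S L HL)|].
        rewrite (lsum_ext _ (fun _ => (c ^ 2 * Rpower (jj l) (r + 2 - 2 * s)) * 1)) by (intros; ring).
        rewrite lsum_scal, lsum_one_zl. assert (HX := jj_ge1 l).
        apply Rle_trans with (c ^ 2 * Rpower (jj l) (r + 2 - 2 * s) * (3 * Rpower (jj l) (/ 2))).
        -- apply Rmult_le_compat_l; [assumption|]. assert (Q1 := INR_abs_le_sqrt l).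
           assert (1 <= Rpower (jj l) (/ 2)) by (apply Rpower_ge1; lra). lra.
        -- replace (c ^ 2 * Rpower (jj l) (r + 2 - 2 * s) * (3 * Rpower (jj l) (/ 2)))
             with (3 * c ^ 2 * (Rpower (jj l) (r + 2 - 2 * s) * Rpower (jj l) (/ 2))) by ring.
           rewrite <- Rpower_plus.
           assert (Rpower (jj l) (r + 2 - 2 * s + / 2) <= 1) by (apply Rpower_le1; lra).
           unfold C1. assert (0 <= 4 * C0 * c ^ 2) by nra. nra.
  - intros j l. replace (j + l - j)%Z with l by lia.
    assert (HX := jj_ge1 (j + l)). assert (HY := jj_ge1 j). assert (HZ := jj_ge1 l).
    assert (TX := jj_triang j l). assert (TY := jj_triang_l j l). assert (TZ := jj_triang_r j l).
    assert (Q1 := PH (j + l)%Z j). assert (Q2 := PH (j + l)%Z l). assert (Q3 := PK2 (j + l)%Z j).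
    assert (W : 0 < wt s j * wt s l) by (apply Rmult_lt_0_compat; apply wt_pos).
    assert (G : forall t, wt r (j + l) * errD j l <= t * (wt s j * wt s l) ->
      t <= H (j + l)%Z j + H (j + l)%Z l + K2 (j + l)%Z j ->
      wt r (j + l) * errD j l <= (H (j + l)%Z j + H (j + l)%Z l + K2 (j + l)%Z j) * (wt s j * wt s l)).
    { intros t Ht1 Ht2. eapply Rle_trans; [apply Ht1|]. apply Rmult_le_compat_r; lra. }
    assert (W4 : forall x y, 1 <= x -> x <= 4 * y -> Rpower x (s / 2) <= c * Rpower y (s / 2)).
    { intros x y Hx Hy. unfold c. rewrite Rpower_mult_distr by lra. apply Rle_Rpower_l; lra. }
    (* [x] stands for the output, [y] for the smaller input and [z] for the larger one. *)
    assert (BC : forall x y z, 1 <= x -> 1 <= y -> 1 <= z -> x <= 4 * z ->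
      Rpower x (r / 2) * y <= c * (Rpower y (1 - s / 2) * Rpower x ((r - s) / 2))
        * (Rpower y (s / 2) * Rpower z (s / 2))).
    { intros x y z Hx Hy Hz Hxz.
      replace (c * (Rpower y (1 - s / 2) * Rpower x ((r - s) / 2)) * (Rpower y (s / 2) * Rpower z (s / 2)))
        with (Rpower x ((r - s) / 2) * (c * Rpower z (s / 2)) * (Rpower y (1 - s / 2) * Rpower y (s / 2))) by ring.
      rewrite <- (Rpower_plus (1 - s / 2)). replace (1 - s / 2 + s / 2) with 1 by ring.
      rewrite Rpower_1 by lra. apply Rmult_le_compat_r; [lra|].
      replace (r / 2) with ((r - s) / 2 + s / 2) by field. rewrite Rpower_plus.
      apply Rmult_le_compat_l; [apply Rlt_le, Rpower_pos|]. now apply W4. }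
    destruct (Rle_dec (jj (j + l)) (Rmin (jj j) (jj l))) as [EA|EA].
    + apply (G (K2 (j + l)%Z j)); [|lra]. unfold errD, K2.
      destruct (Rle_dec (jj (j + l)) (Rmin (jj j) (jj l))) as [_|]; [|contradiction].
      replace (j + l - j)%Z with l by lia.
      assert (EY : jj (j + l) <= jj j) by (eapply Rle_trans; [apply EA|apply Rmin_l]).
      assert (EZ : jj (j + l) <= jj l) by (eapply Rle_trans; [apply EA|apply Rmin_r]).
      destruct (Rle_dec _ _) as [_|]; [|contradiction]. unfold wt.
      replace (c * (Rpower (jj (j + l)) ((r - 1) / 2) * Rpower (jj l) (3 / 2 - s)) *
          (Rpower (jj j) (s / 2) * Rpower (jj l) (s / 2)))
        with (Rpower (jj (j + l)) ((r - 1) / 2) * (Rpower (jj l) (3 / 2 - s) * Rpower (jj l) (s / 2)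
          * (c * Rpower (jj j) (s / 2)))) by ring.
      replace ((r - 1) / 2) with (r / 2 + - / 2) by field. rewrite Rpower_plus.
      replace (Rpower (jj (j + l)) (r / 2) * (Rpower (jj l) (3 / 2) * Rpower (jj (j + l)) (- / 2)))
        with (Rpower (jj (j + l)) (r / 2) * Rpower (jj (j + l)) (- / 2) * Rpower (jj l) (3 / 2)) by ring.
      apply Rmult_le_compat_l; [apply Rmult_le_pos; apply Rlt_le, Rpower_pos|].
      replace (3 / 2) with (3 / 2 - s + s / 2 + s / 2) at 1 by field. rewrite !Rpower_plus.
      apply Rmult_le_compat_l; [apply Rmult_le_pos; apply Rlt_le, Rpower_pos|]. apply W4; lra.
    + unfold errD in *. destruct (Rle_dec (jj (j + l)) (Rmin (jj j) (jj l))) as [|_]; [contradiction|].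
      unfold Rmin in *. destruct (Rle_dec (jj j) (jj l)) as [E|E].
      * apply (G (H (j + l)%Z j)); [|lra]. unfold H. destruct (Rle_dec _ _); [|lra].
        unfold wt. apply BC; lra.
      * apply (G (H (j + l)%Z l)); [|lra]. unfold H. destruct (Rle_dec _ _); [|lra].
        unfold wt. rewrite (Rmult_comm (Rpower (jj j) (s / 2))). apply BC; lra.
Qed.

(** * Symbols of the scheme *)

Lemma cexpi_0 : cexpi 0 = RtoC 1.
Proof. unfold cexpi. now rewrite cos_0, sin_0. Qed.

Lemma cexpi_plus x y : cexpi (x + y) = Cmult (cexpi x) (cexpi y).
Proof.
  unfold cexpi, Cmult; simpl. rewrite cos_plus, sin_plus. f_equal; ring.
Qed.

Lemma Cmod_cexpi x : Cmod (cexpi x) = 1.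
Proof.
  unfold Cmod, cexpi; simpl. transitivity (sqrt 1); [f_equal|apply sqrt_1].
  assert (H := sin2_cos2 x). unfold Rsqr in H. lra.
Qed.

Lemma cexpi_opp x : cexpi (- x) = Cconj (cexpi x).
Proof. unfold cexpi, Cconj; simpl. now rewrite cos_neg, sin_neg. Qed.

Lemma Rabs_sin_le x : Rabs (sin x) <= Rabs x.
Proof.
  assert (P : forall y, 0 < y -> Rabs (sin y) <= y).
  { intros y Hy. apply Rabs_le. split; [|now apply Rlt_le, sin_lt_x].
    destruct (Rle_dec y 1) as [H|H].
    - assert (0 <= sin y); [|lra]. apply sin_ge_0; [lra|]. assert (Q := PI2_1). lra.
    - assert (Q := SIN_bound y). lra. }
  destruct (Rtotal_order x 0) as [H|[->|H]].
  - rewrite <- (Rabs_Ropp (sin x)), <- sin_neg, (Rabs_left x) by lra. apply P; lra.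
  - rewrite sin_0. lra.
  - rewrite (Rabs_right x) by lra. now apply P.
Qed.

(** The modulus on the left is [2 |sin (x/2)|]. *)
Lemma Cmod_cexpi_m1 x : Cmod (Cminus (cexpi x) (RtoC 1)) <= Rabs x.
Proof.
  apply Rsqr_incr_0_var; [|apply Rabs_pos]. rewrite !Rsqr_pow2, Cmod_sqr, pow2_abs.
  assert (E : Re (Cminus (cexpi x) (RtoC 1)) ^ 2 + Im (Cminus (cexpi x) (RtoC 1)) ^ 2
              = 4 * sin (x / 2) ^ 2).
  { unfold Re, Im, cexpi, Cminus, Cplus, Copp, RtoC; simpl.
    replace x with (2 * (x / 2)) at 1 2 3 4 by field.
    rewrite cos_2a, sin_2a. assert (H := sin2_cos2 (x / 2)). unfold Rsqr in H.
    set (s := sin (x / 2)) in *. set (c := cos (x / 2)) in *.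
    assert (Hc : c * c = 1 - s * s) by lra.
    replace (2 * s * c + - 0) with (2 * (s * c)) by ring.
    replace (2 * (s * c) * (2 * (s * c) * 1)) with (4 * (s * s) * (c * c)) by ring.
    rewrite Hc. ring. }
  rewrite E. assert (H := Rabs_sin_le (x / 2)).
  assert (H1 : Rabs (sin (x / 2)) ^ 2 <= Rabs (x / 2) ^ 2) by (apply pow_incr; split; [apply Rabs_pos|auto]).
  rewrite !pow2_abs in H1. nra.
Qed.

Lemma Cmod_cexpi_m1_2 x : Cmod (Cminus (cexpi x) (RtoC 1)) <= 2.
Proof.
  unfold Cminus. eapply Rle_trans; [apply Cmod_triangle|].
  rewrite Cmod_opp, Cmod_cexpi, Cmod_R, Rabs_R1. lra.
Qed.

Lemma Cmod_cexpi_minus x y : Cmod (Cminus (cexpi x) (cexpi y)) <= Rabs (x - y).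
Proof.
  replace (Cminus (cexpi x) (cexpi y)) with (Cmult (cexpi y) (Cminus (cexpi (x - y)) (RtoC 1))).
  - rewrite Cmod_mult, Cmod_cexpi, Rmult_1_l. apply Cmod_cexpi_m1.
  - replace x with ((x - y) + y) at 2 by ring. rewrite cexpi_plus. ring.
Qed.

Lemma Ci2 : Cmult Ci Ci = Copp (RtoC 1).
Proof. unfold Ci, Cmult, Copp, RtoC; simpl. f_equal; ring. Qed.

Lemma Cmod_Ci : Cmod Ci = 1.
Proof. unfold Cmod, Ci; simpl. transitivity (sqrt 1); [f_equal|apply sqrt_1]. ring. Qed.

Lemma RtoC_neq0 x : x <> 0 -> RtoC x <> RtoC 0.
Proof. intros H E. apply H. now injection E. Qed.

(* [ph tau q] is the integral over [0 <= s <= tau] of [exp (-2 i s q)]. *)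
Definition ph (tau q : R) : C :=
  Cmult (Cdiv Ci (RtoC (2 * q))) (Cminus (cexpi (- 2 * tau * q)) (RtoC 1)).

Lemma Cmod_ph tau q : 0 <= tau -> q <> 0 -> Cmod (ph tau q) <= tau.
Proof.
  intros Ht Hq. unfold ph, Cdiv. rewrite !Cmod_mult, Cmod_Ci, Cmod_inv by (apply RtoC_neq0; lra).
  rewrite Cmod_R. assert (H := Cmod_cexpi_m1 (- 2 * tau * q)).
  assert (P : 0 < Rabs (2 * q)) by (apply Rabs_pos_lt; lra).
  rewrite Rmult_1_l. apply Rmult_le_reg_l with (Rabs (2 * q)); auto.
  rewrite <- Rmult_assoc, Rinv_r, Rmult_1_l by lra. eapply Rle_trans; [apply H|].
  replace (- 2 * tau * q) with (- (tau * (2 * q))) by ring.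
  rewrite Rabs_Ropp, Rabs_mult, (Rabs_right tau) by lra. lra.
Qed.

Lemma ph_0 q : ph 0 q = RtoC 0.
Proof. unfold ph. replace (- 2 * 0 * q) with 0 by ring. rewrite cexpi_0. unfold Cminus. rewrite Cplus_opp_r. apply Cmult_0_r. Qed.

(** * Algebra of bilinear operators *)

Definition ab (m : Z -> Z -> C) (f g : Fc) (k : Z) : Prop :=
  absc (fun j => Cmult (m j (k - j)%Z) (Cmult (f j) (g (k - j)%Z))).

Definition poly2 (m : Z -> Z -> C) : Prop :=
  exists c, 0 <= c /\ forall j l, Cmod (m j l) <= c * (1 + IZR j ^ 2 + IZR l ^ 2).

Lemma wt1_ge_abs k : Rabs (IZR k) <= wt 1 k.
Proof.
  unfold wt. replace (1 / 2) with (/ 2) by field. assert (H := jj_ge1 k). rewrite Rpower_sqrt by lra.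
  rewrite <- sqrt_Rsqr_abs. apply sqrt_le_1_alt. unfold jj, Rsqr. lra.
Qed.

Lemma wt1_ge1 k : 1 <= wt 1 k.
Proof. apply Rpower_ge1; [apply jj_ge1|lra]. Qed.

(** At fixed [k], [j^2 <= |j| (|k| + |k - j|)] is at most [(|k| + 1) <j><k - j>]: the quadratic
    growth is shared evenly by the two factors, so [H^1] is enough. The brackets of the scheme can
    thus be split into their single products before any cancellation is used. *)
Lemma poly2_ab m f g A B k : poly2 m -> nb 1 f A -> nb 1 g B -> ab m f g k.
Proof.
  intros [c [Hc Hm]] Hf Hg. apply Bil_absc with A B (c * (1 + 2 * (Rabs (IZR k) + 1))); auto.
  - apply Rmult_le_pos; auto. assert (H := Rabs_pos (IZR k)). lra.
  - intros j. eapply Rle_trans; [apply Hm|]. rewrite Rmult_assoc. apply Rmult_le_compat_l; auto.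
    assert (H1 := wt1_ge_abs j). assert (H2 := wt1_ge_abs (k - j)). assert (H3 := wt1_ge1 j).
    assert (H4 := wt1_ge1 (k - j)). rewrite <- (pow2_abs (IZR j)), <- (pow2_abs (IZR (k - j))).
    assert (T1 : Rabs (IZR j) <= Rabs (IZR k) + Rabs (IZR (k - j))).
    { rewrite <- Rabs_Ropp with (IZR (k - j)), minus_IZR. replace (IZR j) with (IZR k + - (IZR k - IZR j)) at 1 by ring.
      apply Rabs_triang. }
    assert (T2 : Rabs (IZR (k - j)) <= Rabs (IZR k) + Rabs (IZR j)).
    { rewrite <- Rabs_Ropp with (IZR j), minus_IZR. apply Rabs_triang. }
    assert (P1 := Rabs_pos (IZR j)). assert (P2 := Rabs_pos (IZR (k - j))). assert (P3 := Rabs_pos (IZR k)).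
    set (a := Rabs (IZR j)) in *. set (b := Rabs (IZR (k - j))) in *. set (x := Rabs (IZR k)) in *.
    set (u := wt 1 j) in *. set (v := wt 1 (k - j)) in *.
    assert (1 <= u * v) by nra.
    assert (a ^ 2 <= (x + 1) * (u * v)).
    { apply Rle_trans with (u * (x + b)); [simpl; rewrite Rmult_1_r; apply Rmult_le_compat; lra|].
      replace ((x + 1) * (u * v)) with (u * ((x + 1) * v)) by ring. apply Rmult_le_compat_l; nra. }
    assert (b ^ 2 <= (x + 1) * (u * v)).
    { apply Rle_trans with (v * (x + a)); [simpl; rewrite Rmult_1_r; apply Rmult_le_compat; lra|].
      replace ((x + 1) * (u * v)) with (v * ((x + 1) * u)) by ring. apply Rmult_le_compat_l; nra. }
    lra.
Qed.

Lemma Bil_lin m1 m2 c1 c2 f g k : ab m1 f g k -> ab m2 f g k ->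
  Bil (fun j l => Cplus (Cmult c1 (m1 j l)) (Cmult c2 (m2 j l))) f g k
  = Cplus (Cmult c1 (Bil m1 f g k)) (Cmult c2 (Bil m2 f g k)).
Proof.
  intros H1 H2. unfold Bil. rewrite <- !CsumZ_scal by assumption.
  rewrite <- CsumZ_plus by (apply absc_scal; assumption). apply CsumZ_ext. intros; ring.
Qed.

Lemma Bil_lin3 m1 m2 m3 c1 c2 c3 f g k : ab m1 f g k -> ab m2 f g k -> ab m3 f g k ->
  Bil (fun j l => Cplus (Cplus (Cmult c1 (m1 j l)) (Cmult c2 (m2 j l))) (Cmult c3 (m3 j l))) f g k
  = Cplus (Cplus (Cmult c1 (Bil m1 f g k)) (Cmult c2 (Bil m2 f g k))) (Cmult c3 (Bil m3 f g k)).
Proof.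
  intros H1 H2 H3. unfold Bil. rewrite <- !CsumZ_scal by assumption.
  rewrite <- CsumZ_plus by (apply absc_scal; assumption).
  rewrite <- CsumZ_plus by (try apply absc_plus; apply absc_scal; assumption).
  apply CsumZ_ext. intros; ring.
Qed.

Lemma Bil_scal m c f g k : ab m f g k ->
  Bil (fun j l => Cmult c (m j l)) f g k = Cmult c (Bil m f g k).
Proof.
  intros H. unfold Bil. rewrite <- CsumZ_scal by assumption. apply CsumZ_ext. intros; ring.
Qed.

Lemma Bil_plus_l m f f' g k : ab m f g k -> ab m f' g k ->
  Bil m (fadd f f') g k = Cplus (Bil m f g k) (Bil m f' g k).
Proof.
  intros H1 H2. unfold Bil. rewrite <- CsumZ_plus by assumption. apply CsumZ_ext. intros; unfold fadd; ring.
Qed.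

Lemma Bil_minus_l m f f' g k : ab m f g k -> ab m f' g k ->
  Bil m (fsub f f') g k = Cminus (Bil m f g k) (Bil m f' g k).
Proof.
  intros H1 H2. unfold Bil. rewrite <- CsumZ_minus by assumption.
  apply CsumZ_ext. intros; unfold fsub; ring.
Qed.

Lemma Bil_minus_r m f g g' k : ab m f g k -> ab m f g' k ->
  Bil m f (fsub g g') k = Cminus (Bil m f g k) (Bil m f g' k).
Proof.
  intros H1 H2. unfold Bil. rewrite <- CsumZ_minus by assumption.
  apply CsumZ_ext. intros; unfold fsub; ring.
Qed.

Lemma Bil_swap m f g k : ab m f g k -> Bil m f g k = Bil (fun j l => m l j) g f k.
Proof.
  intros H. unfold Bil.
  rewrite <- (CsumZ_invol _ (fun j => (k - j)%Z)) by (auto; intros; lia).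
  apply CsumZ_ext. intros j. replace (k - (k - j))%Z with j by lia. ring.
Qed.

(** The iterates have mean zero, so symbols need to agree only where both inputs are nonzero; this
    gives a meaning to the divisions by [j] and [l]. *)
Lemma Bil_congr m m' f g k : f 0%Z = RtoC 0 -> g 0%Z = RtoC 0 ->
  (forall j l, (j <> 0)%Z -> (l <> 0)%Z -> (j + l = k)%Z -> m j l = m' j l) ->
  Bil m f g k = Bil m' f g k.
Proof.
  intros Hf Hg H. apply CsumZ_ext. intros j.
  destruct (Z.eq_dec j 0) as [->|Hj]; [rewrite Hf; ring|].
  destruct (Z.eq_dec (k - j) 0) as [E|Hl]; [rewrite E, Hg; ring|].
  rewrite (H j (k - j)%Z); auto. lia.
Qed.

Lemma fmul_Bil f g k : fmul f g k = Bil (fun _ _ => RtoC 1) f g k.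
Proof. apply CsumZ_ext. intros; ring. Qed.

Lemma fmul_mult_Bil a b f g k :
  fmul (Defs.mult a f) (Defs.mult b g) k = Bil (fun j l => Cmult (a j) (b l)) f g k.
Proof. apply CsumZ_ext. intros; unfold Defs.mult; ring. Qed.

(** * The quadratic part of the scheme as bilinear operators *)

(** Removes the frequencies where the symbols below have a vanishing denominator: zero inputs do not
    occur since [f 0 = 0], and the zero output is annihilated by [B]. *)
Definition guard (j l : Z) (c : C) : C :=
  if (negb (Z.eqb j 0) && negb (Z.eqb l 0) && negb (Z.eqb (j + l) 0))%bool then c else RtoC 0.

Lemma guard_nz j l c : (j <> 0)%Z -> (l <> 0)%Z -> (j + l <> 0)%Z -> guard j l c = c.
Proof.
  intros H1 H2 H3. unfold guard. apply Z.eqb_neq in H1, H2, H3. now rewrite H1, H2, H3.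
Qed.

Lemma guard_cases j l c (P : C -> Prop) : P (RtoC 0) ->
  ((j <> 0)%Z -> (l <> 0)%Z -> (j + l <> 0)%Z -> P c) -> P (guard j l c).
Proof.
  intros H0 H. unfold guard.
  destruct (Z.eqb_spec j 0), (Z.eqb_spec l 0), (Z.eqb_spec (j + l) 0); simpl; auto.
Qed.

(** The six symbols have the inputs [x, y] and the output [x + y]. The four for [ubar^2] are a
    rational coefficient times the time integral [ph] of one factor of the phase, with [- t] as the
    integral of the [-1] in [a + b - 1]; [gI1] and [gI2] integrate a full phase. *)
Definition gL1 (t : R) (j l : Z) : C := let x := IZR j in let y := IZR l in
  guard j l (Cmult (RtoC (y ^ 2 / (x + y) ^ 2)) (ph t (x ^ 2))).
Definition gL2 (t : R) (j l : Z) : C := let x := IZR j in let y := IZR l in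
  guard j l (Cmult (RtoC (x ^ 2 / (x + y) ^ 2)) (Cminus (ph t ((x + y) * x)) (RtoC t))).
Definition gL3 (t : R) (j l : Z) : C := let x := IZR j in let y := IZR l in
  guard j l (Cmult (RtoC (2 * x * y / (x + y) ^ 2)) (ph t ((x + y) ^ 2))).
Definition gL4 (t : R) (j l : Z) : C := let x := IZR j in let y := IZR l in
  guard j l (Cmult (RtoC (2 * x * y / (x + y) ^ 2)) (Cminus (ph t (- (x * y))) (RtoC t))).
Definition gI1 (t : R) (j l : Z) : C := guard j l (ph t (IZR j * IZR l)).
Definition gI2 (t : R) (j l : Z) : C := guard j l (ph t ((IZR j + IZR l) * IZR l)).

Definition dxs (m : nat) (k : Z) : C := Cpow (Cmult Ci (RtoC (IZR k))) m.
Definition dis (m : nat) (k : Z) : C :=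
  if Z.eq_dec k 0 then RtoC 0 else Cinv (Cpow (Cmult Ci (RtoC (IZR k))) m).
Definition Sg (t : R) (k : Z) : C := cexpi (- t * IZR k ^ 2).

Lemma IZR_C_neq0 k : (k <> 0)%Z -> RtoC (IZR k) <> RtoC 0.
Proof. intros H. apply RtoC_neq0. now apply not_0_IZR. Qed.

Lemma Ci_neq0 : Ci <> RtoC 0.
Proof. intros E. apply R1_neq_R0. injection E. auto. Qed.

Lemma dxs1 k : dxs 1 k = Cmult Ci (RtoC (IZR k)).
Proof. unfold dxs. simpl. ring. Qed.

Lemma dxs2 k : dxs 2 k = Copp (Cmult (RtoC (IZR k)) (RtoC (IZR k))).
Proof.
  unfold dxs. simpl. assert (H := Ci2). ring [H].
Qed.

Ltac solve_dis :=
  let Hk := fresh in intros Hk; unfold dis; destruct (Z.eq_dec _ 0) as [|_]; [contradiction|]; simpl;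
  apply IZR_C_neq0 in Hk; generalize Ci2 Ci_neq0; intros; field [Ci2]; auto.

Lemma dis1 k : (k <> 0)%Z -> dis 1 k = Cdiv (Copp Ci) (RtoC (IZR k)).
Proof. solve_dis. Qed.

Lemma dis2 k : (k <> 0)%Z -> dis 2 k = Copp (Cinv (Cmult (RtoC (IZR k)) (RtoC (IZR k)))).
Proof. solve_dis. Qed.

Lemma dis3 k : (k <> 0)%Z -> dis 3 k
  = Cdiv Ci (Cmult (RtoC (IZR k)) (Cmult (RtoC (IZR k)) (RtoC (IZR k)))).
Proof. solve_dis. Qed.

Lemma dis4 k : (k <> 0)%Z -> dis 4 k
  = Cinv (Cmult (Cmult (RtoC (IZR k)) (RtoC (IZR k))) (Cmult (RtoC (IZR k)) (RtoC (IZR k)))).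
Proof. solve_dis. Qed.

Definition mo (p : nat) (a : Z -> C) : Prop := forall j, Cmod (a j) <= Rabs (IZR j) ^ p.

Lemma Cmod_Ci_pow k m : Cmod (Cpow (Cmult Ci (RtoC (IZR k))) m) = Rabs (IZR k) ^ m.
Proof. now rewrite Cmod_pow, Cmod_mult, Cmod_Ci, Cmod_R, Rmult_1_l. Qed.

Lemma mo_dxs m : mo m (dxs m).
Proof. intros k. apply Req_le, Cmod_Ci_pow. Qed.

Lemma Rabs_IZR_ge1 k : (k <> 0)%Z -> 1 <= Rabs (IZR k).
Proof. intros H. rewrite <- abs_IZR. apply IZR_le. lia. Qed.

Lemma mo_dis m : mo 0 (dis m).
Proof.
  intros k. simpl. unfold dis. destruct (Z.eq_dec k 0); [rewrite Cmod_0; lra|].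
  assert (H : Cpow (Cmult Ci (RtoC (IZR k))) m <> RtoC 0).
  { apply Cpow_nz. apply Cmult_neq_0; [apply Ci_neq0|now apply IZR_C_neq0]. }
  rewrite Cmod_inv, Cmod_Ci_pow by assumption. rewrite <- Rinv_1.
  apply Rinv_le_contravar; [lra|]. apply pow_R1_Rle. now apply Rabs_IZR_ge1.
Qed.

Lemma mo_Sg t p a : mo p a -> mo p (fun j => Cmult (Sg t j) (a j)).
Proof. intros H k. rewrite Cmod_mult. unfold Sg. rewrite Cmod_cexpi, Rmult_1_l. apply H. Qed.

Lemma mo_Sg0 t : mo 0 (Sg t).
Proof. intros k. unfold Sg. rewrite Cmod_cexpi. simpl. lra. Qed.

Lemma mo_one : mo 0 (fun _ => RtoC 1).
Proof. intros k. rewrite Cmod_1. simpl. lra. Qed.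

Lemma poly2_prod p q a b : (p + q <= 2)%nat -> mo p a -> mo q b ->
  poly2 (fun j l => Cmult (a j) (b l)).
Proof.
  intros Hpq Ha Hb. exists 1. split; [lra|]. intros j l. rewrite Cmod_mult, Rmult_1_l.
  apply Rle_trans with (Rabs (IZR j) ^ p * Rabs (IZR l) ^ q).
  - apply Rmult_le_compat; auto using Cmod_ge_0.
  - rewrite <- (pow2_abs (IZR j)), <- (pow2_abs (IZR l)).
    assert (P1 := Rabs_pos (IZR j)). assert (P2 := Rabs_pos (IZR l)).
    set (x := Rabs (IZR j)) in *. set (y := Rabs (IZR l)) in *.
    assert (0 <= (x - 1) ^ 2) by apply pow2_ge_0. assert (0 <= (y - 1) ^ 2) by apply pow2_ge_0.
    assert (0 <= (x - y) ^ 2) by apply pow2_ge_0.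
    destruct p as [|[|[|p]]], q as [|[|[|q]]]; try lia; simpl in *; nra.
Qed.

Lemma poly2_swap m : poly2 m -> poly2 (fun j l => m l j).
Proof. intros [c [Hc H]]. exists c. split; auto. intros j l. specialize (H l j). nra. Qed.

Lemma fconj_0 f : f 0%Z = RtoC 0 -> fconj f 0%Z = RtoC 0.
Proof.
  intros H. unfold fconj. simpl. rewrite H. unfold Cconj, RtoC; simpl. f_equal. ring.
Qed.

(** The form [1 + 1] lets [field] compute with the constant and turns its side condition into
    [C2_neq0]. *)
Lemma RtoC_2 : RtoC 2 = Cplus (RtoC 1) (RtoC 1).
Proof. rewrite <- RtoC_plus. f_equal. Qed.

Lemma C2_neq0 : Cplus (RtoC 1) (RtoC 1) <> RtoC 0.
Proof. rewrite <- RtoC_2. apply RtoC_neq0. lra. Qed.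

Lemma RtoC_half : RtoC (/ 2) = Cinv (Cplus (RtoC 1) (RtoC 1)).
Proof. rewrite <- RtoC_2. apply RtoC_inv. lra. Qed.

Ltac push_RtoC := repeat progress rewrite ?RtoC_opp, ?RtoC_half, ?RtoC_pow, ?RtoC_mult, ?RtoC_plus, ?RtoC_2.

Lemma IZR_sum_neq0 j l : (j + l <> 0)%Z -> IZR j + IZR l <> 0.
Proof. intros H. rewrite <- plus_IZR. now apply not_0_IZR. Qed.

Ltac symbols j l Hj Hl Hk :=
  assert (Nx := IZR_C_neq0 j Hj); assert (Ny := IZR_C_neq0 l Hl);
  assert (Nk := RtoC_neq0 _ (IZR_sum_neq0 j l Hk)); rewrite RtoC_plus in Nk;
  rewrite ?plus_IZR, ?RtoC_div by (apply pow_nonzero, IZR_sum_neq0; assumption); push_RtoC.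

(** Rational identities are decided modulo the relation [Ci * Ci = -1]. *)
Ltac use_field := generalize Ci2 Ci_neq0 C2_neq0; intros; field [Ci2]; auto.

Section Brackets.

Variables (f : Fc) (A t : R).
Hypotheses (Hf : nb 1 f A) (f0 : f 0%Z = RtoC 0).
Let h := fconj f.

Let Hh : nb 1 h A. Proof. now apply nb_conj. Qed.
Let h0 : h 0%Z = RtoC 0. Proof. now apply fconj_0. Qed.

(** The second product of [L1] carries its derivatives on the opposite factors. It is swapped first,
    because the two symbols combine into a single [ph] only when they are aligned. *)
Lemma L1_Bil k : (k <> 0)%Z -> L1 t f k = Bil (gL1 t) h h k.
Proof.
  intros Hk. set (m1 := fun j l => Cmult (Cmult (Sg (2 * t) j) (dis 2 j)) (dxs 2 l)).
  set (m2 := fun j l => Cmult (dxs 2 j) (dis 2 l)).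
  assert (P1 : ab m1 h h k).
  { apply poly2_ab with A A; auto. apply (poly2_prod 0 2); auto using mo_Sg, mo_dis, mo_dxs. }
  assert (P2 : poly2 m2) by (apply (poly2_prod 2 0); auto using mo_dis, mo_dxs).
  assert (P2' : ab (fun j l => m2 l j) h h k) by (apply poly2_ab with A A; auto; now apply poly2_swap).
  transitivity (Cplus (Cmult (Cmult (ci (- / 2)) (dis 2 k)) (Bil m1 h h k))
                      (Cmult (Cmult (ci (/ 2)) (dis 2 k)) (Bil (fun j l => m2 l j) h h k))).
  - rewrite <- (Bil_swap m2 h h k) by (apply poly2_ab with A A; auto).
    rewrite <- !Cmult_assoc. unfold L1, fadd, fscal. f_equal; f_equal.
    + unfold dxinv at 1, Defs.mult at 1. f_equal. apply CsumZ_ext. intros j.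
      unfold m1, Sgrp, dxinv, dx, Defs.mult, Sg, dis, dxs, h. ring.
    + unfold dxinv at 1, Defs.mult at 1. f_equal. apply CsumZ_ext. intros j.
      unfold m2, dxinv, dx, Defs.mult, dis, dxs, h. ring.
  - rewrite <- Bil_lin by assumption. apply Bil_congr; auto. intros j l Hj Hl Hjl. subst k.
    unfold gL1. cbv zeta. rewrite guard_nz by assumption. unfold m1, m2, ph, ci, Sg.
    rewrite !dis2, !dxs2 by assumption.
    replace (- (2 * t) * IZR j ^ 2) with (- 2 * t * IZR j ^ 2) by ring.
    set (E := cexpi _). symbols j l Hj Hl Hk. use_field.
Qed.

Lemma L2_Bil k : (k <> 0)%Z -> L2 t f k = Bil (gL2 t) h h k.
Proof.
  intros Hk. set (m1 := fun j l => Cmult (Cmult (Sg t j) (dxs 1 j)) (Sg (- t) l)).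
  set (m2 := fun j l : Z => Cmult (dxs 1 j) (RtoC 1)).
  set (m3 := fun j l : Z => Cmult (dxs 2 j) (RtoC 1)).
  assert (P1 : ab m1 h h k).
  { apply poly2_ab with A A; auto. apply (poly2_prod 1 0); auto using mo_Sg0, mo_Sg, mo_dxs. }
  assert (P2 : ab m2 h h k).
  { apply poly2_ab with A A; auto. apply (poly2_prod 1 0); auto using mo_one, mo_dxs. }
  assert (P3 : ab m3 h h k).
  { apply poly2_ab with A A; auto. apply (poly2_prod 2 0); auto using mo_one, mo_dxs. }
  transitivity (Cplus (Cplus (Cmult (Cmult (ci (- / 2)) (Cmult (Sg t k) (dis 3 k))) (Bil m1 h h k))
                             (Cmult (Cmult (ci (/ 2)) (dis 3 k)) (Bil m2 h h k)))
                      (Cmult (Copp (Cmult (RtoC t) (dis 2 k))) (Bil m3 h h k))).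
  - change (L2 t f k) with (Cminus (Cplus
      (Cmult (ci (- / 2)) (Cmult (Sg t k) (Cmult (dis 3 k) (fmul (Sgrp t (dx 1 h)) (Sgrp (- t) h) k))))
      (Cmult (ci (/ 2)) (Cmult (dis 3 k) (fmul (dx 1 h) h k))))
      (Cmult (RtoC t) (Cmult (dis 2 k) (fmul (dx 2 h) h k)))).
    replace (fmul (Sgrp t (dx 1 h)) (Sgrp (- t) h) k) with (Bil m1 h h k).
    2:{ apply CsumZ_ext. intros j. unfold m1, Sgrp, dx, Defs.mult, Sg, dxs. ring. }
    replace (fmul (dx 1 h) h k) with (Bil m2 h h k).
    2:{ apply CsumZ_ext. intros j. unfold m2, dx, Defs.mult, dxs. ring. }
    replace (fmul (dx 2 h) h k) with (Bil m3 h h k).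
    2:{ apply CsumZ_ext. intros j. unfold m3, dx, Defs.mult, dxs. ring. }
    ring.
  - rewrite <- Bil_lin3 by assumption. apply Bil_congr; auto. intros j l Hj Hl Hjl. subst k.
    unfold gL2. cbv zeta. rewrite guard_nz by assumption. unfold m1, m2, m3, ph, ci.
    rewrite !dis2, !dis3, !dxs2, !dxs1 by assumption.
    (* [(j + l)^2 + j^2 - l^2 = 2 (j + l) j]: the three propagators multiply to the phase inside
       [ph]. *)
    replace (cexpi (-2 * t * ((IZR j + IZR l) * IZR j))) with (Cmult (Sg t (j + l)) (Cmult (Sg t j) (Sg (- t) l))).
    2:{ unfold Sg. rewrite <- !cexpi_plus. f_equal. rewrite plus_IZR. ring. }
    set (E1 := Sg _ _). set (E2 := Sg _ _). set (E3 := Sg _ _).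
    symbols j l Hj Hl Hk. use_field.
Qed.

Lemma L3_Bil k : (k <> 0)%Z -> L3 t f k = Bil (gL3 t) h h k.
Proof.
  intros Hk. set (m1 := fun j l => Cmult (dxs 1 j) (dxs 1 l)).
  assert (P1 : ab m1 h h k).
  { apply poly2_ab with A A; auto. apply (poly2_prod 1 1); auto using mo_dxs. }
  transitivity (Cmult (Cmult (Cmult (ci (- (1))) (dis 4 k)) (Cminus (Sg (2 * t) k) (RtoC 1))) (Bil m1 h h k)).
  - change (L3 t f k) with (Cmult (ci (- (1))) (Cmult (dis 4 k)
      (Cminus (Cmult (Sg (2 * t) k) (fsq (dx 1 h) k)) (fsq (dx 1 h) k)))).
    replace (fsq (dx 1 h) k) with (Bil m1 h h k).
    2:{ apply CsumZ_ext. intros j. unfold m1, dx, Defs.mult, dxs. ring. }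
    unfold Sg. ring.
  - rewrite <- Bil_scal by assumption. apply Bil_congr; auto. intros j l Hj Hl Hjl. subst k.
    unfold gL3. cbv zeta. rewrite guard_nz by assumption. unfold m1, ph, ci.
    rewrite !dis4, !dxs1 by assumption.
    replace (cexpi (-2 * t * ((IZR j + IZR l) ^ 2))) with (Sg (2 * t) (j + l)).
    2:{ unfold Sg. f_equal. rewrite plus_IZR. ring. }
    set (E1 := Sg _ _).
    symbols j l Hj Hl Hk. use_field.
Qed.

Lemma L4_Bil k : (k <> 0)%Z -> L4 t f k = Bil (gL4 t) h h k.
Proof.
  intros Hk. set (m1 := fun j l => Cmult (Sg t j) (Sg t l)).
  set (m2 := fun j l : Z => Cmult (RtoC 1) (RtoC 1)).
  set (m3 := fun j l : Z => Cmult (dxs 1 j) (dxs 1 l)).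
  assert (P1 : ab m1 h h k).
  { apply poly2_ab with A A; auto. apply (poly2_prod 0 0); auto using mo_Sg0. }
  assert (P2 : ab m2 h h k).
  { apply poly2_ab with A A; auto. apply (poly2_prod 0 0 (fun _ => RtoC 1) (fun _ => RtoC 1)); auto using mo_one. }
  assert (P3 : ab m3 h h k).
  { apply poly2_ab with A A; auto. apply (poly2_prod 1 1); auto using mo_dxs. }
  transitivity (Cplus (Cplus (Cmult (Cmult (ci 1) (Cmult (dis 2 k) (Sg (- t) k))) (Bil m1 h h k))
                             (Cmult (Copp (Cmult (ci 1) (dis 2 k))) (Bil m2 h h k)))
                      (Cmult (Copp (Cmult (RtoC (2 * t)) (dis 2 k))) (Bil m3 h h k))).
  - change (L4 t f k) with (Cminus (Cminus
      (Cmult (ci 1) (Cmult (dis 2 k) (Cmult (Sg (- t) k) (fsq (Sgrp t h) k))))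
      (Cmult (ci 1) (Cmult (dis 2 k) (fsq h k))))
      (Cmult (RtoC (2 * t)) (Cmult (dis 2 k) (fsq (dx 1 h) k)))).
    replace (fsq (Sgrp t h) k) with (Bil m1 h h k).
    2:{ apply CsumZ_ext. intros j. unfold m1, Sgrp, Defs.mult, Sg. ring. }
    replace (fsq h k) with (Bil m2 h h k).
    2:{ apply CsumZ_ext. intros j. unfold m2. ring. }
    replace (fsq (dx 1 h) k) with (Bil m3 h h k).
    2:{ apply CsumZ_ext. intros j. unfold m3, dx, Defs.mult, dxs. ring. }
    ring.
  - rewrite <- Bil_lin3 by assumption. apply Bil_congr; auto. intros j l Hj Hl Hjl. subst k.
    unfold gL4. cbv zeta. rewrite guard_nz by assumption. unfold m1, m2, m3, ph, ci.
    rewrite !dis2, !dxs1 by assumption.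
    (* [j^2 + l^2 - (j + l)^2 = - 2 j l]. *)
    replace (cexpi (-2 * t * (- (IZR j * IZR l)))) with (Cmult (Sg (- t) (j + l)) (Cmult (Sg t j) (Sg t l))).
    2:{ unfold Sg. rewrite <- !cexpi_plus. f_equal. rewrite plus_IZR. ring. }
    set (E1 := Sg _ _). set (E2 := Sg _ _). set (E3 := Sg _ _).
    symbols j l Hj Hl Hk. use_field.
Qed.

Lemma I1_Bil k : (k <> 0)%Z -> I1 t f k = Bil (gI1 t) f f k.
Proof.
  intros Hk. set (m1 := fun j l => Cmult (dis 1 j) (dis 1 l)).
  set (m2 := fun j l : Z => Cmult (Cmult (Sg (- t) j) (dis 1 j)) (Cmult (Sg (- t) l) (dis 1 l))).
  assert (P1 : ab m1 f f k).
  { apply poly2_ab with A A; auto. apply (poly2_prod 0 0); auto using mo_dis. }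
  assert (P2 : ab m2 f f k).
  { apply poly2_ab with A A; auto. 
    apply (poly2_prod 0 0 (fun j => Cmult (Sg (- t) j) (dis 1 j)) (fun j => Cmult (Sg (- t) j) (dis 1 j)));
      auto using mo_Sg, mo_dis. }
  transitivity (Cplus (Cmult (ci (/ 2)) (Bil m1 f f k))
                      (Cmult (Copp (Cmult (ci (/ 2)) (Sg t k))) (Bil m2 f f k))).
  - change (I1 t f k) with (Cmult (ci (/ 2)) (Cminus (fsq (dxinv 1 f) k)
      (Cmult (Sg t k) (fsq (Sgrp (- t) (dxinv 1 f)) k)))).
    replace (fsq (dxinv 1 f) k) with (Bil m1 f f k).
    2:{ apply CsumZ_ext. intros j. unfold m1, dxinv, Defs.mult, dis. ring. }
    replace (fsq (Sgrp (- t) (dxinv 1 f)) k) with (Bil m2 f f k).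
    2:{ apply CsumZ_ext. intros j. unfold m2, Sgrp, dxinv, Defs.mult, Sg, dis. ring. }
    ring.
  - rewrite <- Bil_lin by assumption. apply Bil_congr; auto. intros j l Hj Hl Hjl. subst k.
    unfold gI1. rewrite guard_nz by assumption. unfold m1, m2, ph, ci.
    rewrite !dis1 by assumption.
    replace (cexpi (-2 * t * (IZR j * IZR l))) with (Cmult (Sg t (j + l)) (Cmult (Sg (- t) j) (Sg (- t) l))).
    2:{ unfold Sg. rewrite <- !cexpi_plus. f_equal. rewrite plus_IZR. ring. }
    set (E1 := Sg _ _). set (E2 := Sg _ _). set (E3 := Sg _ _).
    symbols j l Hj Hl Hk. use_field.
Qed.

Lemma I2_Bil k : (k <> 0)%Z -> I2 t f k = Bil (gI2 t) f h k.
Proof.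
  intros Hk. set (m1 := fun j l => Cmult (Sg (- t) j) (Cmult (Sg t l) (dis 1 l))).
  set (m2 := fun j l : Z => Cmult (RtoC 1) (dis 1 l)).
  assert (P1 : ab m1 f h k).
  { apply poly2_ab with A A; auto.
    apply (poly2_prod 0 0 (Sg (- t)) (fun l => Cmult (Sg t l) (dis 1 l))); auto using mo_Sg0, mo_Sg, mo_dis. }
  assert (P2 : ab m2 f h k).
  { apply poly2_ab with A A; auto. 
    apply (poly2_prod 0 0 (fun _ => RtoC 1) (dis 1)); auto using mo_one, mo_dis. }
  transitivity (Cplus (Cmult (Cmult (ci (- / 2)) (Cmult (Sg t k) (dis 1 k))) (Bil m1 f h k))
                      (Cmult (Cmult (ci (/ 2)) (dis 1 k)) (Bil m2 f h k))).
  - change (I2 t f k) with (Cplus (Cplus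
      (Cmult (ci (- / 2)) (Cmult (Sg t k) (Cmult (dis 1 k) (fmul (Sgrp (- t) f) (Sgrp t (dxinv 1 h)) k))))
      (Cmult (ci (/ 2)) (Cmult (dis 1 k) (fmul f (dxinv 1 h) k))))
      (fconst (RtoC (t * L2_norm f ^ 2)) k)).
    unfold fconst. destruct (Z.eq_dec k 0); [contradiction|].
    replace (fmul (Sgrp (- t) f) (Sgrp t (dxinv 1 h)) k) with (Bil m1 f h k).
    2:{ apply CsumZ_ext. intros j. unfold m1, Sgrp, dxinv, Defs.mult, Sg, dis. ring. }
    replace (fmul f (dxinv 1 h) k) with (Bil m2 f h k).
    2:{ apply CsumZ_ext. intros j. unfold m2, dxinv, Defs.mult, dis. ring. }
    ring.
  - rewrite <- Bil_lin by assumption. apply Bil_congr; auto. intros j l Hj Hl Hjl. subst k.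
    unfold gI2. rewrite guard_nz by assumption. unfold m1, m2, ph, ci.
    rewrite !dis1 by assumption.
    replace (cexpi (-2 * t * ((IZR j + IZR l) * IZR l))) with (Cmult (Sg t (j + l)) (Cmult (Sg (- t) j) (Sg t l))).
    2:{ unfold Sg. rewrite <- !cexpi_plus. f_equal. rewrite plus_IZR. ring. }
    set (E1 := Sg _ _). set (E2 := Sg _ _). set (E3 := Sg _ _).
    symbols j l Hj Hl Hk. use_field.
Qed.

End Brackets.

(** * Stability *)

Lemma kernel_scal c K1 K2 mu : 0 <= mu -> kernel c K1 K2 ->
  kernel (mu * c) (fun k j => mu * K1 k j) (fun k j => mu * K2 k j).
Proof.
  intros Hmu (Hc & P1 & P2 & H1 & H2).
  assert (Q : 0 <= mu ^ 2) by apply pow2_ge_0.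
  repeat split; intros; try (apply Rmult_le_pos; auto).
  - intros L HL. rewrite (lsum_ext _ (fun j => mu ^ 2 * K1 k j ^ 2)) by (intros; ring).
    rewrite lsum_scal, Rpow_mult_distr. apply Rmult_le_compat_l; auto. now apply H1.
  - intros L HL. rewrite (lsum_ext _ (fun j => mu ^ 2 * K2 (j + l)%Z j ^ 2)) by (intros; ring).
    rewrite lsum_scal, Rpow_mult_distr. apply Rmult_le_compat_l; auto. now apply H2.
Qed.

(** One constant serves all symbols dominated by a multiple of [D]; the multiple [mu] will carry the
    factor [tau]. The [+ 1] in the witness makes the constant positive. *)
Lemma Bil_bound_weight r s (D : Z -> Z -> R) :
  (exists c K1 K2, kernel c K1 K2 /\ forall j l, wt r (j + l) * D j l
     <= (K1 (j + l)%Z j + K2 (j + l)%Z j) * (wt s j * wt s l)) ->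
  exists Cb, 0 < Cb /\ forall m mu f g A B, 0 <= mu ->
    (forall j l, Cmod (m j l) <= mu * D j l) -> nb s f A -> nb s g B ->
    nb r (Bil m f g) (Cb * mu * A * B) /\ forall k, ab m f g k.
Proof.
  intros (c & K1 & K2 & HK & HD). exists (2 * c + 1).
  assert (Hc : 0 <= c) by apply HK. split; [lra|].
  intros m mu f g A B Hmu Hm Hf Hg.
  destruct (Bil_bound r s m (mu * c) _ _ f g A B (kernel_scal _ _ _ mu Hmu HK)) as [H1 H2]; auto.
  - intros j l. apply Rle_trans with (wt r (j + l) * (mu * D j l)).
    + apply Rmult_le_compat_l; [apply Rlt_le, wt_pos|apply Hm].
    + specialize (HD j l).
      replace (wt r (j + l) * (mu * D j l)) with (mu * (wt r (j + l) * D j l)) by ring.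
      replace ((mu * K1 (j + l)%Z j + mu * K2 (j + l)%Z j) * (wt s j * wt s l)) with
        (mu * ((K1 (j + l)%Z j + K2 (j + l)%Z j) * (wt s j * wt s l))) by ring.
      now apply Rmult_le_compat_l.
  - split; [|exact H2]. revert H1. apply nb_mono.
    assert (HA := nb_pos _ _ _ Hf). assert (HB := nb_pos _ _ _ Hg).
    assert (0 <= mu * A * B) by (repeat apply Rmult_le_pos; auto). nra.
Qed.

Definition stabD (j l : Z) : R := (jj j + jj l) / jj (j + l).

Definition stab_const (r Cb : R) : Prop :=
  0 < Cb /\ forall m mu f g A B, 0 <= mu ->
    (forall j l, Cmod (m j l) <= mu * stabD j l) -> nb r f A -> nb r g B ->
    nb r (Bil m f g) (Cb * mu * A * B) /\ forall k, ab m f g k.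

Lemma stab_bil r : 1 <= r -> exists Cb, stab_const r Cb.
Proof. intros Hr. apply Bil_bound_weight. now apply stab_kernel. Qed.

Lemma stabD_ge j l : 1 <= 2 * stabD j l.
Proof.
  unfold stabD. assert (H := jj_triang j l). assert (H1 := jj_ge1 (j + l)).
  assert (1 <= 2 * (jj j + jj l) / jj (j + l)) by (apply Rle_div_r; lra). lra.
Qed.

Lemma stabD_pos j l : 0 <= stabD j l.
Proof. assert (H := stabD_ge j l). lra. Qed.

(** The algebra property of [H^r]: the constant symbol 1 is dominated by [2 stabD]. *)
Lemma fmul_bound r Cb f g A B : stab_const r Cb -> nb r f A -> nb r g B ->
  nb r (fmul f g) (2 * Cb * A * B) /\ forall k, ab (fun _ _ => RtoC 1) f g k.
Proof.
  intros [_ HC] Hf Hg.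
  destruct (HC (fun _ _ => RtoC 1) 2 f g A B) as [H1 H2]; auto; [lra| |].
  - intros j l. rewrite Cmod_1. apply stabD_ge.
  - split; auto. apply nb_ext with (Bil (fun _ _ => RtoC 1) f g); [apply fmul_Bil|].
    revert H1. apply nb_mono. lra.
Qed.

Lemma fconj_sub f g k : fconj (fsub f g) k = fsub (fconj f) (fconj g) k.
Proof. unfold fconj, fsub, Cminus, Cplus, Copp, Cconj. simpl. f_equal. ring. Qed.

Lemma Bil_diff r Cb m mu f g f' g' A d : stab_const r Cb -> 0 <= mu ->
  (forall j l, Cmod (m j l) <= mu * stabD j l) ->
  nb r f' A -> nb r g A -> nb r g' A -> nb r f A -> nb r (fsub f f') d -> nb r (fsub g g') d ->
  nb r (fsub (Bil m f g) (Bil m f' g')) (2 * Cb * mu * A * d).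
Proof.
  intros [_ HC] Hmu Hm Hf' Hg Hg' Hf Hd1 Hd2.
  apply nb_ext with (fadd (Bil m (fsub f f') g) (Bil m f' (fsub g g'))).
  - intros k. unfold fadd, fsub at 1.
    rewrite Bil_minus_l, Bil_minus_r; [ring| | | |]; eapply HC; eauto.
  - destruct (HC m mu _ _ _ _ Hmu Hm Hd1 Hg) as [H1 _].
    destruct (HC m mu _ _ _ _ Hmu Hm Hf' Hd2) as [H2 _].
    assert (H := nb_plus _ _ _ _ _ H1 H2). revert H. apply nb_mono. apply Req_le. ring.
Qed.

(** [mV], [mM] and [mU] are the symbols of the [ubar^2], the mixed and the [u^2] interaction. *)
Definition quad (mV mM mU : Z -> Z -> C) (f : Fc) : Fc := fun k =>
  Cplus (Cplus (Bil mV (fconj f) (fconj f) k) (Bil mM f (fconj f) k)) (Bil mU f f k).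

Lemma quad_diff r Cb mV mM mU mu f f' A d : stab_const r Cb -> 0 <= mu ->
  (forall j l, Cmod (mV j l) <= mu * stabD j l) -> (forall j l, Cmod (mM j l) <= mu * stabD j l) ->
  (forall j l, Cmod (mU j l) <= mu * stabD j l) ->
  nb r f A -> nb r f' A -> nb r (fsub f f') d ->
  nb r (fsub (quad mV mM mU f) (quad mV mM mU f')) (6 * Cb * mu * A * d).
Proof.
  intros HC Hmu HV HM HU Hf Hf' Hd.
  assert (Hh := nb_conj _ _ _ Hf). assert (Hh' := nb_conj _ _ _ Hf').
  assert (Hd' : nb r (fsub (fconj f) (fconj f')) d).
  { apply nb_ext with (fconj (fsub f f')); [intros; symmetry; apply fconj_sub|now apply nb_conj]. }
  assert (H1 := Bil_diff r Cb mV mu _ _ _ _ A d HC Hmu HV Hh' Hh Hh' Hh Hd' Hd').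
  assert (H2 := Bil_diff r Cb mM mu _ _ _ _ A d HC Hmu HM Hf' Hh Hh' Hf Hd Hd').
  assert (H3 := Bil_diff r Cb mU mu _ _ _ _ A d HC Hmu HU Hf' Hf Hf' Hf Hd Hd).
  assert (H := nb_plus _ _ _ _ _ (nb_plus _ _ _ _ _ H1 H2) H3).
  replace (6 * Cb * mu * A * d) with
    (2 * Cb * mu * A * d + 2 * Cb * mu * A * d + 2 * Cb * mu * A * d) by ring.
  revert H. apply nb_ext. intros k. unfold fsub, fadd, quad. ring.
Qed.

(** * The scheme as a bilinear update *)

Definition mV (t : R) (j l : Z) : C := Cplus (Cplus (Cplus (Cmult (RtoC 2) (gL1 t j l))
  (Cmult (RtoC 2) (gL2 t j l))) (gL3 t j l)) (gL4 t j l).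
Definition mM (t : R) (j l : Z) : C := Cmult (RtoC 2) (gI2 t j l).
Definition mU (t : R) (j l : Z) : C := gI1 t j l.

(** A nonzero integer satisfies [1 + k^2 <= 2 k^2], so the division by [k^2] costs at most a factor
    2 against the weight with [jj k]. *)
Lemma Rdiv_sqr_stab x j l : (j + l <> 0)%Z -> 0 <= x <= IZR j ^ 2 + IZR l ^ 2 ->
  0 <= x / (IZR j + IZR l) ^ 2 <= 2 * stabD j l.
Proof.
  intros Hk Hx. unfold stabD.
  assert (P : 1 <= (IZR j + IZR l) ^ 2).
  { rewrite <- plus_IZR, <- pow2_abs. apply pow_R1_Rle. now apply Rabs_IZR_ge1. }
  set (K := (IZR j + IZR l) ^ 2) in *.
  assert (E : jj (j + l) = 1 + K) by (unfold jj, K; now rewrite plus_IZR).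
  rewrite E. split.
  - apply Rmult_le_pos; [lra|]. apply Rlt_le, Rinv_0_lt_compat; lra.
  - replace (2 * ((jj j + jj l) / (1 + K))) with ((2 * (jj j + jj l)) / (1 + K)) by (field; lra).
    apply Rle_div_l; [lra|]. unfold jj.
    replace (2 * (1 + IZR j ^ 2 + (1 + IZR l ^ 2)) / (1 + K) * K)
      with ((1 + IZR j ^ 2 + (1 + IZR l ^ 2)) * (2 * K / (1 + K))) by (field; lra).
    assert (1 <= 2 * K / (1 + K)) by (apply Rle_div_r; lra). nra.
Qed.

Lemma Rabs_prod_le j l : Rabs (2 * IZR j * IZR l) <= IZR j ^ 2 + IZR l ^ 2.
Proof.
  assert (H1 := pow2_ge_0 (IZR j - IZR l)). assert (H2 := pow2_ge_0 (IZR j + IZR l)).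
  apply Rabs_le. lra.
Qed.

Lemma Cmod_coef_le x j l c e : (j + l <> 0)%Z -> Rabs x <= IZR j ^ 2 + IZR l ^ 2 ->
  Cmod c <= e -> Cmod (Cmult (RtoC (x / (IZR j + IZR l) ^ 2)) c) <= 2 * e * stabD j l.
Proof.
  intros Hk Hx Hc. rewrite Cmod_mult, Cmod_R. unfold Rdiv.
  rewrite Rabs_mult, (Rabs_right (/ _)).
  - destruct (Rdiv_sqr_stab (Rabs x) j l Hk) as [H1 H2]; [split; auto using Rabs_pos|].
    unfold Rdiv in *. replace (2 * e * stabD j l) with ((2 * stabD j l) * e) by ring.
    apply Rmult_le_compat; auto using Cmod_ge_0.
  - apply Rle_ge, Rlt_le, Rinv_0_lt_compat. assert (H := IZR_sum_neq0 j l Hk).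
    assert (0 < (IZR j + IZR l) ^ 2) by (now apply pow2_gt_0). lra.
Qed.

Lemma guard_le j l c e : 0 <= e -> ((j <> 0)%Z -> (l <> 0)%Z -> (j + l <> 0)%Z -> Cmod c <= e) ->
  Cmod (guard j l c) <= e.
Proof. intros He H. apply guard_cases; auto. rewrite Cmod_0. lra. Qed.

Lemma Cmod_ph_minus t q : 0 <= t -> q <> 0 -> Cmod (Cminus (ph t q) (RtoC t)) <= 2 * t.
Proof.
  intros Ht Hq. unfold Cminus. eapply Rle_trans; [apply Cmod_triangle|].
  rewrite Cmod_opp, Cmod_R, Rabs_right by lra. assert (H := Cmod_ph t q Ht Hq). lra.
Qed.

Section SymbolBounds.

Variables (t : R) (j l : Z).
Hypothesis (Ht : 0 <= t).

Let Hpos e : 0 <= e -> 0 <= e * t * stabD j l.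
Proof. intros He. apply Rmult_le_pos; [now apply Rmult_le_pos|apply stabD_pos]. Qed.

Let abs_sqr x : Rabs (x ^ 2) = x ^ 2.
Proof. apply Rabs_right, Rle_ge, pow2_ge_0. Qed.

Lemma gL1_bound : Cmod (gL1 t j l) <= 2 * t * stabD j l.
Proof.
  apply guard_le; [apply Hpos; lra|]. intros Hj Hl Hk. apply Cmod_coef_le; auto.
  - rewrite abs_sqr. assert (H := pow2_ge_0 (IZR j)). lra.
  - apply Cmod_ph; auto. now apply pow_nonzero, not_0_IZR.
Qed.

Lemma gL2_bound : Cmod (gL2 t j l) <= 4 * t * stabD j l.
Proof.
  apply guard_le; [apply Hpos; lra|]. intros Hj Hl Hk.
  replace (4 * t) with (2 * (2 * t)) by ring. apply Cmod_coef_le; auto.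
  - rewrite abs_sqr. assert (H := pow2_ge_0 (IZR l)). lra.
  - apply Cmod_ph_minus; auto.
    apply Rmult_integral_contrapositive_currified; [now apply IZR_sum_neq0|now apply not_0_IZR].
Qed.

Lemma gL3_bound : Cmod (gL3 t j l) <= 2 * t * stabD j l.
Proof.
  apply guard_le; [apply Hpos; lra|]. intros Hj Hl Hk. apply Cmod_coef_le; auto using Rabs_prod_le.
  apply Cmod_ph; auto. now apply pow_nonzero, IZR_sum_neq0.
Qed.

Lemma gL4_bound : Cmod (gL4 t j l) <= 4 * t * stabD j l.
Proof.
  apply guard_le; [apply Hpos; lra|]. intros Hj Hl Hk.
  replace (4 * t) with (2 * (2 * t)) by ring. apply Cmod_coef_le; auto using Rabs_prod_le.
  apply Cmod_ph_minus; auto. apply Ropp_neq_0_compat.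
  apply Rmult_integral_contrapositive_currified; now apply not_0_IZR.
Qed.

Lemma gI1_bound : Cmod (gI1 t j l) <= 2 * t * stabD j l.
Proof.
  apply guard_le; [apply Hpos; lra|]. intros Hj Hl Hk. apply Rle_trans with t.
  - apply Cmod_ph; auto. apply Rmult_integral_contrapositive_currified; now apply not_0_IZR.
  - assert (H := stabD_ge j l). nra.
Qed.

Lemma gI2_bound : Cmod (gI2 t j l) <= 2 * t * stabD j l.
Proof.
  apply guard_le; [apply Hpos; lra|]. intros Hj Hl Hk. apply Rle_trans with t.
  - apply Cmod_ph; auto.
    apply Rmult_integral_contrapositive_currified; [now apply IZR_sum_neq0|now apply not_0_IZR].
  - assert (H := stabD_ge j l). nra.
Qed.

(** [18 = 2 * 2 + 2 * 4 + 2 + 4], the bounds of the four brackets with their multiplicities in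
    [Psi1]. The other two symbols have smaller bounds and share the constant. *)
Lemma mV_bound : Cmod (mV t j l) <= (18 * t) * stabD j l.
Proof.
  unfold mV. assert (H1 := gL1_bound). assert (H2 := gL2_bound). assert (H3 := gL3_bound).
  assert (H4 := gL4_bound).
  eapply Rle_trans; [apply Cmod_triangle|].
  eapply Rle_trans; [apply Rplus_le_compat_r, Cmod_triangle|].
  eapply Rle_trans; [apply Rplus_le_compat_r, Rplus_le_compat_r, Cmod_triangle|].
  rewrite !Cmod_mult, Cmod_R, Rabs_right by lra. lra.
Qed.

Lemma mM_bound : Cmod (mM t j l) <= (18 * t) * stabD j l.
Proof.
  unfold mM. assert (H1 := gI2_bound). rewrite Cmod_mult, Cmod_R, Rabs_right by lra.
  assert (H := Hpos 1). lra.
Qed.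

Lemma mU_bound : Cmod (mU t j l) <= (18 * t) * stabD j l.
Proof. unfold mU. assert (H1 := gI1_bound). assert (H := Hpos 1). lra. Qed.

End SymbolBounds.

(** The symbol of [Bop], which is real. *)
Definition Bs (k : Z) : R := if Z.eq_dec k 0 then 0 else - (IZR k ^ 2 / bsym k).

Lemma bsym_bounds k : IZR k ^ 2 <= bsym k <= IZR k ^ 2 + 1.
Proof.
  unfold bsym. assert (H := pow2_ge_0 (IZR k)). replace (IZR k ^ 4) with ((IZR k ^ 2) ^ 2) by ring.
  set (x := IZR k ^ 2) in *. split.
  - rewrite <- (sqrt_pow2 x) at 1 by assumption. apply sqrt_le_1_alt. lra.
  - rewrite <- (sqrt_pow2 (x + 1)) by lra. apply sqrt_le_1_alt. nra.
Qed.

Lemma bsym_ge1 k : (k <> 0)%Z -> 1 <= bsym k.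
Proof.
  intros Hk. assert (H := bsym_bounds k). assert (1 <= IZR k ^ 2); [|lra].
  rewrite <- pow2_abs. apply pow_R1_Rle. now apply Rabs_IZR_ge1.
Qed.

Lemma Rabs_Bs k : Rabs (Bs k) <= 1.
Proof.
  unfold Bs. destruct (Z.eq_dec k 0) as [_|Hk]; [rewrite Rabs_R0; lra|].
  assert (H := bsym_bounds k). assert (H1 := bsym_ge1 k Hk). assert (H2 := pow2_ge_0 (IZR k)).
  rewrite Rabs_Ropp, Rabs_right.
  - apply Rle_div_l; lra.
  - apply Rle_ge, Rmult_le_pos; auto. apply Rlt_le, Rinv_0_lt_compat. lra.
Qed.

Lemma Btau_at tau g k : Btau tau g k = Cmult (RtoC (Bs k)) (Cmult (cexpi (tau * bsym k)) (g k)).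
Proof.
  unfold Btau, Bop, bracket_inv, dx, Egrp, Defs.mult, Bs. fold (dxs 2 k). rewrite dxs2.
  destruct (Z.eq_dec k 0) as [_|Hk]; [ring|]. unfold Rdiv.
  rewrite RtoC_opp, RtoC_mult, RtoC_pow. ring.
Qed.

(** The increment of one step seen after undoing the propagator. The step length [t] is a variable
    here, to be differentiated later, while [c] is the mean [a t_n + b] frozen at the start of the
    step. *)
Definition Inc (t c : R) (f : Fc) : Fc := fun k => Cmult (RtoC (Bs k))
  (Cplus (Cmult (RtoC (/ 4)) (quad (mV t) (mM t) (mU t) f k))
         (Cmult (RtoC c) (Cplus (Cmult (RtoC t) (f k)) (Cmult (ph t (IZR k ^ 2)) (fconj f k))))).

Lemma RInt_cos_lin c : c <> 0 -> RInt (fun s => cos (c * s)) 0 1 = sin c / c.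
Proof.
  intros Hc. apply is_RInt_unique.
  replace (sin c / c) with (sin (c * 1) / c - sin (c * 0) / c)
    by (rewrite Rmult_0_r, sin_0, Rmult_1_r; field; auto).
  apply (is_RInt_derive (fun s => sin (c * s) / c) (fun s => cos (c * s))).
  - intros x _. auto_derive; auto. field. auto.
  - intros x _. apply continuity_pt_filterlim. apply derivable_continuous_pt.
    exists (- sin (c * x) * c). apply is_derive_Reals. auto_derive; auto. ring.
Qed.

Lemma RInt_sin_lin c : c <> 0 -> RInt (fun s => sin (c * s)) 0 1 = (1 - cos c) / c.
Proof.
  intros Hc. apply is_RInt_unique.
  replace ((1 - cos c) / c) with (- cos (c * 1) / c - - cos (c * 0) / c)
    by (rewrite Rmult_0_r, cos_0, Rmult_1_r; field; auto).
  apply (is_RInt_derive (fun s => - cos (c * s) / c) (fun s => sin (c * s))).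
  - intros x _. auto_derive; auto. field. auto.
  - intros x _. apply continuity_pt_filterlim. apply derivable_continuous_pt.
    exists (cos (c * x) * c). apply is_derive_Reals. auto_derive; auto. ring.
Qed.

(** Rescaling the integration variable by [t] turns [t psi_1] into the phase integral [ph]; the
    proof evaluates both explicitly instead. *)
Lemma psi1_ph t k : (k <> 0)%Z ->
  Cmult (RtoC t) (psi1 (Cmult (RtoC (- 2 * t * IZR k ^ 2)) Ci)) = ph t (IZR k ^ 2).
Proof.
  intros Hk. destruct (Req_dec t 0) as [->|Ht].
  { rewrite ph_0. ring. }
  assert (Hq : IZR k ^ 2 <> 0) by now apply pow_nonzero, not_0_IZR.
  set (q := IZR k ^ 2) in *. set (c := - 2 * t * q).
  assert (Hc : c <> 0).
  { unfold c. apply Rmult_integral_contrapositive_currified; auto.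
    apply Rmult_integral_contrapositive_currified; lra. }
  assert (E : psi1 (Cmult (RtoC c) Ci) = (sin c / c, (1 - cos c) / c)).
  { unfold psi1. f_equal.
    - rewrite <- RInt_cos_lin by auto. apply RInt_ext. intros s _.
      unfold cexp, Cmult, Ci, RtoC, Re, Im; simpl.
      replace ((c * 0 - 0 * 1) * s - (c * 1 + 0 * 0) * 0) with 0 by ring. rewrite exp_0, Rmult_1_l.
      f_equal. ring.
    - rewrite <- RInt_sin_lin by auto. apply RInt_ext. intros s _.
      unfold cexp, Cmult, Ci, RtoC, Re, Im; simpl.
      replace ((c * 0 - 0 * 1) * s - (c * 1 + 0 * 0) * 0) with 0 by ring. rewrite exp_0, Rmult_1_l.
      f_equal. ring. }
  rewrite E. unfold ph. fold c.
  replace (Cdiv Ci (RtoC (2 * q))) with (Cmult Ci (RtoC (/ (2 * q)))).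
  2:{ unfold Cdiv. f_equal. apply RtoC_inv. lra. }
  unfold cexpi, Cmult, Ci, Cminus, Cplus, Copp, RtoC; simpl. unfold c. f_equal; field; auto.
Qed.

(** With the propagator factored out, a step of the scheme can be compared with the exact solution
    in the rotating frame of [hw]. *)
Lemma Psi1_Inc r Cb t tn a b f A k : 1 <= r -> stab_const r Cb -> 0 <= t -> nb r f A ->
  f 0%Z = RtoC 0 ->
  Psi1 t tn a b f k = Cmult (cexpi (t * bsym k)) (Cminus (f k) (Cmult Ci (Inc t (a * tn + b) f k))).
Proof.
  intros Hr [_ HC] Ht Hrf f0. assert (Hf : nb 1 f A) by (apply nb_index with r; auto).
  assert (Hh := nb_conj _ _ _ Hrf).
  unfold Psi1, fsub, fscal. cbv zeta. rewrite !Btau_at. unfold Egrp, Defs.mult at 1.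
  unfold Inc. destruct (Z.eq_dec k 0) as [->|Hk].
  { unfold Bs. simpl. ring. }
  unfold fadd, fscal.
  rewrite (L1_Bil f A), (L2_Bil f A), (L3_Bil f A), (L4_Bil f A), (I1_Bil f A), (I2_Bil f A) by auto.
  assert (HB : forall m mu f g, 0 <= mu -> (forall j l, Cmod (m j l) <= (mu * t) * stabD j l) ->
     nb r f A -> nb r g A -> ab m f g k).
  { intros m mu f1 g1 H0 H1 H2 H3. apply (HC m (mu * t) f1 g1 A A); auto. now apply Rmult_le_pos. }
  set (h := fconj f) in *.
  assert (E1 : Bil (mV t) h h k = Cplus (Cplus (Cplus (Cmult (RtoC 2) (Bil (gL1 t) h h k))
     (Cmult (RtoC 2) (Bil (gL2 t) h h k))) (Bil (gL3 t) h h k)) (Bil (gL4 t) h h k)).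
  { assert (A1 : ab (gL1 t) h h k) by (apply HB with 2; auto using gL1_bound; lra).
    assert (A2 : ab (gL2 t) h h k) by (apply HB with 4; auto using gL2_bound; lra).
    assert (A3 : ab (gL3 t) h h k) by (apply HB with 2; auto using gL3_bound; lra).
    assert (A4 : ab (gL4 t) h h k) by (apply HB with 4; auto using gL4_bound; lra).
    unfold Bil. rewrite <- !CsumZ_scal by assumption.
    rewrite <- CsumZ_plus by (apply absc_scal; assumption).
    rewrite <- CsumZ_plus by (try (apply absc_plus; apply absc_scal); assumption).
    rewrite <- CsumZ_plus by (try (apply absc_plus; [apply absc_plus; apply absc_scal|]); assumption).
    apply CsumZ_ext. intros j. unfold mV. ring. }
  assert (E2 : Bil (mM t) f h k = Cmult (RtoC 2) (Bil (gI2 t) f h k)).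
  { apply Bil_scal. apply HB with 2; auto using gI2_bound; lra. }
  unfold quad. fold h. rewrite E1, E2. change (Bil (mU t) f f k) with (Bil (gI1 t) f f k).
  rewrite <- psi1_ph by assumption. unfold psi1op, Defs.mult, ci.
  rewrite (RtoC_mult t). ring.
Qed.

Lemma nb_Bs s f A : nb s f A -> nb s (fun k => Cmult (RtoC (Bs k)) (f k)) A.
Proof.
  apply nb_le. intros k. rewrite Cmod_mult, Cmod_R.
  assert (H := Rabs_Bs k). assert (H1 := Cmod_ge_0 (f k)). nra.
Qed.

Lemma nb_unimod s f A (th : Z -> R) : nb s f A -> nb s (fun k => Cmult (cexpi (th k)) (f k)) A.
Proof. apply nb_le. intros k. rewrite Cmod_mult, Cmod_cexpi. lra. Qed.

(** [27 = 6 * 18 / 4] from [quad_diff] and the symbol bounds; [2 D] comes from the two linear terms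
    in [f] and its conjugate. *)
Lemma Inc_diff r Cb t c f f' A D d : stab_const r Cb -> 0 <= t -> Rabs c <= D ->
  nb r f A -> nb r f' A -> nb r (fsub f f') d ->
  nb r (fsub (Inc t c f) (Inc t c f')) (t * ((27 * Cb * A + 2 * D) * d)).
Proof.
  intros HC Ht Hc Hf Hf' Hd.
  assert (Hq := quad_diff r Cb (mV t) (mM t) (mU t) (18 * t) f f' A d HC ltac:(lra)
    (fun j l => mV_bound t j l Ht) (fun j l => mM_bound t j l Ht) (fun j l => mU_bound t j l Ht) Hf Hf' Hd).
  (* [Cmod_ph] asks for a nonzero argument, so the zero mode is cut out; [Bs 0 = 0] makes the change
     invisible at the end. *)
  assert (Hd' : nb r (fun k => if Z.eq_dec k 0 then RtoC 0 else Cmult (ph t (IZR k ^ 2)) (fconj (fsub f f') k)) (t * d)).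
  { apply (nb_dom r r _ (fconj (fsub f f'))); auto; [|now apply nb_conj].
    intros k. assert (W := wt_pos r k). assert (P := Cmod_ge_0 (fconj (fsub f f') k)).
    destruct (Z.eq_dec k 0) as [_|Hk].
    - rewrite Cmod_0, Rmult_0_r. apply Rmult_le_pos; auto. apply Rmult_le_pos; lra.
    - rewrite Cmod_mult.
      assert (H : Cmod (ph t (IZR k ^ 2)) <= t) by (apply Cmod_ph; auto; now apply pow_nonzero, not_0_IZR).
      replace (t * (wt r k * Cmod (fconj (fsub f f') k))) with (wt r k * (t * Cmod (fconj (fsub f f') k))) by ring.
      apply Rmult_le_compat_l; [lra|]. now apply Rmult_le_compat_r. }
  assert (H1 := nb_scal _ _ (RtoC (/ 4)) _ Hq). assert (H2 := nb_scal _ _ (RtoC t) _ Hd).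
  assert (H3 := nb_scal _ _ (RtoC c) _ (nb_plus _ _ _ _ _ H2 Hd')).
  assert (H := nb_Bs _ _ _ (nb_plus _ _ _ _ _ H1 H3)). rewrite !Cmod_R in H.
  apply nb_mono with (Rabs (/ 4) * (6 * Cb * (18 * t) * A * d) + Rabs c * (Rabs t * d + t * d)).
  - rewrite !Rabs_right with (r := / 4), Rabs_right with (r := t) by lra.
    assert (0 <= t * d) by (apply Rmult_le_pos; auto; eapply nb_pos; eauto).
    assert (Rabs c * (t * d) <= D * (t * d)) by now apply Rmult_le_compat_r. lra.
  - revert H. apply nb_ext. intros k. unfold fsub at 1, Inc.
    destruct (Z.eq_dec k 0) as [->|Hk].
    + unfold Bs. simpl. ring.
    + unfold fadd, fscal. rewrite fconj_sub. unfold fsub, Bs.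
      destruct (Z.eq_dec k 0); [contradiction|]. ring.
Qed.

(** The propagator is unimodular in each mode, so only the increments add to [d], and the Lipschitz
    constant is [1 + O(t)]. *)
Lemma Psi1_stable r Cb t tn a b f f' A D d : 1 <= r -> stab_const r Cb -> 0 <= t ->
  Rabs (a * tn + b) <= D -> nb r f A -> nb r f' A -> f 0%Z = RtoC 0 -> f' 0%Z = RtoC 0 ->
  nb r (fsub f f') d ->
  nb r (fsub (Psi1 t tn a b f) (Psi1 t tn a b f')) (d + t * ((27 * Cb * A + 2 * D) * d)).
Proof.
  intros Hr HC Ht Hc Hf Hf' f0 f0' Hd.
  assert (H1 := nb_scal _ _ Ci _ (Inc_diff r Cb t _ f f' A D d HC Ht Hc Hf Hf' Hd)).
  rewrite Cmod_Ci, Rmult_1_l in H1.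
  assert (H := nb_unimod r _ _ (fun k => t * bsym k) (nb_minus _ _ _ _ _ Hd H1)).
  revert H. apply nb_ext. intros k. unfold fsub at 1.
  rewrite !(Psi1_Inc r Cb _ _ _ _ _ A) by auto. unfold fsub, fscal. ring.
Qed.

Lemma Psi1_0 t tn a b f : f 0%Z = RtoC 0 -> Psi1 t tn a b f 0%Z = RtoC 0.
Proof.
  intros H. unfold Psi1, fsub, fscal. cbv zeta. rewrite !Btau_at. unfold Egrp, Defs.mult, Bs.
  rewrite H. simpl. ring.
Qed.

(** * Differentiation of modes and the mean value inequality in [H^r] *)

(** Componentwise, in the form in which [boussinesq_sol] supplies its derivatives. *)
Definition cder (F : R -> C) (x : R) (l : C) : Prop :=
  is_derive (fun s => Re (F s)) x (Re l) /\ is_derive (fun s => Im (F s)) x (Im l).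

Lemma cder_eq F x l l' : cder F x l -> l = l' -> cder F x l'.
Proof. now intros H <-. Qed.

Lemma cder_ext F G x l : (forall s, F s = G s) -> cder F x l -> cder G x l.
Proof.
  intros H [H1 H2]. split; (eapply is_derive_ext; [|eassumption]); intros s; simpl; now rewrite H.
Qed.

Lemma cder_const c x : cder (fun _ => c) x (RtoC 0).
Proof. split; apply (is_derive_const (K := R_AbsRing) (V := R_NormedModule)). Qed.

Lemma cder_plus F G x l m : cder F x l -> cder G x m ->
  cder (fun s => Cplus (F s) (G s)) x (Cplus l m).
Proof.
  intros [H1 H2] [H3 H4]. split.
  - apply (is_derive_plus (fun s => Re (F s)) (fun s => Re (G s)) x _ _ H1 H3).
  - apply (is_derive_plus (fun s => Im (F s)) (fun s => Im (G s)) x _ _ H2 H4).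
Qed.

Lemma cder_opp F x l : cder F x l -> cder (fun s => Copp (F s)) x (Copp l).
Proof.
  intros [H1 H2]. split.
  - apply (is_derive_opp (fun s => Re (F s)) x _ H1).
  - apply (is_derive_opp (fun s => Im (F s)) x _ H2).
Qed.

Lemma cder_minus F G x l m : cder F x l -> cder G x m ->
  cder (fun s => Cminus (F s) (G s)) x (Cminus l m).
Proof. intros H1 H2. apply cder_plus; auto. now apply cder_opp. Qed.

Lemma is_derive_mult_R (f g : R -> R) x l m : is_derive f x l -> is_derive g x m ->
  is_derive (fun s => f s * g s) x (l * g x + f x * m).
Proof.
  intros H1 H2. apply (is_derive_mult f g x l m H1 H2). intros; apply Rmult_comm.
Qed.

Lemma cder_mult F G x l m : cder F x l -> cder G x m ->
  cder (fun s => Cmult (F s) (G s)) x (Cplus (Cmult l (G x)) (Cmult (F x) m)).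
Proof.
  intros [H1 H2] [H3 H4]. split.
  - assert (H := is_derive_minus _ _ x _ _ (is_derive_mult_R _ _ x _ _ H1 H3) (is_derive_mult_R _ _ x _ _ H2 H4)).
    eapply is_derive_ext; [|evar_last; [exact H|]]; [intros; reflexivity|].
    unfold minus, plus, opp, Re, Im; simpl. ring.
  - assert (H := is_derive_plus _ _ x _ _ (is_derive_mult_R _ _ x _ _ H1 H4) (is_derive_mult_R _ _ x _ _ H2 H3)).
    eapply is_derive_ext; [|evar_last; [exact H|]]; [intros; reflexivity|].
    unfold plus, Re, Im; simpl. ring.
Qed.

Lemma cder_scal c F x l : cder F x l -> cder (fun s => Cmult c (F s)) x (Cmult c l).
Proof.
  intros H. eapply cder_eq; [exact (cder_mult (fun _ => c) F x _ _ (cder_const c x) H)|]. cbv beta. ring.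
Qed.

Lemma cder_cexpi a b x : cder (fun s => cexpi (a * s + b)) x (Cmult (Cmult Ci (RtoC a)) (cexpi (a * x + b))).
Proof.
  split; unfold cexpi, Cmult, Ci, RtoC, Re, Im; simpl; auto_derive; auto; ring.
Qed.

Lemma cder_RtoC a b x : cder (fun s => RtoC (a * s + b)) x (RtoC a).
Proof.
  split; unfold RtoC, Re, Im; simpl; auto_derive; auto; ring.
Qed.

Lemma cder_shift F t0 x l : cder F (x - t0) l -> cder (fun s => F (s - t0)) x l.
Proof.
  intros [H1 H2].
  assert (H : is_derive (fun s => s - t0) x 1) by (auto_derive; auto; ring).
  split.
  - evar_last; [apply (is_derive_comp (fun s => Re (F s)) (fun s => s - t0) x _ _ H1 H)|].
    apply Rmult_1_l.
  - evar_last; [apply (is_derive_comp (fun s => Im (F s)) (fun s => s - t0) x _ _ H2 H)|].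
    apply Rmult_1_l.
Qed.

Lemma is_derive_lsum (a : R -> Z -> R) (b : Z -> R) x L :
  (forall k, In k L -> is_derive (fun s => a s k) x (b k)) ->
  is_derive (fun s => lsum (a s) L) x (lsum b L).
Proof.
  induction L as [|y L IH]; intros H; simpl.
  - apply (is_derive_const (K := R_AbsRing) (V := R_NormedModule)).
  - apply (is_derive_plus (fun s => a s y) (fun s => lsum (a s) L)); [apply H; now left|].
    apply IH. intros; apply H; now right.
Qed.

Lemma cder_clsum (a : R -> Z -> C) (b : Z -> C) x L :
  (forall k, cder (fun s => a s k) x (b k)) -> cder (fun s => clsum (a s) L) x (clsum b L).
Proof.
  intros H. split; unfold clsum; simpl.
  - apply (is_derive_lsum (fun s k => Re (a s k))). intros k _. apply H.
  - apply (is_derive_lsum (fun s k => Im (a s k))). intros k _. apply H.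
Qed.

Lemma cder_ph q x : q <> 0 -> cder (fun t => ph t q) x (cexpi (- 2 * x * q)).
Proof.
  intros Hq. unfold ph.
  apply cder_ext with (fun s => Cmult (Cdiv Ci (RtoC (2 * q))) (Cminus (cexpi ((- 2 * q) * s + 0)) (RtoC 1))).
  { intros s. do 3 f_equal. ring. }
  eapply cder_eq; [apply cder_scal, cder_minus; [apply cder_cexpi|apply cder_const]|].
  replace (-2 * q * x + 0) with (-2 * x * q) by ring.
  set (e := cexpi _). replace (-2 * q) with (- (2 * q)) by ring. rewrite RtoC_opp.
  assert (H : RtoC (2 * q) <> RtoC 0) by (apply RtoC_neq0; lra).
  generalize Ci2. intros HC. field [HC]. auto.
Qed.

(** * Continuity on closed intervals and mean value inequalities *)

Definition clamp (t0 t1 s : R) : R := Rmax t0 (Rmin s t1).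

Lemma clamp_in t0 t1 s : t0 <= t1 -> t0 <= clamp t0 t1 s <= t1.
Proof. intros H. unfold clamp, Rmax, Rmin. destruct (Rle_dec s t1), (Rle_dec t0 _); lra. Qed.

Lemma clamp_id t0 t1 s : t0 <= s <= t1 -> clamp t0 t1 s = s.
Proof. intros H. unfold clamp, Rmax, Rmin. destruct (Rle_dec s t1), (Rle_dec t0 _); lra. Qed.

Lemma clamp_lip t0 t1 x y : Rabs (clamp t0 t1 x - clamp t0 t1 y) <= Rabs (x - y).
Proof.
  unfold clamp, Rmax, Rmin.
  destruct (Rle_dec x t1), (Rle_dec y t1); repeat (destruct (Rle_dec t0 _));
    unfold Rabs; repeat destruct (Rcase_abs _); lra.
Qed.

Lemma continuous_clamp t0 t1 x : continuous (clamp t0 t1) x.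
Proof.
  apply continuity_pt_filterlim. intros eps He. exists eps. split; auto.
  intros y [_ Hy]. unfold dist in *; simpl in *. unfold R_dist in *.
  eapply Rle_lt_trans; [apply clamp_lip|exact Hy].
Qed.

(* Continuity on the closed interval, one-sided at the end points. *)
Definition rcont (t0 t1 : R) (F : R -> R) : Prop := forall x, continuous (fun s => F (clamp t0 t1 s)) x.
Definition ccont (t0 t1 : R) (F : R -> C) : Prop :=
  rcont t0 t1 (fun s => Re (F s)) /\ rcont t0 t1 (fun s => Im (F s)).

Lemma rcont_plus t0 t1 F G : rcont t0 t1 F -> rcont t0 t1 G -> rcont t0 t1 (fun s => F s + G s).
Proof.
  intros H1 H2 x.
  apply (continuous_plus (fun s => F (clamp t0 t1 s)) (fun s => G (clamp t0 t1 s))); auto.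
Qed.

Lemma rcont_opp t0 t1 F : rcont t0 t1 F -> rcont t0 t1 (fun s => - F s).
Proof. intros H1 x. apply (continuous_opp (fun s => F (clamp t0 t1 s))); auto. Qed.

Lemma rcont_mult t0 t1 F G : rcont t0 t1 F -> rcont t0 t1 G -> rcont t0 t1 (fun s => F s * G s).
Proof.
  intros H1 H2 x.
  apply (continuous_mult (fun s => F (clamp t0 t1 s)) (fun s => G (clamp t0 t1 s))); auto.
Qed.

Lemma rcont_const t0 t1 c : rcont t0 t1 (fun _ => c).
Proof. intros x. apply continuous_const. Qed.

Lemma rcont_derive t0 t1 F : (forall x, exists l, is_derive F x l) -> rcont t0 t1 F.
Proof.
  intros H x. apply (continuous_comp (clamp t0 t1) F); [apply continuous_clamp|].
  destruct (H (clamp t0 t1 x)) as [l Hl]. apply ex_derive_continuous. now exists l.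
Qed.

Lemma rcont_lsum t0 t1 (a : R -> Z -> R) L : (forall k, rcont t0 t1 (fun s => a s k)) ->
  rcont t0 t1 (fun s => lsum (a s) L).
Proof.
  intros H. induction L as [|y L IH]; simpl; [apply rcont_const|].
  apply (rcont_plus t0 t1 (fun s => a s y) (fun s => lsum (a s) L)); auto.
Qed.

Lemma ccont_plus t0 t1 F G : ccont t0 t1 F -> ccont t0 t1 G -> ccont t0 t1 (fun s => Cplus (F s) (G s)).
Proof.
  intros [H1 H2] [H3 H4]. split.
  - apply (rcont_plus t0 t1 (fun s => Re (F s)) (fun s => Re (G s))); auto.
  - apply (rcont_plus t0 t1 (fun s => Im (F s)) (fun s => Im (G s))); auto.
Qed.

Lemma ccont_opp t0 t1 F : ccont t0 t1 F -> ccont t0 t1 (fun s => Copp (F s)).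
Proof.
  intros [H1 H2]. split.
  - apply (rcont_opp t0 t1 (fun s => Re (F s))); auto.
  - apply (rcont_opp t0 t1 (fun s => Im (F s))); auto.
Qed.

Lemma ccont_minus t0 t1 F G : ccont t0 t1 F -> ccont t0 t1 G -> ccont t0 t1 (fun s => Cminus (F s) (G s)).
Proof. intros H1 H2. apply ccont_plus; auto. now apply ccont_opp. Qed.

Lemma ccont_mult t0 t1 F G : ccont t0 t1 F -> ccont t0 t1 G -> ccont t0 t1 (fun s => Cmult (F s) (G s)).
Proof.
  intros [H1 H2] [H3 H4]. split.
  - apply (rcont_plus t0 t1 (fun s => Re (F s) * Re (G s)) (fun s => - (Im (F s) * Im (G s)))).
    + now apply rcont_mult.
    + now apply rcont_opp, rcont_mult.
  - apply (rcont_plus t0 t1 (fun s => Re (F s) * Im (G s)) (fun s => Im (F s) * Re (G s))); now apply rcont_mult.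
Qed.

Lemma ccont_const t0 t1 c : ccont t0 t1 (fun _ => c).
Proof. split; apply rcont_const. Qed.

Lemma ccont_cder t0 t1 F : (forall x, exists l, cder F x l) -> ccont t0 t1 F.
Proof.
  intros H. split; apply rcont_derive; intros x; destruct (H x) as [l [H1 H2]]; eauto.
Qed.

Lemma ccont_conj t0 t1 F : ccont t0 t1 F -> ccont t0 t1 (fun s => Cconj (F s)).
Proof. intros [H1 H2]. split; auto. now apply (rcont_opp t0 t1 (fun s => Im (F s))). Qed.

Lemma cder_conj F x l : cder F x l -> cder (fun s => Cconj (F s)) x (Cconj l).
Proof. intros [H1 H2]. split; auto. apply (is_derive_opp (fun s => Im (F s)) x _ H2). Qed.

Lemma rcont_restrict t0 t1 u0 u1 F : t0 <= u0 -> u0 <= u1 -> u1 <= t1 -> rcont t0 t1 F -> rcont u0 u1 F.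
Proof.
  intros H0 H1 H2 H x.
  apply (continuous_ext (fun s => F (clamp t0 t1 (clamp u0 u1 s)))).
  - intros s. f_equal. apply clamp_id. assert (Hc := clamp_in u0 u1 s H1). lra.
  - apply (continuous_comp (clamp u0 u1) (fun s => F (clamp t0 t1 s))); [apply continuous_clamp|apply H].
Qed.

Lemma ccont_restrict t0 t1 u0 u1 F : t0 <= u0 -> u0 <= u1 -> u1 <= t1 -> ccont t0 t1 F -> ccont u0 u1 F.
Proof. intros H0 H1 H2 [H3 H4]. split; eapply rcont_restrict; eauto. Qed.

(** [F] is differentiable only in the open interval. Its extension by clamping is continuous
    everywhere and agrees with [F] inside, so the classical mean value theorem applies to the
    extension. *)
Lemma mvt_le F dF t0 t1 B : t0 < t1 -> (forall t, t0 < t < t1 -> is_derive F t (dF t)) ->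
  rcont t0 t1 F -> (forall t, t0 < t < t1 -> dF t <= B) -> F t1 - F t0 <= B * (t1 - t0).
Proof.
  intros Ht HD HC HB. set (G := fun s => F (clamp t0 t1 s)).
  assert (HG : forall t, t0 < t < t1 -> derivable_pt_lim G t (dF t)).
  { intros t Htt. apply is_derive_Reals. apply is_derive_ext_loc with F; [|now apply HD].
    assert (He : 0 < Rmin (t - t0) (t1 - t)) by (apply Rmin_glb_lt; lra).
    exists (mkposreal _ He). intros y Hy. unfold ball in Hy; simpl in Hy. unfold AbsRing_ball in Hy.
    unfold abs, minus, plus, opp in Hy; simpl in Hy.
    unfold G. rewrite clamp_id; auto. assert (H1 := Rmin_l (t - t0) (t1 - t)).
    assert (H2 := Rmin_r (t - t0) (t1 - t)). apply Rabs_def2 in Hy. lra. }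
  destruct (MVT G id t0 t1 (fun c P => exist _ (dF c) (HG c P)) (fun c _ => derivable_pt_id c)) as [c [P E]]; auto.
  - intros c Hc. apply continuity_pt_filterlim. apply HC.
  - intros c Hc. apply derivable_continuous_pt, derivable_pt_id.
  - simpl in E. rewrite derive_pt_id in E. unfold id in E. unfold G in E.
    rewrite !clamp_id in E by lra. assert (H := HB c P). nra.
Qed.

(** The substitute for Duhamel's formula: derivatives and continuity are known for each mode
    separately, and only the derivative is bounded in [H^r]. *)
Lemma mvt_nb r (w d : R -> Fc) t0 t1 K : 0 <= K -> t0 <= t1 ->
  (forall k t, t0 < t < t1 -> cder (fun s => w s k) t (d t k)) ->
  (forall k, ccont t0 t1 (fun s => w s k)) ->
  (forall t, t0 < t < t1 -> nb r (d t) K) ->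
  nb r (fsub (w t1) (w t0)) (K * (t1 - t0)).
Proof.
  intros HK Ht Hd Hc Hn. split; [apply Rmult_le_pos; lra|]. intros L HL.
  set (c := fsub (w t1) (w t0)).
  destruct Ht as [Ht| <-].
  2:{ rewrite (lsum_ext _ (fun _ => 0)).
      - rewrite lsum_zero. apply pow2_ge_0.
      - intros k _. unfold c, fsub, Cminus. rewrite Cplus_opp_r, Cmod_0. ring. }
  set (X := lsum (fun k => (wt r k * Cmod (c k)) ^ 2) L).
  assert (PX : 0 <= X) by (apply lsum_nonneg; intros; apply pow2_ge_0).
  (* The scalar mean value theorem is applied to the pairing of [w] with its own increment [c]. *)
  set (phi := fun t => lsum (fun k => wt r k ^ 2 * (Re (c k) * Re (w t k) + Im (c k) * Im (w t k))) L).
  set (dphi := fun t => lsum (fun k => wt r k ^ 2 * (Re (c k) * Re (d t k) + Im (c k) * Im (d t k))) L).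
  assert (H1 : phi t1 - phi t0 <= (sqrt X * K) * (t1 - t0)).
  { apply mvt_le with dphi; auto.
    - intros t Htt. apply is_derive_lsum. intros k _. destruct (Hd k t Htt) as [D1 D2].
      evar_last.
      + apply (is_derive_scal (fun s => Re (c k) * Re (w s k) + Im (c k) * Im (w s k)) t (wt r k ^ 2)).
        apply (is_derive_plus (fun s => Re (c k) * Re (w s k)) (fun s => Im (c k) * Im (w s k))).
        * apply (is_derive_scal (fun s => Re (w s k)) t (Re (c k))). exact D1.
        * apply (is_derive_scal (fun s => Im (w s k)) t (Im (c k))). exact D2.
      + reflexivity.
    - apply (rcont_lsum t0 t1 (fun s k => wt r k ^ 2 * (Re (c k) * Re (w s k) + Im (c k) * Im (w s k)))).
      intros k. destruct (Hc k) as [C1 C2].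
      apply rcont_mult; [apply rcont_const|].
      apply rcont_plus; apply rcont_mult; auto; apply rcont_const.
    - intros t Htt. destruct (Hn t Htt) as [_ HN]. specialize (HN L HL).
      apply Rle_trans with (lsum (fun k => (wt r k * Cmod (c k)) * (wt r k * Cmod (d t k))) L).
      + apply lsum_le. intros k _.
        replace (wt r k * Cmod (c k) * (wt r k * Cmod (d t k)))
          with (wt r k ^ 2 * (Cmod (c k) * Cmod (d t k))) by ring.
        apply Rmult_le_compat_l; [apply pow2_ge_0|].
        rewrite <- (Cmod_conj (c k)), <- Cmod_mult. eapply Rle_trans; [|apply Rabs_Re_le].
        eapply Rle_trans; [|apply Rle_abs]. unfold Re, Im, Cconj, Cmult; simpl. lra.
      + apply Rsqr_incr_0_var; [|apply Rmult_le_pos; auto using sqrt_pos]. rewrite !Rsqr_pow2.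
        eapply Rle_trans; [apply lsum_CS|]. rewrite Rpow_mult_distr, pow2_sqrt by assumption.
        apply Rmult_le_compat_l; auto. }
  (* The increment of the pairing is the squared norm itself, so one factor [sqrt X] cancels against
     [H1]. *)
  assert (H2 : phi t1 - phi t0 = X).
  { unfold phi, X, Rminus.
    replace (- lsum (fun k => wt r k ^ 2 * (Re (c k) * Re (w t0 k) + Im (c k) * Im (w t0 k))) L)
      with ((-1) * lsum (fun k => wt r k ^ 2 * (Re (c k) * Re (w t0 k) + Im (c k) * Im (w t0 k))) L) by ring.
    rewrite <- lsum_scal, <- lsum_plus. apply lsum_ext. intros k _.
    rewrite Rpow_mult_distr, Cmod_sqr. unfold c, fsub, Cminus, Cplus, Copp, Re, Im; simpl. ring. }
  rewrite H2 in H1. assert (S0 := sqrt_pos X). assert (SX := sqrt_sqrt X PX).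
  destruct S0 as [S0|S0].
  - rewrite <- (pow2_sqrt X PX). apply pow_incr. split; [lra|].
    apply Rmult_le_reg_l with (sqrt X); auto. lra.
  - rewrite <- S0 in SX. rewrite <- SX, Rmult_0_l. apply pow2_ge_0.
Qed.

(** * Time derivative of the scheme and the error symbol *)

(** The integrand of [ph], hence its time derivative. *)
Definition ee (t q : R) : C := cexpi (- 2 * t * q).

Definition dmV (t : R) (j l : Z) : C := let x := IZR j in let y := IZR l in let K := x + y in
  guard j l (Cplus (Cplus
    (Cmult (Cmult (RtoC 2) (RtoC (y ^ 2 / K ^ 2))) (ee t (x ^ 2)))
    (Cmult (Cmult (RtoC 2) (RtoC (x ^ 2 / K ^ 2))) (Cminus (ee t (K * x)) (RtoC 1))))
    (Cmult (RtoC (2 * x * y / K ^ 2)) (Cplus (ee t (K ^ 2)) (Cminus (ee t (- (x * y))) (RtoC 1))))).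
Definition dmM (t : R) (j l : Z) : C := guard j l (Cmult (RtoC 2) (ee t ((IZR j + IZR l) * IZR l))).
Definition dmU (t : R) (j l : Z) : C := guard j l (ee t (IZR j * IZR l)).

Lemma cder_guard j l F x c : ((j <> 0)%Z -> (l <> 0)%Z -> (j + l <> 0)%Z -> cder F x c) ->
  cder (fun t => guard j l (F t)) x (guard j l c).
Proof.
  intros H. unfold guard.
  destruct (Z.eqb_spec j 0), (Z.eqb_spec l 0), (Z.eqb_spec (j + l) 0); simpl; try apply cder_const.
  now apply H.
Qed.

Lemma cder_RtoC_id x : cder RtoC x (RtoC 1).
Proof.
  apply cder_ext with (fun s => RtoC (1 * s + 0)); [intros; f_equal; ring|apply cder_RtoC].
Qed.

Lemma mul_neq0 x y : x <> 0 -> y <> 0 -> x * y <> 0.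
Proof. intros; now apply Rmult_integral_contrapositive_currified. Qed.

Lemma cder_mV j l x : cder (fun t => mV t j l) x (dmV x j l).
Proof.
  apply cder_ext with (fun t => guard j l (Cplus (Cplus (Cplus
    (Cmult (RtoC 2) (Cmult (RtoC (IZR l ^ 2 / (IZR j + IZR l) ^ 2)) (ph t (IZR j ^ 2))))
    (Cmult (RtoC 2) (Cmult (RtoC (IZR j ^ 2 / (IZR j + IZR l) ^ 2))
       (Cminus (ph t ((IZR j + IZR l) * IZR j)) (RtoC t)))))
    (Cmult (RtoC (2 * IZR j * IZR l / (IZR j + IZR l) ^ 2)) (ph t ((IZR j + IZR l) ^ 2))))
    (Cmult (RtoC (2 * IZR j * IZR l / (IZR j + IZR l) ^ 2))
       (Cminus (ph t (- (IZR j * IZR l))) (RtoC t))))).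
  { intros t. unfold mV, gL1, gL2, gL3, gL4, guard. cbv zeta. destruct (_ && _)%bool; ring. }
  unfold dmV. cbv zeta. apply cder_guard. intros Hj Hl Hk.
  apply not_0_IZR in Hj, Hl. apply IZR_sum_neq0 in Hk.
  eapply cder_eq.
  - apply cder_plus; [apply cder_plus; [apply cder_plus|]|].
    + apply cder_scal, cder_scal, cder_ph. now apply pow_nonzero.
    + apply cder_scal, cder_scal, cder_minus; [apply cder_ph|apply cder_RtoC_id]. now apply mul_neq0.
    + apply cder_scal, cder_ph. now apply pow_nonzero.
    + apply cder_scal, cder_minus; [apply cder_ph|apply cder_RtoC_id].
      now apply Ropp_neq_0_compat, mul_neq0.
  - unfold ee. ring.
Qed.

Lemma cder_mM j l x : cder (fun t => mM t j l) x (dmM x j l).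
Proof.
  apply cder_ext with (fun t => guard j l (Cmult (RtoC 2) (ph t ((IZR j + IZR l) * IZR l)))).
  { intros t. unfold mM, gI2, guard. destruct (_ && _)%bool; ring. }
  unfold dmM. apply cder_guard. intros Hj Hl Hk.
  apply not_0_IZR in Hj, Hl. apply IZR_sum_neq0 in Hk.
  apply cder_scal, cder_ph; auto using mul_neq0.
Qed.

Lemma cder_mU j l x : cder (fun t => mU t j l) x (dmU x j l).
Proof.
  unfold mU, gI1, dmU. apply cder_guard. intros Hj Hl Hk. apply not_0_IZR in Hj, Hl.
  apply cder_ph; auto using mul_neq0.
Qed.

(** * Differentiation of the scheme on finitely many modes *)

Definition finsupp (f : Fc) : Prop := exists n, forall k, ~ In k (zl n) -> f k = RtoC 0.

Lemma finsupp_conj f : finsupp f -> finsupp (fconj f).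
Proof.
  intros [n H]. exists n. intros k Hk. unfold fconj. rewrite H.
  - unfold Cconj, RtoC; simpl. f_equal. ring.
  - rewrite in_zl in *. lia.
Qed.

Lemma Bil_finite m f g n k : (forall k, ~ In k (zl n) -> f k = RtoC 0) ->
  Bil m f g k = clsum (fun j => Cmult (m j (k - j)%Z) (Cmult (f j) (g (k - j)%Z))) (zl n).
Proof.
  intros H. apply CsumZ_finite; [apply NoDup_zl|]. intros j Hj.
  destruct (in_dec Z.eq_dec j (zl n)) as [|Hn]; auto. exfalso. apply Hj. rewrite (H j Hn). ring.
Qed.

Lemma ab_finsupp m f g k : finsupp f -> ab m f g k.
Proof.
  intros [n Hn]. set (a := fun j => Cmult (m j (k - j)%Z) (Cmult (f j) (g (k - j)%Z))).
  exists (lsum (fun j => Cmod (a j)) (zl n)). intros L HL. destruct (incl_zl L) as [n' Hn'].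
  apply Rle_trans with (lsum (fun j => Cmod (a j)) (zl (n + n'))).
  - apply lsum_incl; auto using Cmod_ge_0. intros j Hj. apply Hn', in_zl in Hj. apply in_zl. lia.
  - apply Req_le, lsum_support; auto using NoDup_zl; intros j Hj;
      (destruct (in_dec Z.eq_dec j (zl n)) as [Hi|Hi]; [rewrite in_zl in *; lia|]);
      destruct Hj; unfold a; rewrite (Hn j Hi), Cmult_0_l, Cmult_0_r; apply Cmod_0.
Qed.

(** One window of frequencies serves all times, so the sum is finite and the derivative passes
    through it whatever the growth of [m']. *)
Lemma cder_Bil (m : R -> Z -> Z -> C) m' f g k x : finsupp f ->
  (forall j l, cder (fun t => m t j l) x (m' j l)) ->
  cder (fun t => Bil (m t) f g k) x (Bil m' f g k).
Proof.
  intros [n Hn] H. rewrite (Bil_finite _ _ _ n) by assumption.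
  apply cder_ext with (fun t => clsum (fun j => Cmult (m t j (k - j)%Z) (Cmult (f j) (g (k - j)%Z))) (zl n)).
  { intros t. now rewrite (Bil_finite _ _ _ n). }
  apply (cder_clsum (fun t j => Cmult (m t j (k - j)%Z) (Cmult (f j) (g (k - j)%Z)))). intros j.
  eapply cder_eq.
  - apply (cder_mult (fun t => m t j (k - j)%Z) (fun _ => Cmult (f j) (g (k - j)%Z)));
      [apply H|apply cder_const].
  - ring.
Qed.

Definition dInc (t c : R) (f : Fc) : Fc := fun k => Cmult (RtoC (Bs k))
  (Cplus (Cmult (RtoC (/ 4)) (quad (dmV t) (dmM t) (dmU t) f k))
         (Cmult (RtoC c) (Cplus (f k) (Cmult (ee t (IZR k ^ 2)) (fconj f k))))).

Lemma cder_Inc c f k x : finsupp f -> cder (fun t => Inc t c f k) x (dInc x c f k).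
Proof.
  intros Hf. assert (Hh := finsupp_conj f Hf). unfold Inc, dInc.
  destruct (Z.eq_dec k 0) as [->|Hk].
  { unfold Bs. simpl. apply cder_ext with (fun _ => RtoC 0); [intros; ring|].
    eapply cder_eq; [apply cder_const|ring]. }
  apply cder_scal. apply cder_plus; apply cder_scal.
  - unfold quad. apply cder_plus; [apply cder_plus|]; apply (cder_Bil (fun t => _ t)); auto;
      intros j l; [apply cder_mV|apply cder_mM|apply cder_mU].
  - apply cder_plus.
    + eapply cder_eq; [apply (cder_mult RtoC (fun _ => f k)); [apply cder_RtoC_id|apply cder_const]|].
      ring.
    + eapply cder_eq; [apply (cder_mult (fun t => ph t (IZR k ^ 2)) (fun _ => fconj f k));
        [apply cder_ph|apply cder_const]|]; [now apply pow_nonzero, not_0_IZR|]. unfold ee. ring.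
Qed.

(** A step of length zero changes nothing; this is the initial value for the mean value
    inequality. *)
Lemma Inc_0 c f k : Inc 0 c f k = RtoC 0.
Proof.
  unfold Inc, quad.
  assert (Z0 : forall m f g, (forall j l, m j l = RtoC 0) -> Bil m f g k = RtoC 0).
  { intros m f1 g1 H. unfold Bil. rewrite (CsumZ_finite _ [0%Z]).
    - unfold clsum. simpl. rewrite !H. unfold Re, Im, RtoC; simpl. f_equal; ring.
    - constructor; [intros []|constructor].
    - intros j Hj. destruct Hj. rewrite H. ring. }
  rewrite !Z0; [rewrite ph_0; ring| | |]; intros j l;
    unfold mU, mM, mV, gI1, gI2, gL1, gL2, gL3, gL4; cbv zeta; rewrite ?ph_0;
    unfold guard; destruct (_ && _)%bool; try ring; reflexivity.
Qed.

(* The interaction phase [exp (-2 i t (j^2 + jl + l^2))] factors as [ee (j^2) * ee (kl)],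
   as [ee (l^2) * ee (kj)] and as [ee (k^2) * ee (-jl)] with [k = j + l]; each scheme term replaces
   a product [a b] by [a + b - 1]. *)
Definition err (t : R) (j l : Z) : C := let x := IZR j in let y := IZR l in let K := x + y in
  guard j l (Cplus (Cplus
    (Cmult (RtoC (y ^ 2 / K ^ 2)) (Cmult (Cminus (ee t (x ^ 2)) (RtoC 1)) (Cminus (ee t (K * y)) (RtoC 1))))
    (Cmult (RtoC (x ^ 2 / K ^ 2)) (Cmult (Cminus (ee t (y ^ 2)) (RtoC 1)) (Cminus (ee t (K * x)) (RtoC 1)))))
    (Cmult (RtoC (2 * x * y / K ^ 2)) (Cmult (Cminus (ee t (K ^ 2)) (RtoC 1)) (Cminus (ee t (- (x * y))) (RtoC 1))))).

Lemma ee_plus t p q : Cmult (ee t p) (ee t q) = ee t (p + q).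
Proof. unfold ee. rewrite <- cexpi_plus. f_equal. ring. Qed.

(** Each product is written [a b = (a + b - 1) + (a - 1)(b - 1)], and the three are averaged with
    weights [l^2/k^2], [j^2/k^2] and [2 j l/k^2], which add up to 1 since [(j + l)^2 = k^2]. The
    symbol of the scheme is not symmetric: [ee (j^2)] and [ee (k l) - 1] come from opposite orders
    of [j] and [l], so the half-sum over both orders appears. *)
Lemma err_symbol t j l : (j <> 0)%Z -> (l <> 0)%Z -> (j + l <> 0)%Z ->
  Cmult (Sg t (j + l)) (Cmult (Sg t j) (Sg t l)) =
  Cplus (Cmult (RtoC (/ 2)) (Cplus (dmV t j l) (dmV t l j))) (err t j l).
Proof.
  intros Hj Hl Hk. unfold dmV, err. cbv zeta.
  rewrite !guard_nz by (auto; rewrite Z.add_comm; auto).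
  set (x := IZR j). set (y := IZR l). rewrite (Rplus_comm y x). set (K := x + y).
  assert (HK : K <> 0) by (unfold K, x, y; now apply IZR_sum_neq0).
  set (E := Cmult (Sg t (j + l)) _).
  assert (HE : E = ee t (x ^ 2 + x * y + y ^ 2)).
  { unfold E, Sg, ee. rewrite <- !cexpi_plus. f_equal. rewrite plus_IZR. fold x y. ring. }
  assert (E1 : E = Cmult (ee t (x ^ 2)) (ee t (K * y))) by (rewrite ee_plus, HE; f_equal; unfold K; ring).
  assert (E2 : E = Cmult (ee t (y ^ 2)) (ee t (K * x))) by (rewrite ee_plus, HE; f_equal; unfold K; ring).
  assert (E3 : E = Cmult (ee t (K ^ 2)) (ee t (- (x * y)))) by (rewrite ee_plus, HE; f_equal; unfold K; ring).
  replace (y * x) with (x * y) by ring. replace (2 * y * x) with (2 * x * y) by ring.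
  assert (S : Cplus (Cplus (RtoC (y ^ 2 / K ^ 2)) (RtoC (x ^ 2 / K ^ 2))) (RtoC (2 * x * y / K ^ 2)) = RtoC 1).
  { rewrite <- !RtoC_plus. f_equal. unfold K. field. exact HK. }
  set (cy := RtoC (y ^ 2 / K ^ 2)) in *. set (cx := RtoC (x ^ 2 / K ^ 2)) in *.
  set (cxy := RtoC (2 * x * y / K ^ 2)) in *.
  transitivity (Cplus (Cplus (Cmult cy E) (Cmult cx E)) (Cmult cxy E)).
  - rewrite <- !Cmult_plus_distr_r, S. ring.
  - rewrite E1 at 1. rewrite E2 at 1. rewrite E3 at 1.
    rewrite RtoC_half, RtoC_2. field.
Qed.

Lemma Cmod_ee_m1 t q : 0 <= t -> Cmod (Cminus (ee t q) (RtoC 1)) <= 2 * t * Rabs q.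
Proof.
  intros Ht. unfold ee. eapply Rle_trans; [apply Cmod_cexpi_m1|].
  replace (-2 * t * q) with (- (2 * t * q)) by ring. rewrite Rabs_Ropp, !Rabs_mult.
  rewrite (Rabs_right 2), (Rabs_right t) by lra. lra.
Qed.

(** One factor is bounded by [2 t |q|] and the other by 2, in the better of the two ways: a single
    power of [t] is kept so that a single phase is lost. *)
Lemma Cmod_ee_m1_prod t p q : 0 <= t ->
  Cmod (Cmult (Cminus (ee t p) (RtoC 1)) (Cminus (ee t q) (RtoC 1))) <= 4 * t * Rmin (Rabs p) (Rabs q).
Proof.
  intros Ht. rewrite Cmod_mult.
  assert (H1 := Cmod_ee_m1 t p Ht). assert (H2 := Cmod_ee_m1 t q Ht).
  assert (H3 : Cmod (Cminus (ee t p) (RtoC 1)) <= 2) by apply Cmod_cexpi_m1_2.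
  assert (H4 : Cmod (Cminus (ee t q) (RtoC 1)) <= 2) by apply Cmod_cexpi_m1_2.
  assert (P1 := Cmod_ge_0 (Cminus (ee t p) (RtoC 1))). assert (P2 := Cmod_ge_0 (Cminus (ee t q) (RtoC 1))).
  unfold Rmin. destruct (Rle_dec _ _); nra.
Qed.

(** The factor 2 comes from [jj k <= (2 k)^2] for nonzero [k]. *)
Lemma errD_large j l : (j + l <> 0)%Z -> jj (j + l) <= Rmin (jj j) (jj l) ->
  Rabs (IZR l) ^ 3 / Rabs (IZR j + IZR l) <= 2 * errD j l.
Proof.
  intros Hk H. unfold errD. destruct (Rle_dec _ _) as [_|]; [|contradiction].
  assert (PZ := jj_ge1 l). assert (PX := jj_ge1 (j + l)).
  assert (K1 := Rabs_IZR_ge1 (j + l) Hk). assert (EK : Rabs (IZR (j + l)) = Rabs (IZR j + IZR l)) by now rewrite plus_IZR.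
  rewrite EK in K1. set (K := Rabs (IZR j + IZR l)) in *.
  assert (E1 : Rabs (IZR l) ^ 3 <= Rpower (jj l) (3 / 2)).
  { assert (W := wt1_ge_abs l). unfold wt in W.
    replace (3 / 2) with (1 / 2 * INR 3) by (simpl; field).
    rewrite <- Rpower_mult, Rpower_pow by apply Rpower_pos. apply pow_incr. split; auto using Rabs_pos. }
  assert (E2 : / K <= 2 * Rpower (jj (j + l)) (- / 2)).
  { rewrite Rpower_Ropp, Rpower_sqrt by lra.
    replace (/ K) with (2 * / (2 * K)) by (field; lra). apply Rmult_le_compat_l; [lra|].
    apply Rinv_le_contravar; [apply sqrt_lt_R0; lra|].
    rewrite <- (sqrt_pow2 (2 * K)) by lra. apply sqrt_le_1_alt.
    unfold jj. rewrite <- pow2_abs, EK. fold K. nra. }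
  unfold Rdiv. replace (2 * (Rpower (jj l) (3 * / 2) * Rpower (jj (j + l)) (- / 2)))
    with (Rpower (jj l) (3 * / 2) * (2 * Rpower (jj (j + l)) (- / 2))) by ring.
  apply Rmult_le_compat; auto.
  - apply pow_le, Rabs_pos.
  - apply Rlt_le, Rinv_0_lt_compat. lra.
Qed.

(** [al] and [be] are [|j|/|k|] and [|l|/|k|]. If both are at least 1, the minima are bounded by
    [K (be K)], [K (al K)] and [K^2]; with [al <= 2 be] this gives
    [(4 + 32 + 16) t be^3 K^2 <= 104 t D]. Otherwise both are at most 2, and [(al K)^2], [(be K)^2]
    and [al be K^2] give [16 t (al be K)^2 <= 64 t D]. *)
Lemma err_real t K al be m1 m2 m3 D : 0 <= t -> 1 <= K -> 0 <= al -> 0 <= be ->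
  0 <= m1 -> 0 <= m2 -> 0 <= m3 ->
  1 <= al + be -> al <= 1 + be -> be <= 1 + al ->
  m1 <= 4 * t * Rmin ((al * K) ^ 2) (K * (be * K)) -> m2 <= 4 * t * Rmin ((be * K) ^ 2) (K * (al * K)) ->
  m3 <= 4 * t * Rmin (K ^ 2) (al * K * (be * K)) ->
  (1 <= al -> 1 <= be -> (be * K) ^ 3 / K <= 2 * D) ->
  (al < 1 \/ be < 1 -> Rmin ((al * K) ^ 2) ((be * K) ^ 2) <= D) ->
  be ^ 2 * m1 + al ^ 2 * m2 + 2 * (al * be) * m3 <= 110 * t * D.
Proof.
  intros Ht HK Ha Hb P1 P2 P3 T1 T2 T3 M1 M2 M3 DA DB.
  assert (Qa := pow2_ge_0 al). assert (Qb := pow2_ge_0 be).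
  assert (Qab : 0 <= al * be) by now apply Rmult_le_pos.
  assert (QK := pow2_ge_0 K).
  assert (Hm : forall c x y z, 0 <= z -> c <= 4 * t * Rmin x y -> z * c <= 4 * t * (z * x) /\ z * c <= 4 * t * (z * y)).
  { intros c x y z Hz Hc. assert (H1 := Rmin_l x y). assert (H2 := Rmin_r x y).
    assert (H3 : z * c <= z * (4 * t * Rmin x y)) by now apply Rmult_le_compat_l.
    assert (H4 : 0 <= t * z) by now apply Rmult_le_pos.
    assert (t * z * Rmin x y <= t * z * x) by now apply Rmult_le_compat_l.
    assert (t * z * Rmin x y <= t * z * y) by now apply Rmult_le_compat_l. split; lra. }
  destruct (Hm _ _ _ _ Qb M1) as [M11 M12]. destruct (Hm _ _ _ _ Qa M2) as [M21 M22].
  destruct (Hm _ _ _ _ Qab M3) as [M31 M32].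
  assert (HtK : 0 <= t * K ^ 2) by now apply Rmult_le_pos.
  assert (Hmono : forall u v, u <= v -> t * K ^ 2 * u <= t * K ^ 2 * v) by (intros; now apply Rmult_le_compat_l).
  destruct (Rlt_dec al 1) as [A1|A1]; [|destruct (Rlt_dec be 1) as [B1|B1]].
  1,2: set (m := Rmin al be); assert (Pm : 0 <= m) by (now apply Rmin_glb);
    assert (Ma : m <= al) by apply Rmin_l; assert (Mb : m <= be) by apply Rmin_r.
  1,2: assert (HD : m ^ 2 * K ^ 2 <= D) by
    (eapply Rle_trans; [|apply DB; auto]; rewrite <- Rpow_mult_distr;
     apply Rmin_glb; apply pow_incr; split;
       try (apply Rmult_le_pos; lra); apply Rmult_le_compat_r; lra).
  1,2: assert (HD' := Rmult_le_compat_l t _ _ Ht HD).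
  1,2: assert (F : be ^ 2 * al ^ 2 <= 4 * m ^ 2) by
    (replace 4 with (2 ^ 2) by ring; rewrite <- !Rpow_mult_distr; apply pow_incr; split;
     [apply Rmult_le_pos; lra|]; unfold m, Rmin; destruct (Rle_dec al be);
     [|rewrite Rmult_comm]; apply Rmult_le_compat_r; lra).
  1,2: apply Hmono in F; nra.
  apply Rnot_lt_le in A1, B1. assert (HD := DA A1 B1).
  replace ((be * K) ^ 3 / K) with (be ^ 3 * K ^ 2) in HD by (field; lra).
  assert (HD' := Rmult_le_compat_l t _ _ Ht HD).
  assert (F1 : al ^ 3 <= 8 * be ^ 3).
  { replace (8 * be ^ 3) with ((2 * be) ^ 3) by ring. apply pow_incr. lra. }
  assert (F2 : al * be <= 2 * be ^ 3).
  { assert (al * be <= 2 * be ^ 2) by nra. assert (be ^ 2 <= be ^ 3) by nra. lra. }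
  apply Hmono in F1, F2. nra.
Qed.

Lemma err_bound t j l : 0 <= t -> Cmod (err t j l) <= (110 * t) * errD j l.
Proof.
  intros Ht. unfold err. cbv zeta. apply guard_le.
  { apply Rmult_le_pos; [lra|]. unfold errD. destruct (Rle_dec _ _).
    - apply Rmult_le_pos; apply Rlt_le, Rpower_pos.
    - apply Rmin_glb; [assert (H := jj_ge1 j)|assert (H := jj_ge1 l)]; lra. }
  intros Hj Hl Hk. eapply Rle_trans; [apply Cmod_triangle|].
  eapply Rle_trans; [apply Rplus_le_compat_r, Cmod_triangle|].
  rewrite !(Cmod_mult (RtoC _)), !Cmod_R.
  assert (M1 := Cmod_ee_m1_prod t (IZR j ^ 2) ((IZR j + IZR l) * IZR l) Ht).
  assert (M2 := Cmod_ee_m1_prod t (IZR l ^ 2) ((IZR j + IZR l) * IZR j) Ht).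
  assert (M3 := Cmod_ee_m1_prod t ((IZR j + IZR l) ^ 2) (- (IZR j * IZR l)) Ht).
  assert (EL := errD_large j l Hk).
  assert (TK : Rabs (IZR j + IZR l) <= Rabs (IZR j) + Rabs (IZR l)) by apply Rabs_triang.
  assert (Tx : Rabs (IZR j) <= Rabs (IZR j + IZR l) + Rabs (IZR l)).
  { replace (IZR j) with ((IZR j + IZR l) + - IZR l) at 1 by ring. rewrite <- (Rabs_Ropp (IZR l)). apply Rabs_triang. }
  assert (Ty : Rabs (IZR l) <= Rabs (IZR j + IZR l) + Rabs (IZR j)).
  { replace (IZR l) with ((IZR j + IZR l) + - IZR j) at 1 by ring. rewrite <- (Rabs_Ropp (IZR j)). apply Rabs_triang. }
  assert (K1 := Rabs_IZR_ge1 (j + l) Hk). rewrite plus_IZR in K1.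
  rewrite Rabs_Ropp, Rabs_mult in M3. rewrite (Rabs_mult _ (IZR l)) in M1. rewrite (Rabs_mult _ (IZR j)) in M2.
  unfold Rdiv. rewrite !Rabs_mult. rewrite <- !RPow_abs in *. rewrite !Rabs_inv.
  rewrite <- !RPow_abs. rewrite (Rabs_right 2) by lra.
  assert (Q : forall p q, jj p <= jj q <-> Rabs (IZR p) <= Rabs (IZR q)).
  { intros p q. rewrite jj_le_abs, <- !abs_IZR. split; [apply IZR_le|apply le_IZR]. }
  assert (QX : Rabs (IZR (j + l)) = Rabs (IZR j + IZR l)) by now rewrite plus_IZR.
  assert (P1 := Rabs_pos (IZR j)). assert (P2 := Rabs_pos (IZR l)).
  assert (J1 : Rabs (IZR j) ^ 2 <= jj j) by (rewrite pow2_abs; unfold jj; lra).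
  assert (L1 : Rabs (IZR l) ^ 2 <= jj l) by (rewrite pow2_abs; unfold jj; lra).
  set (D := errD j l) in *. set (K := Rabs (IZR j + IZR l)) in *.
  set (a := Rabs (IZR j)) in *. set (b := Rabs (IZR l)) in *.
  match type of M1 with ?c <= _ => assert (Pm1 : 0 <= c) by apply Cmod_ge_0; set (m1 := c) in * end.
  match type of M2 with ?c <= _ => assert (Pm2 : 0 <= c) by apply Cmod_ge_0; set (m2 := c) in * end.
  match type of M3 with ?c <= _ => assert (Pm3 : 0 <= c) by apply Cmod_ge_0; set (m3 := c) in * end.
  assert (IK : 0 < / K) by (apply Rinv_0_lt_compat; lra).
  assert (Ea : a = a * / K * K) by (field; lra). assert (Eb : b = b * / K * K) by (field; lra).
  replace (b ^ 2 * / K ^ 2 * m1 + a ^ 2 * / K ^ 2 * m2 + 2 * a * b * / K ^ 2 * m3)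
    with ((b * / K) ^ 2 * m1 + (a * / K) ^ 2 * m2 + 2 * ((a * / K) * (b * / K)) * m3) by (field; lra).
  assert (Iv : forall u v, u <= v -> u * / K <= v * / K) by (intros; apply Rmult_le_compat_r; lra).
  assert (KK : K * / K = 1) by (field; lra).
  apply Iv in TK, Tx, Ty. rewrite !Rmult_plus_distr_r, KK in *.
  assert (Iv' : forall u, K <= u <-> 1 <= u * / K).
  { intros u. split; intros H; [rewrite <- KK; now apply Iv|].
    apply Rmult_le_reg_r with (/ K); lra. }
  assert (Pa : 0 <= a * / K) by (apply Rmult_le_pos; lra).
  assert (Pb : 0 <= b * / K) by (apply Rmult_le_pos; lra).
  apply err_real with K; rewrite <- ?Ea, <- ?Eb; auto; try lra.
  - intros H1 H2. apply EL. apply Iv' in H1, H2. apply Rmin_glb; apply Q; rewrite QX; assumption.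
  - intros H. assert (HD : D = Rmin (jj j) (jj l)).
    { unfold D, errD. destruct (Rle_dec _ _) as [HX|]; auto. exfalso.
      assert (X1 : K <= a) by (rewrite <- QX; apply Q; eapply Rle_trans; [apply HX|apply Rmin_l]).
      assert (X2 : K <= b) by (rewrite <- QX; apply Q; eapply Rle_trans; [apply HX|apply Rmin_r]).
      apply Iv' in X1, X2. lra. }
    rewrite HD. apply Rmin_glb; eapply Rle_trans; [apply Rmin_l| |apply Rmin_r|]; assumption.
Qed.

(** * Products in [H^r] and the derivative of the increment *)

Lemma fmul_comm r Cb f g A B k : stab_const r Cb -> nb r f A -> nb r g B ->
  fmul f g k = fmul g f k.
Proof.
  intros HC Hf Hg. rewrite !fmul_Bil. rewrite Bil_swap; auto.
  apply (fmul_bound r Cb f g A B); auto.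
Qed.

Lemma fmul_plus_l r Cb f f' g A B D k : stab_const r Cb -> nb r f A -> nb r f' B -> nb r g D ->
  fmul (fadd f f') g k = Cplus (fmul f g k) (fmul f' g k).
Proof.
  intros HC Hf Hf' Hg. rewrite !fmul_Bil. apply Bil_plus_l.
  - apply (fmul_bound r Cb f g A D); auto.
  - apply (fmul_bound r Cb f' g B D); auto.
Qed.

Lemma fmul_plus_sqr r Cb f g A B k : stab_const r Cb -> nb r f A -> nb r g B ->
  fsq (fadd f g) k = Cplus (Cplus (fmul f f k) (Cmult (RtoC 2) (fmul f g k))) (fmul g g k).
Proof.
  intros HC Hf Hg. unfold fsq. assert (Hs := nb_plus _ _ _ _ _ Hf Hg).
  rewrite (fmul_plus_l r Cb _ _ _ A B (A + B)) by auto.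
  rewrite (fmul_comm r Cb f _ A (A + B)), (fmul_comm r Cb g _ B (A + B)) by auto.
  rewrite (fmul_plus_l r Cb f g f A B A), (fmul_plus_l r Cb f g g A B B) by auto.
  rewrite (fmul_comm r Cb g f B A) by auto. rewrite RtoC_2. ring.
Qed.

Lemma clsum_single a j : clsum a [j] = a j.
Proof. unfold clsum. simpl. destruct (a j). unfold Re, Im; simpl. f_equal; ring. Qed.

Lemma fmul_const f c k : fmul (fconst c) f k = Cmult c (f k).
Proof.
  unfold fmul. rewrite (CsumZ_finite _ [0%Z]).
  - rewrite clsum_single, Z.sub_0_r. reflexivity.
  - constructor; [intros []|constructor].
  - intros j Hj. unfold fconst in Hj. destruct (Z.eq_dec j 0) as [->|]; [now left|].
    destruct Hj. ring.
Qed.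

(** Propagation with [k^2] in place of [bsym k], the replacement that makes all phases of the scheme
    quadratic polynomials in the frequencies. *)
Definition twist (t : R) (f : Fc) : Fc := Defs.mult (Sg (- t)) f.
(** The reconstruction of [z] from [u], shared by the exact and the numerical solution. *)
Definition zap (c : R) (g : Fc) : Fc := fadd (fscal (RtoC (/ 2)) (fadd g (fconj g))) (fconst (RtoC c)).

Lemma nb_twist s t f A : nb s f A -> nb s (twist t f) A.
Proof. apply (nb_unimod s f A (fun k => - - t * IZR k ^ 2)). Qed.

Lemma fconj_twist t f k : fconj (twist t f) k = Cmult (Sg t k) (fconj f k).
Proof.
  unfold fconj, twist, Defs.mult. rewrite Cmult_conj. f_equal. unfold Sg.
  rewrite <- cexpi_opp. f_equal. rewrite opp_IZR. ring.
Qed.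

Lemma Sg_cancel t k : Cmult (Sg t k) (Sg (- t) k) = RtoC 1.
Proof.
  unfold Sg. rewrite <- cexpi_plus. replace (- t * IZR k ^ 2 + - - t * IZR k ^ 2) with 0 by ring.
  apply cexpi_0.
Qed.

Lemma Sg_sqr t k : Cmult (Sg t k) (Sg t k) = ee t (IZR k ^ 2).
Proof. unfold Sg, ee. rewrite <- cexpi_plus. f_equal. ring. Qed.

Lemma fsq_zap r Cb c g A k : stab_const r Cb -> nb r g A -> (k <> 0)%Z ->
  fsq (zap c g) k = Cplus (Cmult (RtoC (/ 4)) (Cplus (Cplus (fmul g g k)
      (Cmult (RtoC 2) (fmul g (fconj g) k))) (fmul (fconj g) (fconj g) k)))
    (Cmult (RtoC c) (Cplus (g k) (fconj g k))).
Proof.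
  intros HC Hg Hk. assert (Hc := nb_conj _ _ _ Hg). assert (Hs := nb_plus _ _ _ _ _ Hg Hc).
  set (p := fscal (RtoC (/ 2)) (fadd g (fconj g))).
  assert (Hp := nb_scal _ _ (RtoC (/ 2)) _ Hs). fold p in Hp.
  assert (HK := nb_const r (RtoC c)).
  unfold zap. fold p.
  rewrite (fmul_plus_sqr r Cb p (fconst (RtoC c)) _ _ k HC Hp HK).
  rewrite (fmul_comm r Cb p _ _ _ k HC Hp HK). rewrite !fmul_const.
  replace (fmul p p k) with (Cmult (RtoC (/ 4)) (fsq (fadd g (fconj g)) k)).
  2:{ rewrite (fmul_Bil p p). unfold fsq. rewrite fmul_Bil.
      rewrite <- Bil_scal by (apply (fmul_bound r Cb _ _ _ _ HC Hs Hs)).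
      apply CsumZ_ext. intros j. unfold p, fscal.
      replace (/ 4) with (/ 2 * / 2) by field. rewrite RtoC_mult. ring. }
  rewrite (fmul_plus_sqr r Cb g (fconj g) A A k) by auto.
  unfold p, fscal, fadd. unfold fconst. destruct (Z.eq_dec k 0); [contradiction|].
  rewrite RtoC_half, RtoC_2. field.
Qed.

(** Consistency in exact form: up to [err], the derivative of the increment is the twisted
    nonlinearity at the reconstruction of the linearly propagated value [f]. The three products of
    [fsq_zap] match the three parts of [quad], and finite support allows [dmV] to be separated from
    [err]. *)
Lemma dInc_err r Cb t c f A k : stab_const r Cb -> nb r f A -> finsupp f -> f 0%Z = RtoC 0 ->
  dInc t c f k = Cmult (RtoC (Bs k)) (Cminus (Cmult (Sg t k) (fsq (zap c (twist t f)) k))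
     (Cmult (RtoC (/ 4)) (Bil (err t) (fconj f) (fconj f) k))).
Proof.
  intros HC Hf Hfin f0. unfold dInc.
  destruct (Z.eq_dec k 0) as [->|Hk]; [unfold Bs; simpl; ring|]. f_equal.
  assert (Hg := nb_twist _ t _ _ Hf). set (g := twist t f) in *.
  assert (Hgb := nb_conj _ _ _ Hg). assert (Hh := nb_conj _ _ _ Hf). set (h := fconj f) in *.
  assert (h0 : h 0%Z = RtoC 0) by now apply fconj_0.
  rewrite (fsq_zap r Cb c g A k HC Hg Hk).
  assert (Hhfin := finsupp_conj f Hfin). fold h in Hhfin.
  assert (EU : Cmult (Sg t k) (fmul g g k) = Bil (dmU t) f f k).
  { unfold g, twist. rewrite fmul_mult_Bil, <- Bil_scal by now apply ab_finsupp.
    apply Bil_congr; auto. intros j l Hj Hl <-. unfold dmU. rewrite guard_nz by assumption.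
    unfold Sg, ee. rewrite <- !cexpi_plus. f_equal. rewrite plus_IZR. ring. }
  assert (EM : Cmult (RtoC 2) (Cmult (Sg t k) (fmul g (fconj g) k)) = Bil (dmM t) f h k).
  { replace (fmul g (fconj g) k) with (Bil (fun j l => Cmult (Sg (- t) j) (Sg t l)) f h k).
    2:{ apply CsumZ_ext. intros j. unfold g. rewrite fconj_twist. unfold twist, Defs.mult, h. ring. }
    rewrite Cmult_assoc, <- Bil_scal by now apply ab_finsupp.
    apply Bil_congr; auto. intros j l Hj Hl <-. unfold dmM. rewrite guard_nz by assumption.
    rewrite <- Cmult_assoc. f_equal.
    unfold Sg, ee. rewrite <- !cexpi_plus. f_equal. rewrite plus_IZR. ring. }
  assert (EV : Cmult (Sg t k) (fmul (fconj g) (fconj g) k) = Cplus (Bil (dmV t) h h k) (Bil (err t) h h k)).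
  { replace (fmul (fconj g) (fconj g) k) with (Bil (fun j l => Cmult (Sg t j) (Sg t l)) h h k).
    2:{ apply CsumZ_ext. intros j. unfold g. rewrite !fconj_twist. unfold h. ring. }
    rewrite <- Bil_scal by now apply ab_finsupp.
    transitivity (Bil (fun j l => Cplus (Cplus (Cmult (RtoC (/ 2)) (dmV t j l))
       (Cmult (RtoC (/ 2)) (dmV t l j))) (Cmult (RtoC 1) (err t j l))) h h k).
    - apply Bil_congr; auto. intros j l Hj Hl <-. rewrite err_symbol by auto. ring.
    - rewrite (Bil_lin3 (dmV t) (fun j l => dmV t l j)) by now apply ab_finsupp.
      rewrite <- (Bil_swap (dmV t)) by now apply ab_finsupp.
      rewrite RtoC_half. field. }
  unfold quad. fold h. rewrite <- EU, <- EM.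
  replace (Bil (dmV t) h h k) with (Cminus (Cmult (Sg t k) (fmul (fconj g) (fconj g) k)) (Bil (err t) h h k))
    by (rewrite EV; ring).
  replace (fconj g k) with (Cmult (Sg t k) (h k)) by (symmetry; apply fconj_twist).
  rewrite <- Sg_sqr. replace (g k) with (Cmult (Sg (- t) k) (f k)) by reflexivity.
  assert (HS := Sg_cancel t k). fold h. ring [HS].
Qed.

(** * Truncation to finitely many modes *)

Definition trunc (n : nat) (f : Fc) : Fc := fun k => if in_dec Z.eq_dec k (zl n) then f k else RtoC 0.

Lemma finsupp_trunc n f : finsupp (trunc n f).
Proof. exists n. intros k Hk. unfold trunc. now destruct (in_dec _ _ _). Qed.

Lemma nb_trunc s n f A : nb s f A -> nb s (trunc n f) A.
Proof.
  apply nb_le. intros k. unfold trunc. destruct (in_dec _ _ _); [lra|].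
  rewrite Cmod_0. apply Cmod_ge_0.
Qed.

Lemma trunc_0 n f : f 0%Z = RtoC 0 -> trunc n f 0%Z = RtoC 0.
Proof. intros H. unfold trunc. now destruct (in_dec _ _ _). Qed.

Lemma trunc_close s f A d : 0 < d -> nb s f A -> exists n, nb s (fsub f (trunc n f)) d.
Proof.
  intros Hd [HA H]. set (a := fun k => (wt s k * Cmod (f k)) ^ 2).
  assert (Pa : forall k, 0 <= a k) by (intros; apply pow2_ge_0).
  assert (Ea : ex_sumZ a) by (eapply sumb_ex; eauto).
  assert (Sa := sumb_sumZ a Pa Ea). assert (La := is_lim_sumZ a Ea).
  apply is_lim_seq_spec in La.
  assert (Hd2 : 0 < d ^ 2) by now apply pow_lt.
  destruct (La (mkposreal _ Hd2)) as [n Hn]. specialize (Hn n (le_n n)). simpl pos in Hn.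
  exists n. split; [lra|]. intros L HL.
  set (L' := filter (fun k => if in_dec Z.eq_dec k (zl n) then false else true) L).
  apply Rle_trans with (lsum a L').
  - assert (NL' : NoDup L') by now apply NoDup_filter.
    assert (Z0 : forall k, (wt s k * Cmod (fsub f (trunc n f) k)) ^ 2 <> 0 -> ~ In k (zl n)).
    { intros k Hk Hin. apply Hk. unfold fsub, trunc. destruct (in_dec _ _ _); [|contradiction].
      unfold Cminus. rewrite Cplus_opp_r, Cmod_0. ring. }
    set (b := fun k => (wt s k * Cmod (fsub f (trunc n f) k)) ^ 2) in *.
    apply Rle_trans with (lsum b L').
    { clear - Z0. unfold L'. induction L as [|x L IH]; simpl; [lra|].
      destruct (in_dec Z.eq_dec x (zl n)) as [Hx|Hx]; simpl; [|lra].
      destruct (Req_dec (b x) 0) as [E|E]; [lra|]. destruct (Z0 x E Hx). }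
    apply lsum_le. intros k Hk. apply filter_In in Hk. destruct Hk as [_ Hk].
      unfold b, fsub, trunc, a. destruct (in_dec _ _ _); [discriminate|].
      unfold Cminus. replace (Copp (RtoC 0)) with (RtoC 0) by ring. rewrite Cplus_0_r. lra.
  (* [L'] is disjoint from the window, so both together stay below the total, of which the window
     misses less than [d^2]. *)
  - assert (N : NoDup (L' ++ zl n)).
    { apply NoDup_app; [now apply NoDup_filter|apply NoDup_zl|].
      intros k Hk1 Hk2. apply filter_In in Hk1. destruct Hk1 as [_ Hk1].
      destruct (in_dec _ _ _); [discriminate|contradiction]. }
    assert (S := Sa _ N). rewrite lsum_app in S. apply Rabs_def2 in Hn. lra.
Qed.

(** * The exact solution *)

(** Factorization of [x'' = - b^2 x - q R] into first-order equations; the rotating factor removes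
    the linear part and leaves only the forcing in the derivative. *)
Lemma half_wave (b q : R) (x xt Rh : R -> C) t0 t : b <> 0 ->
  cder x t (xt t) ->
  cder xt t (Cminus (Cmult (RtoC (- b ^ 2)) (x t)) (Cmult (RtoC q) (Rh t))) ->
  cder (fun s => Cmult (cexpi (- b * s + b * t0)) (Cminus (x s) (Cmult (Cmult Ci (RtoC (/ b))) (xt s)))) t
    (Cmult (Cmult Ci (RtoC (q / b))) (Cmult (cexpi (- b * (t - t0))) (Rh t))).
Proof.
  intros Hb Hx Hxt. eapply cder_eq.
  - apply cder_mult; [apply cder_cexpi|].
    apply cder_minus; [exact Hx|apply cder_scal; exact Hxt].
  - replace (- b * (t - t0)) with (- b * t + b * t0) by ring. unfold Rdiv.
    rewrite !RtoC_mult, !RtoC_opp, RtoC_pow, !RtoC_inv by assumption.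
    assert (Hb' := RtoC_neq0 b Hb). generalize Ci2. intros H. field [H]. assumption.
Qed.

Lemma CsumZ_conj a : absc a -> CsumZ (fun k => Cconj (a k)) = Cconj (CsumZ a).
Proof.
  intros Ha. destruct (absc_ex _ Ha) as [_ HI]. unfold CsumZ, Cconj; simpl. f_equal.
  transitivity (sumZ (fun k => -1 * Im (a k))).
  - apply sumZ_ext. intros k. unfold Im. ring.
  - rewrite (proj2 (sumZ_scal (-1) _ HI)). ring.
Qed.

Lemma fconj_fsq r Cb f A k : stab_const r Cb -> nb r f A -> fconj (fsq f) k = fsq (fconj f) k.
Proof.
  intros HC Hf. unfold fconj at 1. unfold fsq. rewrite !fmul_Bil. unfold Bil.
  assert (HA : ab (fun _ _ => RtoC 1) f f (- k)) by (apply (fmul_bound r Cb f f A A); auto).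
  rewrite <- CsumZ_conj by exact HA.
  assert (HA' : absc (fun j => Cconj (Cmult (RtoC 1) (Cmult (f j) (f (- k - j)%Z))))).
  { revert HA. apply absc_le with (c := 1); [|lra]. intros j. rewrite Cmod_conj. lra. }
  rewrite <- (CsumZ_invol _ Z.opp) by (auto; intros; lia).
  apply CsumZ_ext. intros j. unfold fconj. rewrite !Cmult_conj.
  replace (- k - - j)%Z with (- (k - j))%Z by lia. f_equal.
  unfold Cconj, RtoC; simpl. f_equal. ring.
Qed.

Lemma fsq_diff r Cb f g A d : stab_const r Cb -> nb r f A -> nb r g A -> nb r (fsub f g) d ->
  nb r (fsub (fsq f) (fsq g)) (4 * Cb * A * d).
Proof.
  intros HC Hf Hg Hd.
  assert (H := Bil_diff r Cb (fun _ _ => RtoC 1) 2 f f g g A d HC ltac:(lra)).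
  replace (4 * Cb * A * d) with (2 * Cb * 2 * A * d) by ring.
  apply nb_ext with (fsub (Bil (fun _ _ => RtoC 1) f f) (Bil (fun _ _ => RtoC 1) g g)).
  - intros k. unfold fsub, fsq. now rewrite !fmul_Bil.
  - apply H; auto. intros j l. rewrite Cmod_1. apply stabD_ge.
Qed.

Lemma ccont_cont_Hs s T z k : 0 <= T -> cont_Hs s T z -> ccont 0 T (fun t => z t k).
Proof.
  intros HT [Hin Hc].
  assert (E : forall x eps, 0 < eps -> exists d, 0 < d /\ forall y, Rabs (y - x) < d ->
    Cmod (Cminus (z (clamp 0 T y) k) (z (clamp 0 T x) k)) < eps).
  { intros x eps He. assert (W := wt_pos s k).
    assert (Hx := clamp_in 0 T x HT).
    destruct (Hc _ Hx (wt s k * eps)) as [d [Hd H]]; [now apply Rmult_lt_0_compat|].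
    exists d. split; auto. intros y Hy. assert (Hy' := clamp_in 0 T y HT).
    assert (H1 : Hs_norm s (fsub (z (clamp 0 T y)) (z (clamp 0 T x))) < wt s k * eps).
    { apply H; auto. eapply Rle_lt_trans; [apply clamp_lip|exact Hy]. }
    apply Rmult_lt_reg_l with (wt s k); auto. eapply Rle_lt_trans; [|exact H1].
    apply (nb_mode s (fsub (z (clamp 0 T y)) (z (clamp 0 T x)))). apply nb_of_Hs; [|lra].
    assert (N1 := nb_of_Hs _ _ _ (Hin _ Hx) (Rle_refl _)).
    assert (N2 := nb_of_Hs _ _ _ (Hin _ Hy') (Rle_refl _)).
    exact (proj1 (Hs_of_nb _ _ _ (nb_minus _ _ _ _ _ N2 N1))). }
  split; intros x; apply continuity_pt_filterlim; intros eps He; destruct (E x eps He) as [d [Hd H]];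
    exists d; (split; [exact Hd|]); intros y [_ Hy]; unfold dist in *; simpl in *; unfold R_dist in *;
    specialize (H y Hy); (eapply Rle_lt_trans; [|exact H]).
  - apply (Rabs_Re_le (Cminus (z (clamp 0 T y) k) (z (clamp 0 T x) k))).
  - apply (Rabs_Im_le (Cminus (z (clamp 0 T y) k) (z (clamp 0 T x) k))).
Qed.

(** Meant for the zero mode, where dispersion and nonlinearity vanish and the solution is affine in
    time. *)
Lemma cder_zero_const (F : R -> C) t0 t1 c : t0 <= t1 -> ccont t0 t1 F ->
  (forall t, t0 < t < t1 -> cder F t c) -> F t1 = Cplus (F t0) (Cmult c (RtoC (t1 - t0))).
Proof.
  intros [Ht| <-] [HC1 HC2] HD.
  2:{ replace (t0 - t0) with 0 by ring. ring. }
  assert (G : forall (f : R -> R) l, rcont t0 t1 f -> (forall t, t0 < t < t1 -> is_derive f t l) ->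
    f t1 = f t0 + l * (t1 - t0)).
  { intros f l Hc Hd.
    assert (H1 := mvt_le f (fun _ => l) t0 t1 l Ht Hd Hc ltac:(intros; lra)).
    assert (H2 := mvt_le (fun s => - f s) (fun _ => - l) t0 t1 (- l) Ht
      (fun t Htt => is_derive_opp f t l (Hd t Htt)) (rcont_opp _ _ _ Hc) ltac:(intros; lra)). lra. }
  assert (E1 := G _ (Re c) HC1 (fun t Htt => proj1 (HD t Htt))).
  assert (E2 := G _ (Im c) HC2 (fun t Htt => proj2 (HD t Htt))).
  unfold Re, Im in E1, E2. cbv beta in E1, E2.
  apply injective_projections; unfold Cplus, Cmult, RtoC; simpl; [rewrite E1|rewrite E2]; ring.
Qed.

(** For [sg = 1] this is the variable [u] in a frame rotating from [t0] on. The opposite half wave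
    [sg = -1] allows [x] to be recovered before reality is known. Mode zero is excluded since
    [bsym 0 = 0]. *)
Definition hw (sg t0 : R) (x xt : R -> Fc) (t : R) : Fc := fun k =>
  if Z.eq_dec k 0 then RtoC 0 else
  Cmult (cexpi (- (sg * bsym k) * t + sg * bsym k * t0))
        (Cminus (x t k) (Cmult (Cmult Ci (RtoC (/ (sg * bsym k)))) (xt t k))).

Definition wave_eq (x xt Rh : R -> Fc) (t : R) : Prop := forall k,
  cder (fun s => x s k) t (xt t k) /\
  cder (fun s => xt s k) t (Cminus (Cmult (RtoC (- bsym k ^ 2)) (x t k))
                                   (Cmult (RtoC (IZR k ^ 2)) (Rh t k))).

Definition hw_der (sg t0 : R) (Rh : R -> Fc) (t : R) : Fc := fun k =>
  Cmult (Cmult Ci (RtoC (- (sg * Bs k)))) (Cmult (cexpi (- (sg * bsym k) * (t - t0))) (Rh t k)).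

Lemma cder_hw sg t0 x xt Rh t k : sg = 1 \/ sg = -1 -> wave_eq x xt Rh t ->
  cder (fun s => hw sg t0 x xt s k) t (hw_der sg t0 Rh t k).
Proof.
  intros Hs Hw. unfold hw, hw_der, Bs. destruct (Z.eq_dec k 0) as [_|Hk].
  - eapply cder_eq; [apply cder_const|]. replace (- (sg * 0)) with 0 by ring. ring.
  - assert (Hb := bsym_ge1 k Hk). destruct (Hw k) as [H1 H2].
    eapply cder_eq.
    + apply (half_wave (sg * bsym k) (IZR k ^ 2) (fun s => x s k) (fun s => xt s k) (fun s => Rh s k)).
      * destruct Hs as [-> | ->]; lra.
      * exact H1.
      * replace ((sg * bsym k) ^ 2) with (bsym k ^ 2) by (destruct Hs as [-> | ->]; ring). exact H2.
    + cbv beta. do 3 f_equal. destruct Hs as [-> | ->]; field; lra.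
Qed.

Lemma hw_der_nb r sg t0 Rh t K : sg = 1 \/ sg = -1 -> nb r (Rh t) K -> nb r (hw_der sg t0 Rh t) K.
Proof.
  intros Hs. apply nb_le. intros k. unfold hw_der.
  rewrite !Cmod_mult, Cmod_Ci, Cmod_cexpi, Cmod_R, Rabs_Ropp, Rabs_mult.
  assert (H := Rabs_Bs k). assert (H1 := Cmod_ge_0 (Rh t k)).
  replace (Rabs sg) with 1 by (destruct Hs as [-> | ->]; unfold Rabs; destruct (Rcase_abs _); lra). nra.
Qed.

Lemma ccont_hw sg t0 a b x xt k : ccont a b (fun s => x s k) -> ccont a b (fun s => xt s k) ->
  ccont a b (fun s => hw sg t0 x xt s k).
Proof.
  intros H1 H2. unfold hw. destruct (Z.eq_dec k 0); [apply ccont_const|].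
  apply ccont_mult.
  - apply ccont_cder. intros y. eexists. apply cder_cexpi.
  - apply ccont_minus; auto. apply ccont_mult; auto. apply ccont_const.
Qed.

Lemma hw_nb r sg t0 t1 x xt Rh K : sg = 1 \/ sg = -1 -> 0 <= K -> t0 <= t1 ->
  (forall t, t0 < t < t1 -> wave_eq x xt Rh t) ->
  (forall k, ccont t0 t1 (fun s => x s k)) -> (forall k, ccont t0 t1 (fun s => xt s k)) ->
  (forall t, t0 < t < t1 -> nb r (Rh t) K) ->
  nb r (fsub (hw sg t0 x xt t1) (hw sg t0 x xt t0)) (K * (t1 - t0)).
Proof.
  intros Hs HK Ht Hw Hx Hxt HR.
  apply (mvt_nb r (hw sg t0 x xt) (hw_der sg t0 Rh)); auto.
  - intros k t Htt. apply cder_hw; auto.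
  - intros k. now apply ccont_hw.
  - intros t Htt. apply hw_der_nb; auto.
Qed.

Lemma nb_zero r f : nb r f 0 -> forall k, f k = RtoC 0.
Proof.
  intros H k. apply (nb_mode _ _ _ k) in H. assert (W := wt_pos r k).
  apply Cmod_eq_0. assert (P := Cmod_ge_0 (f k)).
  destruct P as [P|P]; auto. assert (0 < wt r k * Cmod (f k)) by now apply Rmult_lt_0_compat. lra.
Qed.

Lemma zero_nb r f : (forall k, f k = RtoC 0) -> nb r f 0.
Proof.
  intros H. split; [lra|]. intros L HL.
  rewrite (lsum_ext _ (fun _ => 0)) by (intros k _; rewrite H, Cmod_0; ring).
  rewrite lsum_zero. lra.
Qed.

Lemma hw_recover sg t0 x xt t k : sg = 1 \/ sg = -1 -> (k <> 0)%Z ->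
  Cmult (cexpi (sg * bsym k * (t - t0))) (hw sg t0 x xt t k)
  = Cminus (x t k) (Cmult (Cmult Ci (RtoC (/ (sg * bsym k)))) (xt t k)).
Proof.
  intros Hs Hk. unfold hw. destruct (Z.eq_dec k 0); [contradiction|].
  rewrite Cmult_assoc, <- cexpi_plus.
  replace (sg * bsym k * (t - t0) + (- (sg * bsym k) * t + sg * bsym k * t0)) with 0 by ring.
  rewrite cexpi_0. ring.
Qed.

(** The two half waves contain [xt] with opposite signs, so it cancels in their mean. *)
Lemma hw_sum t0 x xt t k : (k <> 0)%Z ->
  x t k = Cmult (RtoC (/ 2)) (Cplus (Cmult (cexpi (1 * bsym k * (t - t0))) (hw 1 t0 x xt t k))
                                    (Cmult (cexpi (-1 * bsym k * (t - t0))) (hw (-1) t0 x xt t k))).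
Proof.
  intros Hk. rewrite !hw_recover by auto. assert (Hb := bsym_ge1 k Hk).
  replace (/ (-1 * bsym k)) with (- / (1 * bsym k)) by (field; lra).
  rewrite RtoC_opp, RtoC_half. field.
Qed.

Lemma real_valued_Im f k : real_valued f -> k = 0%Z -> f k = RtoC (Re (f k)).
Proof.
  intros H ->. assert (E := H 0%Z). simpl in E. destruct (f 0%Z) as [x y].
  unfold Cconj in E; simpl in E. injection E. intros E2. unfold RtoC, Re; simpl. f_equal. lra.
Qed.

Section Solution.

Variables (r s T M Cb : R) (phi0 psi0 : Fc) (z zt : R -> Fc).
Hypothesis Hr : 1 <= r.
Hypothesis Hrs : r <= s.
Hypothesis HT : 0 < T.
Hypothesis HC : stab_const r Cb.
Hypothesis Rphi : real_valued phi0.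
Hypothesis Rpsi : real_valued psi0.
Hypothesis Hsol : boussinesq_sol T phi0 psi0 z zt.
Hypothesis Hcz : cont_Hs s T z.
Hypothesis Hczt : cont_Hs (s - 2) T zt.
Hypothesis Hz : forall t, 0 <= t <= T -> nb s (z t) M.
Hypothesis Hzt : forall t, 0 <= t <= T -> nb (s - 2) (zt t) M.

Lemma bsym_sqr k : bsym k ^ 2 = IZR k ^ 4 + IZR k ^ 2.
Proof.
  unfold bsym. rewrite pow2_sqrt; [ring|]. assert (H := pow2_ge_0 (IZR k)).
  replace (IZR k ^ 4) with ((IZR k ^ 2) ^ 2) by ring. assert (H1 := pow2_ge_0 (IZR k ^ 2)). lra.
Qed.

Lemma sol_wave t : 0 < t < T -> wave_eq z zt (fun t => fsq (z t)) t.
Proof.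
  intros Ht k. destruct Hsol as (_ & _ & H). destruct (H k t Ht) as (H1 & H2 & H3 & H4).
  split; split; auto; rewrite bsym_sqr; assumption.
Qed.

Lemma sol_ccont k : ccont 0 T (fun t => z t k).
Proof. apply ccont_cont_Hs with s; auto. lra. Qed.

Lemma sol_ccont_t k : ccont 0 T (fun t => zt t k).
Proof. apply ccont_cont_Hs with (s - 2); auto. lra. Qed.

Lemma Hz_r t : 0 <= t <= T -> nb r (z t) M.
Proof. intros Ht. apply nb_index with s; auto. Qed.

Lemma sol_M0 : 0 <= M.
Proof. apply (nb_pos s (z 0)). apply Hz. lra. Qed.

Lemma Cb_pos : 0 < Cb.
Proof. apply HC. Qed.

Lemma zt_mode0 t : 0 <= t <= T -> zt t 0%Z = RtoC (mean_a psi0).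
Proof.
  intros Ht. destruct Hsol as (_ & E & _).
  rewrite (cder_zero_const (fun t => zt t 0%Z) 0 t (RtoC 0)).
  - rewrite E. unfold mean_a. rewrite <- real_valued_Im by auto. ring.
  - lra.
  - apply ccont_restrict with 0 T; try lra. apply sol_ccont_t.
  - intros u Hu. destruct (sol_wave u ltac:(lra) 0%Z) as [_ H].
    eapply cder_eq; [exact H|]. unfold bsym. simpl.
    replace (0 * (0 * 1) + 0 * (0 * (0 * (0 * 1)))) with 0 by ring. rewrite sqrt_0.
    replace (- (0 * (0 * 1))) with 0 by ring. replace (0 * (0 * 1)) with 0 by ring. ring.
Qed.

Lemma z_mode0 t : 0 <= t <= T -> z t 0%Z = RtoC (mean_a psi0 * t + mean_b phi0).
Proof.
  intros Ht. destruct Hsol as (E & _ & _).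
  rewrite (cder_zero_const (fun t => z t 0%Z) 0 t (RtoC (mean_a psi0))).
  - rewrite E. unfold mean_b. rewrite (real_valued_Im phi0 0%Z) by auto. unfold Re at 2 3. simpl.
    rewrite <- RtoC_mult, <- RtoC_plus. f_equal. unfold Re. ring.
  - lra.
  - apply ccont_restrict with 0 T; try lra. apply sol_ccont.
  - intros u Hu. destruct (sol_wave u ltac:(lra) 0%Z) as [H _].
    rewrite <- (zt_mode0 u) by lra. exact H.
Qed.

(** * The solution stays real-valued *)

Let q (t : R) : Fc := fsub (fconj (z t)) (z t).
Let qt (t : R) : Fc := fsub (fconj (zt t)) (zt t).
Let Rq (t : R) : Fc := fsub (fsq (fconj (z t))) (fsq (z t)).

Lemma bsym_opp k : bsym (- k) = bsym k.
Proof. unfold bsym. f_equal. rewrite opp_IZR. ring. Qed.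

(** The coefficients are real and even in [k], so conjugation maps solutions to solutions; the
    difference is forced by the difference of the squares, which is bounded by a multiple of [q]. *)
Lemma q_wave t : 0 < t < T -> wave_eq q qt Rq t.
Proof.
  intros Ht k. destruct (sol_wave t Ht k) as [H1 H2]. destruct (sol_wave t Ht (- k)%Z) as [H3 H4].
  split.
  - apply (cder_minus (fun s => Cconj (z s (- k)%Z)) (fun s => z s k)); auto.
    apply (cder_conj (fun s => z s (- k)%Z)). exact H3.
  - eapply cder_eq.
    + apply (cder_minus (fun s => Cconj (zt s (- k)%Z)) (fun s => zt s k)); [|exact H2].
      apply (cder_conj (fun s => zt s (- k)%Z)). exact H4.
    + unfold Rq, q, fsub. rewrite <- (fconj_fsq r Cb (z t) M) by (auto; apply Hz_r; lra).
      unfold fconj. rewrite bsym_opp, opp_IZR.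
      replace ((- IZR k) ^ 2) with (IZR k ^ 2) by ring.
      rewrite Cminus_conj, !Cmult_conj.
      assert (RC : forall x, Cconj (RtoC x) = RtoC x) by (intros; unfold Cconj, RtoC; simpl; f_equal; ring).
      rewrite !RC. ring.
Qed.

Lemma q_ccont a b k : 0 <= a -> a <= b -> b <= T -> ccont a b (fun t => q t k).
Proof.
  intros. apply ccont_restrict with 0 T; auto. unfold q, fsub.
  apply ccont_minus; [|apply sol_ccont]. apply (ccont_conj 0 T (fun t => z t (- k)%Z)). apply sol_ccont.
Qed.

Lemma qt_ccont a b k : 0 <= a -> a <= b -> b <= T -> ccont a b (fun t => qt t k).
Proof.
  intros. apply ccont_restrict with 0 T; auto. unfold qt, fsub.
  apply ccont_minus; [|apply sol_ccont_t]. apply (ccont_conj 0 T (fun t => zt t (- k)%Z)). apply sol_ccont_t.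
Qed.

Lemma q_mode0 t : 0 <= t <= T -> q t 0%Z = RtoC 0 /\ qt t 0%Z = RtoC 0.
Proof.
  intros Ht. unfold q, qt, fsub, fconj. simpl. rewrite (z_mode0 t Ht), (zt_mode0 t Ht).
  split; unfold Cconj, Cminus, Cplus, Copp, RtoC; simpl; f_equal; ring.
Qed.

Lemma q_hw sg t0 t1 S : sg = 1 \/ sg = -1 -> 0 <= t0 -> t0 <= t1 -> t1 <= T ->
  (forall k, q t0 k = RtoC 0) -> (forall k, qt t0 k = RtoC 0) ->
  (forall t, t0 <= t <= t1 -> nb r (q t) S) ->
  nb r (hw sg t0 q qt t1) (4 * Cb * M * S * (t1 - t0)).
Proof.
  intros Hs H0 H1 H2 Z1 Z2 HS.
  assert (S0 : 0 <= S) by (eapply nb_pos; apply (HS t0); lra).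
  assert (P := Cb_pos). assert (PM := sol_M0).
  apply nb_ext with (fsub (hw sg t0 q qt t1) (hw sg t0 q qt t0)).
  - intros k. unfold fsub, hw at 3. destruct (Z.eq_dec k 0).
    + ring.
    + rewrite Z1, Z2. ring.
  - apply hw_nb with Rq; auto.
    + repeat apply Rmult_le_pos; lra.
    + intros t Ht. apply q_wave. lra.
    + intros k. apply q_ccont; lra.
    + intros k. apply qt_ccont; lra.
    + intros t Ht. unfold Rq.
      apply (fsq_diff r Cb (fconj (z t)) (z t) M S HC); [apply nb_conj|..];
        [apply Hz_r; lra|apply Hz_r; lra|apply (HS t); lra].
Qed.

(** A Picard contraction: for [8 Cb M (t1 - t0) <= 1] both half waves are bounded by
    [4 Cb M S (t - t0) <= S / 2], and [q] is their mean after rotation. *)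
Lemma q_contract t0 t1 S : 0 <= t0 -> t0 <= t1 -> t1 <= T -> (8 * Cb * M) * (t1 - t0) <= 1 ->
  (forall k, q t0 k = RtoC 0) -> (forall k, qt t0 k = RtoC 0) ->
  (forall t, t0 <= t <= t1 -> nb r (q t) S) ->
  (forall t, t0 <= t <= t1 -> nb r (q t) (S / 2)).
Proof.
  intros H0 H1 H2 Hh Z1 Z2 HS t Ht.
  assert (S0 : 0 <= S) by (eapply nb_pos; apply (HS t0); lra).
  assert (P := Cb_pos). assert (PM := sol_M0).
  assert (E : forall sg, sg = 1 \/ sg = -1 -> nb r (hw sg t0 q qt t) (S / 2)).
  { intros sg Hs. apply nb_mono with (4 * Cb * M * S * (t - t0)).
    - assert (0 <= 8 * Cb * M) by (repeat apply Rmult_le_pos; lra).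
      assert (8 * Cb * M * (t - t0) <= 8 * Cb * M * (t1 - t0)) by (apply Rmult_le_compat_l; lra).
      replace (4 * Cb * M * S * (t - t0)) with (8 * Cb * M * (t - t0) * (S / 2)) by field.
      rewrite <- (Rmult_1_l (S / 2)) at 2. apply Rmult_le_compat_r; lra.
    - apply q_hw; auto; try lra. intros u Hu. apply HS. lra. }
  assert (E1 := nb_unimod r _ _ (fun k => 1 * bsym k * (t - t0)) (E 1 (or_introl eq_refl))).
  assert (E2 := nb_unimod r _ _ (fun k => -1 * bsym k * (t - t0)) (E (-1) (or_intror eq_refl))).
  assert (E3 := nb_scal r _ (RtoC (/ 2)) _ (nb_plus _ _ _ _ _ E1 E2)).
  rewrite Cmod_R, Rabs_right in E3 by lra.
  replace (/ 2 * (S / 2 + S / 2)) with (S / 2) in E3 by field.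
  revert E3. apply nb_le. intros k. destruct (Z.eq_dec k 0) as [->|Hk].
  - rewrite (proj1 (q_mode0 t ltac:(lra))), Cmod_0. apply Cmod_ge_0.
  - rewrite (hw_sum t0 q qt t k Hk). unfold fscal, fadd. lra.
Qed.

Lemma nb_geom_zero f A : 0 <= A -> (forall n, nb r f (A / 2 ^ n)) -> nb r f 0.
Proof.
  intros HA H. apply zero_nb. intros k. apply Cmod_eq_0.
  assert (W := wt_pos r k). assert (P := Cmod_ge_0 (f k)).
  assert (L : is_lim_seq (fun n => A * (/ 2) ^ n) (A * 0)).
  { apply (is_lim_seq_scal_l _ A 0). apply is_lim_seq_geom. rewrite Rabs_right; lra. }
  assert (Le : Rbar_le (wt r k * Cmod (f k)) (A * 0)).
  { apply (is_lim_seq_le (fun _ => wt r k * Cmod (f k)) (fun n => A * (/ 2) ^ n)); auto.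
    - intros n. rewrite pow_inv. apply (nb_mode r f (A / 2 ^ n) k). apply H.
    - apply is_lim_seq_const. }
  simpl in Le. destruct P as [P|P]; auto.
  assert (0 < wt r k * Cmod (f k)) by now apply Rmult_lt_0_compat. lra.
Qed.

(** Repeated halving of the a priori bound [2 M] forces [q = 0]. The half wave then vanishes as
    well, and with [q = 0] it is a nonzero multiple of [qt]. *)
Lemma q_vanish_step t0 t1 : 0 <= t0 -> t0 <= t1 -> t1 <= T -> (8 * Cb * M) * (t1 - t0) <= 1 ->
  (forall k, q t0 k = RtoC 0) -> (forall k, qt t0 k = RtoC 0) ->
  forall k, q t1 k = RtoC 0 /\ qt t1 k = RtoC 0.
Proof.
  intros H0 H1 H2 Hh Z1 Z2. assert (PM := sol_M0).
  assert (E : forall n t, t0 <= t <= t1 -> nb r (q t) (2 * M / 2 ^ n)).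
  { induction n as [|n IH]; intros t Ht.
    - replace (2 * M / 2 ^ 0) with (M + M) by (simpl; field).
      apply nb_minus; [apply nb_conj|]; apply Hz_r; lra.
    - replace (2 * M / 2 ^ S n) with (2 * M / 2 ^ n / 2) by (simpl; field; apply pow_nonzero; lra).
      revert t Ht. apply q_contract; auto. }
  assert (Q : forall t, t0 <= t <= t1 -> nb r (q t) 0).
  { intros t Ht. apply nb_geom_zero with (2 * M); [lra|]. intros n. now apply E. }
  assert (W := q_hw 1 t0 t1 0 (or_introl eq_refl) H0 H1 H2 Z1 Z2 Q).
  replace (4 * Cb * M * 0 * (t1 - t0)) with 0 in W by ring.
  intros k. assert (Qk := nb_zero r _ (Q t1 ltac:(lra)) k). split; auto.
  destruct (Z.eq_dec k 0) as [->|Hk]; [apply q_mode0; lra|].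
  assert (Wk := nb_zero r _ W k).
  assert (Rk := hw_recover 1 t0 q qt t1 k (or_introl eq_refl) Hk).
  rewrite Wk, Qk, Cmult_0_r in Rk.
  assert (Hb := bsym_ge1 k Hk). rewrite Rmult_1_l in Rk.
  assert (Hb' : RtoC (/ bsym k) <> RtoC 0) by (apply RtoC_neq0, Rinv_neq_0_compat; lra).
  assert (Hm := Cmult_neq_0 _ _ Ci_neq0 Hb').
  assert (Rk' : Cmult (Cmult Ci (RtoC (/ bsym k))) (qt t1 k) = RtoC 0) by (rewrite <- Copp_0, Rk; ring).
  destruct (Ceq_dec (qt t1 k) (RtoC 0)) as [|N]; auto.
  destruct (Cmult_neq_0 _ _ Hm N Rk').
Qed.

Lemma q_vanish t : 0 <= t <= T -> forall k, q t k = RtoC 0 /\ qt t k = RtoC 0.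
Proof.
  assert (P := Cb_pos). assert (PM := sol_M0).
  assert (Pm : 0 <= 8 * Cb * M) by (repeat apply Rmult_le_pos; lra).
  (* The [+ 1] keeps the denominator away from zero when [M = 0]. *)
  set (h := / (8 * Cb * M + 1)).
  assert (Ph : 0 < h) by (apply Rinv_0_lt_compat; lra).
  assert (Eh : (8 * Cb * M) * h <= 1).
  { unfold h. apply Rmult_le_reg_r with (8 * Cb * M + 1); [lra|].
    rewrite Rmult_assoc, Rinv_l by lra. lra. }
  assert (G : forall n t, 0 <= t <= T -> t <= INR n * h -> forall k, q t k = RtoC 0 /\ qt t k = RtoC 0).
  { induction n as [|n IH]; intros u Hu Hn k.
    - simpl in Hn. replace u with 0 by lra. destruct Hsol as (E1 & E2 & _).
      unfold q, qt, fsub, fconj. rewrite E1, E2, Rphi, Rpsi.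
      assert (CC : forall c, Cconj (Cconj c) = c).
      { intros [x y]. unfold Cconj; simpl. f_equal. ring. }
      rewrite !CC. unfold Cminus. rewrite !Cplus_opp_r. auto.
    - destruct (Rle_dec u (INR n * h)) as [H|H]; [now apply IH|].
      assert (P0 : 0 <= INR n * h) by (apply Rmult_le_pos; [apply pos_INR|lra]).
      rewrite S_INR in Hn.
      apply q_vanish_step with (INR n * h); try lra.
      + apply Rle_trans with ((8 * Cb * M) * h); auto. apply Rmult_le_compat_l; lra.
      + intros j. apply IH; lra.
      + intros j. apply IH; lra. }
  intros Ht. destruct (INR_unbounded (t / h)) as [n Hn]. apply (G n); auto.
  apply Rlt_le, Rlt_div_l; auto.
Qed.

Lemma sol_real t k : 0 <= t <= T ->
  Cconj (z t (- k)%Z) = z t k /\ Cconj (zt t (- k)%Z) = zt t k.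
Proof.
  intros Ht. destruct (q_vanish t Ht k) as [H1 H2].
  unfold q, qt, fsub, fconj in H1, H2.
  split.
  - replace (Cconj (z t (- k)%Z)) with (Cplus (Cminus (Cconj (z t (- k)%Z)) (z t k)) (z t k)) by ring.
    rewrite H1. ring.
  - replace (Cconj (zt t (- k)%Z)) with (Cplus (Cminus (Cconj (zt t (- k)%Z)) (zt t k)) (zt t k)) by ring.
    rewrite H2. ring.
Qed.

(** * The exact solution in the variable of the scheme *)

Let a := mean_a psi0.
Let b := mean_b phi0.

(** The exact counterpart of [u_n]. Subtracting the mean [a t + b] of [z] amounts to deleting mode
    zero, by [z_mode0]. *)
Definition Uex (t : R) : Fc := fun k => if Z.eq_dec k 0 then RtoC 0 else
  Cminus (z t k) (Cmult (Cmult Ci (RtoC (/ bsym k))) (zt t k)).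

Lemma Uex_hw t0 t k : Uex t k = Cmult (cexpi (bsym k * (t - t0))) (hw 1 t0 z zt t k).
Proof.
  unfold Uex. destruct (Z.eq_dec k 0) as [->|Hk].
  - unfold hw. simpl. ring.
  - replace (bsym k * (t - t0)) with (1 * bsym k * (t - t0)) by ring.
    rewrite hw_recover by auto. now rewrite Rmult_1_l.
Qed.

Lemma hw_self t k : hw 1 t z zt t k = Uex t k.
Proof.
  rewrite (Uex_hw t). replace (bsym k * (t - t)) with 0 by ring. rewrite cexpi_0. ring.
Qed.

Lemma Uex_0 k : Uex 0 k = u0 phi0 psi0 k.
Proof.
  destruct Hsol as (E1 & E2 & _). unfold Uex, u0, fsub, fscal, bracket_inv, Defs.mult, fconst.
  rewrite E1, E2. destruct (Z.eq_dec k 0) as [->|Hk].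
  - unfold mean_b. rewrite <- real_valued_Im by auto. ring.
  - ring.
Qed.

Lemma Cconj_R x : Cconj (RtoC x) = RtoC x.
Proof. unfold Cconj, RtoC; simpl; f_equal; ring. Qed.

Lemma Cconj_Ci : Cconj Ci = Copp Ci.
Proof. unfold Cconj, Ci, Copp; simpl; f_equal; ring. Qed.

(** Reality turns conjugation into a sign change in front of [zt], so that [z] and [zt] are both
    recovered from [Uex] and its conjugate. *)
Lemma Uex_conj t k : 0 <= t <= T -> fconj (Uex t) k = if Z.eq_dec k 0 then RtoC 0 else
  Cplus (z t k) (Cmult (Cmult Ci (RtoC (/ bsym k))) (zt t k)).
Proof.
  intros Ht. unfold fconj, Uex. destruct (sol_real t k Ht) as [H1 H2].
  destruct (Z.eq_dec (- k) 0), (Z.eq_dec k 0); try lia; [apply Cconj_R|].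
  rewrite Cminus_conj, !Cmult_conj, Cconj_R, Cconj_Ci, H1, H2, bsym_opp. ring.
Qed.

Lemma Uex_zap t k : 0 <= t <= T -> zap (a * t + b) (Uex t) k = z t k.
Proof.
  intros Ht. unfold zap, fadd, fscal, fconst. rewrite Uex_conj by assumption.
  unfold Uex. destruct (Z.eq_dec k 0) as [->|Hk].
  - rewrite z_mode0 by assumption. fold a b. ring.
  - rewrite RtoC_half. field.
Qed.

Lemma Uex_zt t k : 0 <= t <= T ->
  fadd (fscal (ci (/ 2)) (bracket (fsub (Uex t) (fconj (Uex t))))) (fconst (RtoC a)) k = zt t k.
Proof.
  intros Ht. unfold fadd, fscal, fconst, bracket, Defs.mult, fsub. rewrite Uex_conj by assumption.
  unfold Uex. destruct (Z.eq_dec k 0) as [->|Hk].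
  - rewrite zt_mode0 by assumption. fold a. ring.
  - assert (Hb := bsym_ge1 k Hk). rewrite RtoC_inv by lra. unfold ci. rewrite RtoC_half.
    assert (Hb' : RtoC (bsym k) <> RtoC 0) by (apply RtoC_neq0; lra).
    generalize Ci2. intros HI. field [HI]. auto using C2_neq0.
Qed.

(** One [M] from [z] and [2 M] from [zt], because [jj k <= 2 bsym k] off the zero mode. *)
Lemma Uex_nb t : 0 <= t <= T -> nb s (Uex t) (3 * M).
Proof.
  intros Ht. assert (PM := sol_M0).
  assert (H1 : nb s (Defs.mult (fun k => if Z.eq_dec k 0 then RtoC 0 else RtoC 1) (z t)) (1 * M)).
  { apply nb_mult_le; auto; [lra|]. intros k. destruct (Z.eq_dec k 0); [rewrite Cmod_0|rewrite Cmod_1]; lra. }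
  assert (H2 : nb s (Defs.mult (fun k => if Z.eq_dec k 0 then RtoC 0 else Cmult Ci (RtoC (/ bsym k))) (zt t)) (2 * M)).
  { apply nb_mult with (s - 2); auto; [lra|]. intros k. assert (W := wt_pos (s - 2) k).
    destruct (Z.eq_dec k 0) as [_|Hk]; [rewrite Cmod_0; lra|].
    assert (Hb := bsym_ge1 k Hk). assert (Hb2 := bsym_bounds k).
    rewrite Cmod_mult, Cmod_Ci, Cmod_R, Rabs_right by (apply Rle_ge, Rlt_le, Rinv_0_lt_compat; lra).
    rewrite <- wt_shift. assert (E : jj k <= 2 * bsym k).
    { assert (1 <= IZR k ^ 2); [|unfold jj; lra].
      rewrite <- pow2_abs. apply pow_R1_Rle. now apply Rabs_IZR_ge1. }
    apply Rmult_le_reg_r with (bsym k); [lra|].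
    replace (wt (s - 2) k * jj k * (1 * / bsym k) * bsym k) with (wt (s - 2) k * jj k) by (field; lra). nra. }
  assert (H := nb_minus _ _ _ _ _ H1 H2). replace (1 * M + 2 * M) with (3 * M) in H by ring.
  revert H. apply nb_ext. intros k. unfold Uex, fsub, Defs.mult. destruct (Z.eq_dec k 0); ring.
Qed.

Lemma Uex_mode0 t : Uex t 0%Z = RtoC 0.
Proof. reflexivity. Qed.

Lemma mean_a_le : Rabs a <= M.
Proof.
  rewrite <- Cmod_R. unfold a. rewrite <- (zt_mode0 0) by lra.
  apply (nb_mode0 (s - 2)). apply Hzt. lra.
Qed.

Lemma mean_le t : 0 <= t <= T -> Rabs (a * t + b) <= M.
Proof.
  intros Ht. rewrite <- Cmod_R. unfold a, b. rewrite <- (z_mode0 t) by lra.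
  apply (nb_mode0 s). now apply Hz.
Qed.

Lemma fsq_sol t : 0 <= t <= T -> nb r (fsq (z t)) (2 * Cb * M * M).
Proof. intros Ht. apply (fmul_bound r Cb (z t) (z t) M M); auto; now apply Hz_r. Qed.

Lemma hw_sol t0 t1 : 0 <= t0 -> t0 <= t1 -> t1 <= T ->
  nb r (fsub (hw 1 t0 z zt t1) (hw 1 t0 z zt t0)) (2 * Cb * M * M * (t1 - t0)).
Proof.
  intros H0 H1 H2. assert (P := Cb_pos). assert (PM := sol_M0).
  apply hw_nb with (fun t => fsq (z t)); auto.
  - repeat apply Rmult_le_pos; lra.
  - intros t Ht. apply sol_wave. lra.
  - intros k. apply ccont_restrict with 0 T; auto. apply sol_ccont.
  - intros k. apply ccont_restrict with 0 T; auto. apply sol_ccont_t.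
  - intros t Ht. apply fsq_sol. lra.
Qed.

Lemma nb_zap_diff g g' c c' d e : nb r (fsub g g') d -> Rabs (c - c') <= e ->
  nb r (fsub (zap c g) (zap c' g')) (d + e).
Proof.
  intros Hd He.
  assert (H := nb_plus _ _ _ _ _ (nb_scal _ _ (RtoC (/ 2)) _ (nb_plus _ _ _ _ _ Hd (nb_conj _ _ _ Hd)))
    (nb_const r (RtoC (c - c')))).
  rewrite !Cmod_R, (Rabs_right (/ 2)) in H by lra.
  apply nb_mono with (/ 2 * (d + d) + Rabs (c - c')); [lra|].
  revert H. apply nb_ext. intros k. unfold fsub at 1, zap, fadd, fscal. rewrite fconj_sub.
  unfold fsub, fconst. destruct (Z.eq_dec k 0).
  - unfold Rminus. rewrite RtoC_plus, RtoC_opp. ring.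
  - ring.
Qed.

Lemma nb_zap g c A e : nb r g A -> Rabs c <= e -> nb r (zap c g) (A + e).
Proof.
  intros Hg He.
  assert (H := nb_plus _ _ _ _ _ (nb_scal _ _ (RtoC (/ 2)) _ (nb_plus _ _ _ _ _ Hg (nb_conj _ _ _ Hg)))
    (nb_const r (RtoC c))).
  rewrite !Cmod_R, (Rabs_right (/ 2)) in H by lra. revert H. apply nb_mono. lra.
Qed.

(** * Local error *)

Variables (s0 Ce : R).
Hypothesis Hs0 : s0 <= s.
Hypothesis HCe : 0 < Ce /\ forall m mu f g A B, 0 <= mu ->
    (forall j l, Cmod (m j l) <= mu * errD j l) -> nb s0 f A -> nb s0 g B ->
    nb r (Bil m f g) (Ce * mu * A * B) /\ forall k, ab m f g k.

(** The summands account, in this order, for [k^2] instead of [bsym k] in the phase, for the squares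
    of [z] and of its frozen approximation, and for [err], where [110 * 9 / 4 <= 1000]. *)
Definition K0 : R := 2 * Cb * M * M + 4 * Cb * (4 * M) * (2 * Cb * M * M + 4 * M + 1) + 1000 * Ce * M * M.
(** [K0] plus the cost of truncation: [tau^2] once directly, and once more through the Lipschitz
    bound of [Psi1_stable]. *)
Definition K1 : R := K0 + 2 + 27 * Cb * (3 * M) + 2 * M.

Lemma K0_pos : 0 <= K0.
Proof.
  assert (P := Cb_pos). assert (PM := sol_M0). destruct HCe as [PCe _]. unfold K0.
  repeat apply Rplus_le_le_0_compat; repeat apply Rmult_le_pos; try lra.
  repeat apply Rplus_le_le_0_compat; repeat apply Rmult_le_pos; lra.
Qed.

Lemma K1_pos : 0 <= K1.
Proof.
  assert (P := Cb_pos). assert (PM := sol_M0). assert (PK := K0_pos). unfold K1.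
  assert (0 <= 27 * Cb * (3 * M)) by (repeat apply Rmult_le_pos; lra). lra.
Qed.

Lemma Uex_r t : 0 <= t <= T -> nb r (Uex t) (3 * M).
Proof. intros Ht. apply nb_index with s; auto. now apply Uex_nb. Qed.

(** Three contributions: the nonlinear drift over the time [t - t0], the change of propagator with
    [|bsym k - k^2| <= 1], and the truncation error [d]. *)
Lemma Uex_twist t0 t fJ d : 0 <= t0 -> t0 <= t -> t <= T -> nb r (fsub (Uex t0) fJ) d ->
  nb r (fsub (Uex t) (twist (t - t0) fJ)) (2 * Cb * M * M * (t - t0) + 3 * M * (t - t0) + d).
Proof.
  intros H0 H1 H2 Hd.
  assert (E1 := nb_unimod r _ _ (fun k => bsym k * (t - t0)) (hw_sol t0 t H0 H1 H2)).
  assert (E2 : nb r (fun k => Cmult (Cminus (cexpi (bsym k * (t - t0))) (Sg (- (t - t0)) k)) (Uex t0 k))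
    ((t - t0) * (3 * M))).
  { apply nb_mult_le; [lra| |apply Uex_r; lra]. intros k. unfold Sg.
    eapply Rle_trans; [apply Cmod_cexpi_minus|].
    replace (bsym k * (t - t0) - - - (t - t0) * IZR k ^ 2) with ((t - t0) * (bsym k - IZR k ^ 2)) by ring.
    assert (Hb := bsym_bounds k). rewrite Rabs_right; [nra|apply Rle_ge, Rmult_le_pos; lra]. }
  assert (E3 := nb_twist r (t - t0) _ _ Hd).
  assert (E := nb_plus _ _ _ _ _ (nb_plus _ _ _ _ _ E1 E2) E3).
  replace (3 * M * (t - t0)) with ((t - t0) * (3 * M)) by ring.
  revert E. apply nb_ext. intros k. unfold fadd, fsub, twist, Defs.mult.
  rewrite hw_self, (Uex_hw t0 t). ring.
Qed.

Lemma local_der t0 t tau fJ : 0 <= t0 -> t0 < t < t0 + tau -> t0 + tau <= T -> tau <= 1 ->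
  nb s0 fJ (3 * M) -> finsupp fJ -> fJ 0%Z = RtoC 0 -> nb r fJ (3 * M) -> nb r (fsub (Uex t0) fJ) (tau ^ 2) ->
  nb r (fun k => Cplus (hw_der 1 t0 (fun t => fsq (z t)) t k) (Cmult Ci (dInc (t - t0) (a * t0 + b) fJ k)))
    (K0 * tau).
Proof.
  intros H0 Ht HtT Htau HJ Jfin J0 HJr Hd. assert (P := Cb_pos). assert (PM := sol_M0).
  set (si := t - t0) in *. assert (Psi : 0 <= si <= tau) by (unfold si; lra).
  set (c := a * t0 + b) in *. set (Y := zap c (twist si fJ)).
  assert (PV : 0 <= 2 * Cb * M * M) by (repeat apply Rmult_le_pos; lra).
  assert (HN := fsq_sol t ltac:(lra)).
  assert (E1 : nb r (fun k => Cmult (Cminus (cexpi (- bsym k * si)) (Sg si k)) (fsq (z t) k))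
    (si * (2 * Cb * M * M))).
  { apply nb_mult_le; [lra| |exact HN]. intros k. unfold Sg.
    eapply Rle_trans; [apply Cmod_cexpi_minus|].
    replace (- bsym k * si - - si * IZR k ^ 2) with (- (si * (bsym k - IZR k ^ 2))) by ring.
    assert (Hb := bsym_bounds k). rewrite Rabs_Ropp, Rabs_right; [nra|apply Rle_ge, Rmult_le_pos; lra]. }
  assert (Hc : Rabs c <= M) by (apply mean_le; lra).
  assert (HY : nb r Y (4 * M)).
  { apply nb_mono with (3 * M + M); [lra|]. apply nb_zap; auto. now apply nb_twist. }
  assert (HzY : nb r (fsub (z t) Y) ((2 * Cb * M * M + 4 * M + 1) * tau)).
  { assert (H := nb_zap_diff (Uex t) (twist si fJ) (a * t + b) c _ (M * si) (Uex_twist t0 t fJ _ H0 ltac:(lra) ltac:(lra) Hd)).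
    apply nb_mono with (2 * Cb * M * M * si + 3 * M * si + tau ^ 2 + M * si).
    - assert (2 * Cb * M * M * si <= 2 * Cb * M * M * tau) by (apply Rmult_le_compat_l; lra).
      assert (M * si <= M * tau) by (apply Rmult_le_compat_l; lra).
      assert (tau ^ 2 <= tau) by nra. lra.
    - apply nb_ext with (fsub (zap (a * t + b) (Uex t)) Y).
      + intros k. unfold fsub. now rewrite Uex_zap by lra.
      + apply H. unfold c. replace (a * t + b - (a * t0 + b)) with (a * si) by (unfold si; ring).
        rewrite Rabs_mult, (Rabs_right si) by lra. apply Rmult_le_compat_r; [lra|apply mean_a_le]. }
  assert (HzA : nb r (z t) (4 * M)) by (apply nb_mono with M; [lra|apply Hz_r; lra]).
  assert (E2 := nb_unimod r _ _ (fun k => - si * IZR k ^ 2) (fsq_diff r Cb _ _ _ _ HC HzA HY HzY)).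
  destruct HCe as [PCe HCe'].
  destruct (HCe' (err si) (110 * si) _ _ _ _ ltac:(lra) (fun j l => err_bound si j l ltac:(lra))
    (nb_conj _ _ _ HJ) (nb_conj _ _ _ HJ)) as [E3 _].
  assert (E3' := nb_scal r _ (RtoC (/ 4)) _ E3). rewrite Cmod_R, Rabs_right in E3' by lra.
  assert (E := nb_plus _ _ _ _ _ (nb_plus _ _ _ _ _ E1 E2) E3').
  apply nb_mono with (si * (2 * Cb * M * M) + 4 * Cb * (4 * M) * ((2 * Cb * M * M + 4 * M + 1) * tau)
    + / 4 * (Ce * (110 * si) * (3 * M) * (3 * M))).
  - unfold K0. assert (si * (2 * Cb * M * M) <= tau * (2 * Cb * M * M)) by (apply Rmult_le_compat_r; lra).
    assert (Q : 0 <= Ce * M * M) by (repeat apply Rmult_le_pos; lra).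
    assert (si * (Ce * M * M) <= tau * (Ce * M * M)) by (apply Rmult_le_compat_r; lra).
    assert (0 <= tau * (Ce * M * M)) by (apply Rmult_le_pos; lra). lra.
  - revert E. apply nb_le. intros k. rewrite (dInc_err r Cb si c fJ (3 * M) k) by auto.
    fold Y. unfold hw_der. fold si. rewrite Rmult_1_l, RtoC_opp.
    set (X := fadd _ _ k).
    replace (Cplus _ _) with (Cmult (Copp (Cmult Ci (RtoC (Bs k)))) X).
    + rewrite Cmod_mult, Cmod_opp, Cmod_mult, Cmod_Ci, Cmod_R, Rmult_1_l.
      assert (HB := Rabs_Bs k). assert (HX := Cmod_ge_0 X). nra.
    + unfold X, fadd, fscal, fsub. fold (Sg si k). rewrite Rmult_1_l. ring.
Qed.

Lemma local_error t0 tau : 0 <= t0 -> 0 < tau -> t0 + tau <= T -> tau <= 1 ->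
  nb r (fsub (Uex (t0 + tau)) (Psi1 tau t0 a b (Uex t0))) (K1 * tau ^ 2).
Proof.
  intros H0 Htau HtT Htau1. assert (P := Cb_pos). assert (PM := sol_M0).
  assert (Pt2 : 0 < tau ^ 2) by now apply pow_lt.
  assert (PK0 := K0_pos).
  set (f := Uex t0). set (c := a * t0 + b).
  assert (Hf : nb r f (3 * M)) by (apply Uex_r; lra).
  (* The window [n] may depend on the solution and on [tau]: only the tolerance [tau^2] enters the
     final bound. *)
  destruct (trunc_close r f (3 * M) (tau ^ 2) Pt2 Hf) as [n Hn].
  set (fJ := trunc n f) in *.
  assert (HJ : nb r fJ (3 * M)) by now apply nb_trunc.
  assert (Jfin := finsupp_trunc n f). fold fJ in Jfin.
  assert (J0 : fJ 0%Z = RtoC 0) by now apply trunc_0.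
  assert (HJs : nb s0 fJ (3 * M)).
  { apply nb_trunc. apply nb_index with s; auto. apply Uex_nb. lra. }
  (* At [t0] this is [Uex t0]. At [t0 + tau], the rotation by [exp (i tau bsym)] of [w - fJ] is the
     exact value minus one step of the scheme from [fJ]. *)
  set (w := fun t k => Cplus (hw 1 t0 z zt t k) (Cmult Ci (Inc (t - t0) c fJ k))).
  assert (E1 : nb r (fsub (w (t0 + tau)) (w t0)) (K0 * tau * (t0 + tau - t0))).
  { assert (CI : forall k x, cder (fun s => Inc (s - t0) c fJ k) x (dInc (x - t0) c fJ k)).
    { intros k x. apply (cder_shift (fun s => Inc s c fJ k)). now apply cder_Inc. }
    apply mvt_nb with (fun t k => Cplus (hw_der 1 t0 (fun t => fsq (z t)) t k) (Cmult Ci (dInc (t - t0) c fJ k))).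
    - apply Rmult_le_pos; lra.
    - lra.
    - intros k t Ht. unfold w. apply cder_plus.
      + apply cder_hw; auto. apply sol_wave. lra.
      + apply cder_scal. apply CI.
    - intros k. unfold w. apply ccont_plus.
      + apply ccont_hw; apply ccont_restrict with 0 T; try lra; [apply sol_ccont|apply sol_ccont_t].
      + apply ccont_cder. intros x. eexists. apply cder_scal. apply CI.
    - intros t Ht. apply local_der; auto. }
  assert (E2 := nb_unimod r _ _ (fun k => tau * bsym k) (nb_plus _ _ _ _ _ E1 Hn)).
  assert (Hd : nb r (fsub fJ f) (tau ^ 2)).
  { revert Hn. apply nb_le. intros k. unfold fsub. rewrite <- Cmod_opp. apply Req_le. f_equal. ring. }
  assert (E3 := Psi1_stable r Cb tau t0 a b fJ f (3 * M) M (tau ^ 2) Hr HC (Rlt_le _ _ Htau)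
    (mean_le t0 ltac:(lra)) HJ Hf J0 eq_refl Hd).
  assert (E := nb_plus _ _ _ _ _ E2 E3).
  apply nb_mono with (K0 * tau * (t0 + tau - t0) + tau ^ 2 +
       (tau ^ 2 + tau * ((27 * Cb * (3 * M) + 2 * M) * tau ^ 2))).
  - unfold K1. replace (t0 + tau - t0) with tau by ring.
    assert (Q : 0 <= (27 * Cb * (3 * M) + 2 * M) * tau ^ 2).
    { apply Rmult_le_pos; [|lra]. assert (0 <= 27 * Cb * (3 * M)) by (repeat apply Rmult_le_pos; lra). lra. }
    assert (tau * ((27 * Cb * (3 * M) + 2 * M) * tau ^ 2) <= 1 * ((27 * Cb * (3 * M) + 2 * M) * tau ^ 2))
      by (apply Rmult_le_compat_r; lra). lra.
  - revert E. apply nb_ext. intros k. unfold fadd, fsub.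
    rewrite (Psi1_Inc r Cb tau t0 a b fJ (3 * M)) by (auto; lra). fold c.
    rewrite (Uex_hw t0 (t0 + tau)). unfold w.
    replace (t0 + tau - t0) with tau by ring. replace (t0 - t0) with 0 by ring.
    rewrite Inc_0, hw_self. fold f. rewrite (Rmult_comm (bsym k) tau). ring.
Qed.

(** * Propagation of the error *)

(** The Lipschitz rate on the ball of radius [3 M + 1]: [3 M] for the exact solution and a margin of
    1 for the numerical one. *)
Definition stab_rate : R := 27 * Cb * (3 * M + 1) + 2 * M.
Lemma stab_rate_pos : 0 <= stab_rate.
Proof.
  assert (P := Cb_pos). assert (PM := sol_M0).
  apply Rplus_le_le_0_compat; apply Rmult_le_pos; lra.
Qed.

Definition growth : R := K1 * T * exp (stab_rate * T).

Lemma growth_bound tau n : 0 < tau -> INR n * tau <= T ->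
  K1 * (INR n * tau) * exp (stab_rate * (INR n * tau)) <= growth.
Proof.
  intros Ht Hn. assert (PK := K1_pos). assert (P := Cb_pos). assert (PM := sol_M0).
  assert (P0 : 0 <= INR n * tau) by (apply Rmult_le_pos; [apply pos_INR|lra]).
  assert (PS := stab_rate_pos).
  unfold growth. apply Rmult_le_compat.
  - now apply Rmult_le_pos.
  - apply Rlt_le, exp_pos.
  - now apply Rmult_le_compat_l.
  - assert (E : stab_rate * (INR n * tau) <= stab_rate * T) by now apply Rmult_le_compat_l.
    destruct E as [E|E]; [now apply Rlt_le, exp_increasing|rewrite E; lra].
Qed.

Lemma u_n_mode0 tau n : u_n tau phi0 psi0 n 0%Z = RtoC 0.
Proof.
  induction n as [|n IH]; cbn [u_n].
  - rewrite <- Uex_0. reflexivity.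
  - now apply Psi1_0.
Qed.

(** Discrete Gronwall with a bootstrap: the induction hypothesis and [tau * growth <= 1] bound the
    error by 1, hence the numerical value stays in the ball where [stab_rate] is valid for the next
    step. *)
Lemma global_error tau n : 0 < tau -> tau <= 1 -> tau * growth <= 1 -> INR n * tau <= T ->
  nb r (fsub (Uex (INR n * tau)) (u_n tau phi0 psi0 n))
     (tau * (K1 * (INR n * tau) * exp (stab_rate * (INR n * tau)))).
Proof.
  intros Ht Ht1 Htg. assert (PK := K1_pos). assert (P := Cb_pos). assert (PM := sol_M0).
  induction n as [|n IH]; intros Hn.
  - simpl. replace (tau * (K1 * (0 * tau) * exp (stab_rate * (0 * tau)))) with 0 by ring.
    apply zero_nb. intros k. unfold fsub. rewrite Rmult_0_l, Uex_0. unfold Cminus. apply Cplus_opp_r.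
  - cbn [u_n]. fold a b. rewrite S_INR in *.
    assert (Pn := pos_INR n). assert (Pnt : 0 <= INR n * tau) by (apply Rmult_le_pos; lra).
    assert (Hn' : INR n * tau <= T) by lra. assert (Hn2 : INR n * tau + tau <= T) by lra. specialize (IH Hn').
    set (tn := INR n * tau) in *.
    set (e := tau * (K1 * tn * exp (stab_rate * tn))) in *.
    assert (He1 : e <= 1).
    { assert (Hg := growth_bound tau n Ht Hn'). fold tn in Hg. unfold e.
      apply Rle_trans with (tau * growth); auto. apply Rmult_le_compat_l; lra. }
    assert (Pe := nb_pos _ _ _ IH).
    assert (HU := Uex_r tn ltac:(lra)).
    assert (HU1 : nb r (Uex tn) (3 * M + 1)) by (revert HU; apply nb_mono; lra).
    assert (Hu : nb r (u_n tau phi0 psi0 n) (3 * M + 1)).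
    { apply nb_mono with (3 * M + e); [lra|].
      assert (H := nb_minus _ _ _ _ _ HU IH). revert H. apply nb_ext. intros k. unfold fsub. ring. }
    assert (E1 := local_error tn tau ltac:(lra) Ht ltac:(lra) Ht1).
    assert (Hm : Rabs (a * tn + b) <= M) by (apply mean_le; lra).
    assert (E2 := Psi1_stable r Cb tau tn a b _ _ _ M e Hr HC (Rlt_le _ _ Ht) Hm
      HU1 Hu (Uex_mode0 tn) (u_n_mode0 tau n) IH).
    assert (E := nb_plus _ _ _ _ _ E1 E2).
    replace ((INR n + 1) * tau) with (tn + tau) by (unfold tn; ring).
    apply nb_mono with (K1 * tau ^ 2 + (e + tau * (stab_rate * e))).
    + assert (PS := stab_rate_pos).
      (* The local error [K1 tau^2] is paid for by the increase of [tn] to [tn + tau], and the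
         factor [1 + stab_rate tau] by the exponential. *)
      assert (X1 : 1 + stab_rate * tau <= exp (stab_rate * tau)) by apply exp_ineq1_le.
      assert (PSt : 0 <= stab_rate * tau) by (apply Rmult_le_pos; lra).
      assert (X2 : 1 <= exp (stab_rate * (tn + tau))).
      { eapply Rle_trans; [|apply exp_ineq1_le].
        assert (0 <= stab_rate * (tn + tau)) by (apply Rmult_le_pos; lra). lra. }
      assert (X3 : exp (stab_rate * (tn + tau)) = exp (stab_rate * tn) * exp (stab_rate * tau)).
      { rewrite <- exp_plus. f_equal. ring. }
      assert (X4 : e * (1 + stab_rate * tau) <= e * exp (stab_rate * tau)) by now apply Rmult_le_compat_l.
      assert (X5 : K1 * tau ^ 2 * 1 <= K1 * tau ^ 2 * exp (stab_rate * (tn + tau))).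
      { apply Rmult_le_compat_l; auto. apply Rmult_le_pos; auto. apply pow2_ge_0. }
      replace (tau * (K1 * (tn + tau) * exp (stab_rate * (tn + tau)))) with
        (K1 * tau ^ 2 * exp (stab_rate * (tn + tau)) + e * exp (stab_rate * tau)) by
        (unfold e; rewrite X3; ring). lra.
    + revert E. apply nb_ext. intros k. unfold fadd, fsub. fold a b. ring.
Qed.

(** [zt] is recovered by applying [<d^2>], whose symbol is at most [jj k]; this costs the two
    derivatives that separate [r - 2] from [r]. *)
Lemma final_error tau n : 0 < tau -> tau <= 1 -> tau * growth <= 1 -> INR n * tau <= T ->
  nb r (fsub (z (INR n * tau)) (z_n tau phi0 psi0 n)) (tau * growth) /\
  nb (r - 2) (fsub (zt (INR n * tau)) (zt_n tau phi0 psi0 n)) (tau * growth).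
Proof.
  intros Ht Ht1 Htg Hn. assert (Pn := pos_INR n).
  assert (Pnt : 0 <= INR n * tau) by (apply Rmult_le_pos; lra).
  assert (E : nb r (fsub (Uex (INR n * tau)) (u_n tau phi0 psi0 n)) (tau * growth)).
  { assert (H := global_error tau n Ht Ht1 Htg Hn). revert H. apply nb_mono.
    apply Rmult_le_compat_l; [lra|]. now apply growth_bound. }
  set (tn := INR n * tau) in *. set (u := u_n tau phi0 psi0 n) in *. split.
  - assert (H := nb_zap_diff (Uex tn) u (a * tn + b) (a * tn + b) _ 0 E).
    rewrite Rplus_0_r in H. apply nb_ext with (fsub (zap (a * tn + b) (Uex tn)) (zap (a * tn + b) u)).
    + intros k. unfold fsub. rewrite Uex_zap by lra. reflexivity.
    + apply H. rewrite Rminus_diag, Rabs_R0. lra.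
  - assert (H := nb_minus _ _ _ _ _ E (nb_conj _ _ _ E)).
    apply nb_mono with (/ 2 * (tau * growth + tau * growth)); [lra|].
    apply nb_ext with (Defs.mult (fun k => Cmult (ci (/ 2)) (RtoC (bsym k)))
      (fsub (fsub (Uex tn) u) (fconj (fsub (Uex tn) u)))).
    + intros k. unfold fsub at 1. rewrite <- (Uex_zt tn k) by lra.
      unfold zt_n. fold u. fold a. unfold fadd, fscal, bracket, Defs.mult, fsub at 1 2 3 4.
      rewrite fconj_sub. unfold fsub. ring.
    + apply nb_mult with r; [lra| |exact H]. intros k. unfold ci.
      assert (Hb := bsym_bounds k). assert (Hk := pow2_ge_0 (IZR k)).
      rewrite !Cmod_mult, !Cmod_R, Cmod_Ci, (Rabs_right (/ 2)), Rabs_right by lra.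
      rewrite <- (wt_shift r). assert (W := wt_pos (r - 2) k).
      assert (wt (r - 2) k * bsym k <= wt (r - 2) k * jj k) by (apply Rmult_le_compat_l; unfold jj; lra).
      lra.
Qed.

End Solution.

(** * Choice of the exponent and conclusion *)

(** The regularity that the estimate of [err] consumes. It coincides with [r + p(r)] for [r > 3/2];
    for smaller [r] the line [r/2 + 5/4] lies below. At [r = 5/2] the positive [eps] lifts it off
    the logarithmic case. *)
Definition reduced_index (r eps : R) : R :=
  if Rlt_dec r (5 / 2) then r / 2 + 5 / 4 else r + p_eps r eps.

Lemma reduced_index_spec r eps : 1 <= r -> 0 < eps ->
  err_exponents r (reduced_index r eps) /\ reduced_index r eps <= r + p_eps r eps /\
  r <= r + p_eps r eps.
Proof.
  intros Hr He. unfold err_exponents, reduced_index, p_eps.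
  destruct (Rlt_dec r (5 / 2)); repeat destruct (Rle_dec _ _); repeat destruct (Rlt_dec _ _); lra.
Qed.

Theorem theorem1 :
  forall r : R, 1 <= r ->
  exists eps0 : R, 0 < eps0 /\
  forall eps : R, 0 < eps < eps0 ->
  let s := r + p_eps r eps in
  forall T M : R, 0 < T ->
  exists C : R, 0 < C /\
  forall (phi0 psi0 : Fc) (z zt : R -> Fc),
    real_valued phi0 -> real_valued psi0 ->
    boussinesq_sol T phi0 psi0 z zt ->
    cont_Hs s T z -> cont_Hs (s - 2) T zt ->
    (forall t, 0 <= t <= T -> Hs_norm s (z t) <= M) ->
    (forall t, 0 <= t <= T -> Hs_norm (s - 2) (zt t) <= M) ->
    exists tau0 : R, 0 < tau0 /\
    forall (tau : R) (n : nat), 0 < tau <= tau0 -> INR n * tau <= T ->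
      in_Hs r (fsub (z (INR n * tau)) (z_n tau phi0 psi0 n)) /\
      in_Hs (r - 2) (fsub (zt (INR n * tau)) (zt_n tau phi0 psi0 n)) /\
      Hs_norm r (fsub (z (INR n * tau)) (z_n tau phi0 psi0 n))
      + Hs_norm (r - 2) (fsub (zt (INR n * tau)) (zt_n tau phi0 psi0 n)) <= C * tau.
Proof.
  (* Every positive [eps] is admissible in [reduced_index_spec]; the value 1 is arbitrary. *)
  intros r Hr. exists 1. split; [lra|]. intros eps Heps s T M HT.
  destruct (reduced_index_spec r eps Hr (proj1 Heps)) as (Hexp & Hs0 & Hrs). fold s in Hs0, Hrs.
  set (s0 := reduced_index r eps) in *.
  destruct (stab_bil r Hr) as [Cb HC].
  destruct (Bil_bound_weight r s0 errD (err_kernel r s0 Hexp)) as [Ce HCe].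
  set (G := growth T (Rabs M) Cb Ce).
  (* Each of the two norms is at most [tau * G]. As [Cb] and [Ce] are fixed before the data, [G]
     depends only on [r], [eps], [T] and [M]. *)
  exists (2 * Rabs G + 1). assert (PG := Rabs_pos G). split; [lra|].
  intros phi0 psi0 z zt Rphi Rpsi Hsol Hcz Hczt Hz Hzt.
  assert (Hz' : forall t, 0 <= t <= T -> nb s (z t) (Rabs M)).
  { intros t Ht. apply nb_of_Hs; [now apply Hcz|]. eapply Rle_trans; [now apply Hz|apply Rle_abs]. }
  assert (Hzt' : forall t, 0 <= t <= T -> nb (s - 2) (zt t) (Rabs M)).
  { intros t Ht. apply nb_of_Hs; [now apply Hczt|]. eapply Rle_trans; [now apply Hzt|apply Rle_abs]. }
  (* Guarantees [tau <= 1] and [tau * G <= 1] at once, uniformly over all data with the same bound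
     [M]. *)
  exists (/ (Rabs G + 1)). split; [apply Rinv_0_lt_compat; lra|].
  intros tau n [Htau Htau0] Hn.
  assert (HtG : tau * (Rabs G + 1) <= 1).
  { apply Rle_trans with (/ (Rabs G + 1) * (Rabs G + 1)); [apply Rmult_le_compat_r; lra|].
    rewrite Rinv_l; lra. }
  assert (PtG : 0 <= tau * Rabs G) by (apply Rmult_le_pos; lra).
  assert (HG : tau * G <= tau * Rabs G) by (apply Rmult_le_compat_l; [lra|apply Rle_abs]).
  destruct (final_error r s T (Rabs M) Cb phi0 psi0 z zt Hr Hrs HT HC Rphi Rpsi Hsol Hcz Hczt Hz' Hzt'
    s0 Ce Hs0 HCe tau n) as [E1 E2]; try assumption; try (fold G; lra).
  fold G in E1, E2.
  destruct (Hs_of_nb _ _ _ E1) as [I1 N1]. destruct (Hs_of_nb _ _ _ E2) as [I2 N2].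
  repeat split; auto. lra.
Qed.
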